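(* Let $A>0$ be a constant and let $V\in W^{1,1}(\mathbb{R})$ satisfy $\|V_x\|_1<A$. Let $u_0\in L^1(\mathbb{R})$ be nonnegative with $$\int_{\mathbb{R}}u_0(x)\,dx=1\quad\text{and}\quad \int_{\mathbb{R}}u_0(x)|x|\,dx<\infty .$$ Then the initial value problem $$U_t=-AUU_x+U_x\,(V*U_x),\qquad U(x,0)=U_0(x)=\int_{-\infty}^x u_0(y)\,dy-\frac12$$ has a weak solution $U\in C(\mathbb{R}\times(0,\infty))$ with $U_x\in L^\infty_{loc}\big((0,\infty),L^\infty(\mathbb{R})\big)$, in the sense that $$-\int_0^\infty\!\!\int_{\mathbb{R}}U\varphi_t\,dx\,dt-\int_{\mathbb{R}}U_0(x)\varphi(x,0)\,dx=\frac A2\int_0^\infty\!\!\int_{\mathbb{R}}U^2\varphi_x\,dx\,dt+\int_0^\infty\!\!\int_{\mathbb{R}}U_x\,(V_x*U)\,\varphi\,dx\,dt$$ for all $\varphi\in C_c^\infty(\mathbb{R}\times[0,\infty))$. Moreover, this solution satisfies $$\|U(\cdot,t)-W^R(\cdot,t)\|_p\le C\,t^{-\frac12\left(1-\frac1p\right)}\left(\log(2+t)\right)^{\frac12\left(1+\frac1p\right)}$$ for a constant $C>0$, for all $t>0$ and each $p\in(1,\infty]$, where $$W^R(x,t)=\begin{cases}-\frac12 & \text{for } x\le-\frac{At}{2},\\ \frac{x}{At} & \text{for } -\frac{At}{2}<x<\frac{At}{2},\\ \frac12 & \text{for } x\ge\frac{At}{2}.\end{cases}$$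
   Context: $\|\cdot\|_p$ is the norm of $L^p(\mathbb{R})$ in the space variable $x$ (with $\frac1p=0$ for $p=\infty$); $*$ is convolution in $x$, $(f*g)(x)=\int_{\mathbb{R}}f(x-y)g(y)\,dy$. The initial value problem is the equation for the primitive $U(x,t)=\int_{-\infty}^x u(y,t)\,dy-\frac12$ of a solution of the inviscid aggregation equation $u_t=(u\,(K'*u))_x$ with interaction kernel $K'(x)=-\frac A2H(x)+V(x)$, where $H(x)=-1$ for $x<0$ and $H(x)=1$ for $x>0$. The function $W^R$ is the unique entropy solution (rarefaction wave) of the Riemann problem $W_t+AWW_x=0$, $W(x,0)=\frac12H(x)$. *)

(* Defs.v *)
From HB Require Import structures.
From mathcomp Require Import all_boot all_order all_algebra.
From mathcomp Require Import all_classical all_reals all_analysis.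

Set Implicit Arguments.
Unset Strict Implicit.
Unset Printing Implicit Defensive.
Import Order.TTheory GRing.Theory Num.Theory.
Import numFieldNormedType.Exports.

Local Open Scope classical_set_scope.
Local Open Scope ring_scope.

(* For finite-dimensional E (here R and R * R) continuity of all iterated
   directional derivatives is the same as that of all iterated partial ones. *)
Fixpoint is_Ck (R : realType) (E : normedModType R) (k : nat) (f : E -> R) :
    Prop :=
  continuous f /\
  if k is k'.+1 then
    forall v : E, (forall p, derivable f p v) /\ is_Ck k' ('D_v f)
  else True.

Definition fsupport (R : realType) (E : normedModType R) (f : E -> R) : set E :=
  closure [set p | f p != 0].

(* C_c^oo(D), for D open. *)
Definition test_function (R : realType) (E : normedModType R) (D : set E)
    (f : E -> R) : Prop :=
  [/\ forall k, is_Ck k f, compact (fsupport f) & fsupport f `<=` D].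

Definition in_L1 (R : realType) (f : R -> R) : Prop :=
  lebesgue_measure.-integrable setT (EFin \o f).

(* V belongs to W^{1,1}(R) and Vx is its weak derivative. *)
Definition W11_with_deriv (R : realType) (V Vx : R -> R) : Prop :=
  [/\ in_L1 V, in_L1 Vx &
    forall phi : R -> R, test_function setT phi ->
      \int[lebesgue_measure]_x (V x * (phi^`())%classic x) =
      - \int[lebesgue_measure]_x (Vx x * phi x)].

Definition conv (R : realType) (f g : R -> R) (x : R) : R :=
  \int[lebesgue_measure]_y (f (x - y) * g y).

(* In a pair of type R * R the first component is the space variable x and the
   second one the time t; functions on R x (0, oo) or R x [0, oo) are total
   functions on R * R, whose values at other times play no role. *)

Definition dx (R : realType) (phi : R * R -> R) : R * R -> R :=
  'D_((1, 0) : R * R) phi.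

Definition dt (R : realType) (phi : R * R -> R) : R * R -> R :=
  'D_((0, 1) : R * R) phi.

Definition upper_half (R : realType) : set (R * R) := setT `*` `]0, +oo[.

Definition spacetime_int (R : realType) (f : R * R -> R) : R :=
  \int[lebesgue_measure]_(t in `]0, +oo[)
    \int[lebesgue_measure]_x f (x, t).

Definition spacetime_integrable (R : realType) (f : R * R -> R) : Prop :=
  (lebesgue_measure \x lebesgue_measure)%E.-integrable
    (@upper_half R) (EFin \o f).

(* Ux is the weak x-derivative of U on R x (0, oo). *)
Definition weak_dx (R : realType) (U Ux : R * R -> R) : Prop :=
  forall phi : R * R -> R, test_function (@upper_half R) phi ->
    spacetime_int (fun z => U z * dx phi z) =
    - spacetime_int (fun z => Ux z * phi z).

(* f belongs to L^oo_loc((0, oo), L^oo(R)). *)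
Definition Linfty_loc_Linfty (R : realType) (f : R * R -> R) : Prop :=
  measurable_fun (@upper_half R) f /\
  forall a b : R, 0 < a -> a < b -> exists M : R,
    {ae lebesgue_measure, forall t : R, a <= t <= b ->
      ('N[lebesgue_measure]_+oo[EFin \o (fun x => f (x, t))] <= M%:E)%E}.

Definition primitive0 (R : realType) (u0 : R -> R) (x : R) : R :=
  (\int[lebesgue_measure]_(y in `]-oo, x]) u0 y) - 2^-1.

(* C_c^oo(R x [0, oo)) is taken to be the set of restrictions to R x [0, oo) of
   functions in C_c^oo(R^2).  The integrability clauses are needed because the
   integrals in the identity have a default value when they do not exist. *)
Definition weak_solution (R : realType) (A : R) (Vx U0 : R -> R)
    (U Ux : R * R -> R) : Prop :=
  forall phi : R * R -> R, test_function setT phi ->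
  let VxU (z : R * R) := conv Vx (fun y => U (y, z.2)) z.1 in
  [/\ spacetime_integrable (fun z => U z * dt phi z),
      spacetime_integrable (fun z => U z ^+ 2 * dx phi z),
      spacetime_integrable (fun z => Ux z * VxU z * phi z) &
      - spacetime_int (fun z => U z * dt phi z)
        - \int[lebesgue_measure]_x (U0 x * phi (x, 0)) =
      A / 2 * spacetime_int (fun z => U z ^+ 2 * dx phi z)
        + spacetime_int (fun z => Ux z * VxU z * phi z)].

Definition rarefaction (R : realType) (A : R) (z : R * R) : R :=
  let: (x, t) := z in
  if x <= - (A * t / 2) then - 2^-1
  else if x < A * t / 2 then x / (A * t)
  else 2^-1.

(* 1 / p, with value 0 at p = +oo. *)
Definition inv_exponent (R : realType) (p : \bar R) : R := fine (p^-1)%E.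

(* Main.v *)
Require Import Defs.
From HB Require Import structures.
From mathcomp Require Import all_boot all_order all_algebra.
From mathcomp Require Import all_classical all_reals all_analysis.
From mathcomp Require Import measurable_realfun.
From mathcomp Require Import ring lra.

Set Implicit Arguments.
Unset Strict Implicit.
Unset Printing Implicit Defensive.
Import Order.TTheory GRing.Theory Num.Theory.
Import numFieldNormedType.Exports.

Local Open Scope classical_set_scope.
Local Open Scope ring_scope.

(** The theorem is proved by following the mass instead of solving the equation
    for U.  Label the initial mass by its position xi, let P be the probability
    with density u0, and let G = U(., 0) be its distribution function minus 1/2,
    a coordinate uniformly distributed on [-1/2, 1/2].  Let kerV be the decaying
    primitive of Vx, that is, V up to a null set.  The equation says that u is
    transported by the field A U - V * u, and U is constant along the paths, so
    the particle of label xi should move according to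

      d/dt X(t, xi) = A G(xi) - \int kerV (X(t, xi) - X(t, eta)) dP(eta).

    The first term pulls two particles apart at the rate A per unit of mass
    between them; as the increments of kerV are controlled by Vx, the second one
    pushes them together at most at the rate a = ||Vx||_1, since a cloud that has
    been stretched has a small density.  Hence X(t, .) stretches the coordinate G
    at least by (A - a) t [expands], the cloud at time t has a density of at most
    1 / ((A - a) t), and every estimate below comes from this one.

    Although kerV is only absolutely continuous, the velocity is Lipschitz in the
    configuration, in the sup norm, with the constant 2 L + 1 / (3 t) at time t
    [vel_lip]: the part of Vx below a high level L is bounded, and the rest,
    small in L1, is averaged against a density of order 1 / t.  The singularity
    1 / (3 t) makes errors grow like t^(1/3) only, so the Euler scheme converges
    under halving of the step [euler_halving], to a flow which satisfies the
    differential equation at positive times [flow_exists].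

    The solution U(x, t) is the centred distribution function of X(t, .) under P,
    a superposition of steps located at the particles.  It is Lipschitz in x by
    the density bound.  Its derivative Ux is the Radon-Nikodym density of the
    measure swept by the particles in space-time [spread_density].  In the weak
    formulation each term is an average over particles: testing Ux is evaluating
    along the paths [density_test], U ^ 2 is again a superposition of steps, with
    weights 2 G [U_square], and Vx * U is the drift [conv_U].  The identity then
    is the average over xi of the fundamental theorem of calculus in time along
    the path of xi [particle_balance].

    For the rate of convergence, the drift is at most a, and at most
    ||kerV||_1 / ((A - a) t) by the density bound; hence it is O(1 / (2 + t)) and
    X(t, xi) stays within |xi| + O(log (2 + t)) of A t G(xi) [X_rate].  The
    rarefaction wave is the superposition of steps located at A t G(xi)
    [fan_rarefaction], so that the L1 distance is O(log (2 + t))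
    [superposition_gap].  Both functions being O(1 / t)-Lipschitz in x, this
    controls the sup norm [lipschitz_sup], and the other norms follow by
    interpolation.  The kernel kerV is integrable because it is close to a local
    average of V, by the definition of the weak derivative [integrable_kernel]. *)

(** * Integration *)

Lemma eq_ler (R : realType) (x y : R) : x = y -> x <= y.
Proof. by move=> ->. Qed.

Section measure_preliminaries.
Context d (T : measurableType d) (R : realType).
Implicit Types (m : {measure set T -> \bar R}) (f g : T -> R).

Lemma EFin_Rintegral m (D : set T) f : measurable D ->
  m.-integrable D (EFin \o f) ->
  (\int[m]_(x in D) f x)%:E = (\int[m]_(x in D) (f x)%:E)%E.
Proof. by move=> mD fi; rewrite /Rintegral fineK//; exact: integrable_fin_num. Qed.

Lemma integrable_scale m (k : R) f : m.-integrable setT (EFin \o f) ->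
  m.-integrable setT (EFin \o (fun x => k * f x)).
Proof.
move=> /(integrableZl measurableT k).
by apply: eq_integrable => // x _; rewrite /= EFinM.
Qed.

Lemma integrable_dominated m f g : measurable_fun setT f ->
  m.-integrable setT (EFin \o g) -> (forall x, `|f x| <= g x) ->
  m.-integrable setT (EFin \o f).
Proof.
move=> mf ig fg; apply: (le_integrable measurableT _ _ ig) => /=.
  exact/measurable_EFinP.
by move=> x _; rewrite lee_fin (le_trans (fg x))// ler_norm.
Qed.

Lemma integrable_bounded_support m (B : set T) (C : R) f :
  measurable B -> (m B < +oo)%E -> measurable_fun setT f ->
  (forall x, `|f x| <= C * \1_B x) -> m.-integrable setT (EFin \o f).
Proof.
move=> mB Bfin mf fB; apply: (@integrable_dominated _ _ (fun x => C * \1_B x)) => //.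
have -> : EFin \o (fun x => C * \1_B x) = (fun x => C%:E * (EFin \o \1_B) x)%E.
  by apply/funext => x /=; rewrite EFinM.
apply: integrableZl => //; apply/integrableP; split.
  by apply/measurable_EFinP; exact: measurable_indic.
under eq_integral do rewrite /= ger0_norm//.
by rewrite integral_indic// setIT.
Qed.

Lemma integrable_bounded (P : probability T R) (C : R) f :
  measurable_fun setT f -> (forall x, `|f x| <= C) ->
  P.-integrable setT (EFin \o f).
Proof.
move=> mf fC; apply: (@integrable_bounded_support _ setT C) => //.
  by apply: (@le_lt_trans _ _ 1%E); [exact: probability_le1|exact: ltry].
by move=> x; rewrite indicT mulr1.
Qed.

Lemma Rintegral_cst_prob (P : probability T R) (C : R) : \int[P]_x C = C.
Proof.
rewrite (Rintegral_cst P measurableT) -[RHS]mulr1; congr (C * _).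
by rewrite -[RHS]/(fine 1%:E); congr fine; exact: probability_setT.
Qed.

Lemma integral_cst_prob (P : probability T R) (c : R) : (\int[P]_x c%:E = c%:E)%E.
Proof.
rewrite -[in RHS](Rintegral_cst_prob P c) EFin_Rintegral//.
by apply: (@integrable_bounded _ `|c|).
Qed.

Lemma Rintegral_prob_bound (P : probability T R) (C : R) f :
  measurable_fun setT f -> (forall x, `|f x| <= C) ->
  `|\int[P]_x f x| <= C.
Proof.
move=> mf fC; have fi := integrable_bounded P mf fC.
apply: (le_trans (le_normr_Rintegral measurableT fi)).
rewrite -[leRHS](Rintegral_cst_prob P).
apply: le_Rintegral => //.
- apply: (@integrable_bounded _ C); first exact: measurableT_comp.
  by move=> x; rewrite normr_id.
- by apply: (@integrable_bounded _ `|C|).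
Qed.

Lemma Rintegral_opp m f : \int[m]_x (- f x) = - \int[m]_x f x.
Proof.
rewrite /Rintegral integralE [in RHS]integralE.
have -> : (\int[m]_x (fun x => (- f x)%:E)^\+ x)%E = (\int[m]_x (fun x => (f x)%:E)^\- x)%E.
  by apply: eq_integral => x _; rewrite funeposE funenegE.
have -> : (\int[m]_x (fun x => (- f x)%:E)^\- x)%E = (\int[m]_x (fun x => (f x)%:E)^\+ x)%E.
  by apply: eq_integral => x _; rewrite funeposE funenegE EFinN oppeK.
by case: (\int[m]_x _)%E (\int[m]_x _)%E => [r| |] [s| |] //=; rewrite ?opprB ?oppr0.
Qed.

Lemma integrable_density (m : {sigma_finite_measure set T -> \bar R}) g :
  measurable_fun setT g -> (forall x, 0 <= g x) ->
  (\int[m]_x (g x)%:E = 1)%E ->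
  exists P : probability T R,
    (forall A, measurable A -> P A = \int[m]_(x in A) (g x)%:E)%E /\
    (forall f : T -> \bar R, measurable_fun setT f -> (forall x, 0 <= f x)%E ->
      (\int[P]_x f x = \int[m]_x (f x * (g x)%:E))%E).
Proof.
move=> mg g0 g1.
pose nu (A : set T) := (\int[m]_(x in A) (g x)%:E)%E.
have nu0 : nu set0 = 0%E by rewrite /nu integral_set0.
have nuge0 A : (0 <= nu A)%E by apply: integral_ge0 => x _; rewrite lee_fin.
have nusig : semi_sigma_additive nu.
  move=> F mF tF mUF; rewrite /nu; apply: cvg_toP.
    apply: ereal_nondecreasing_is_cvgn => a b ab.
    by apply: lee_sum_nneg_natr => // k _ _; exact: nuge0.
  rewrite ge0_integral_bigcup//=.
  - by apply/measurable_EFinP; exact: measurable_funTS.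
  - by move=> x _; rewrite lee_fin.
pose nuM := isMeasure.Build _ _ _ nu nu0 nuge0 nusig.
pose numeas : {measure set T -> \bar R} := HB.pack nu nuM.
have nuT : numeas setT = 1%E by rewrite /= /nu g1.
pose nuP := Measure_isProbability.Build _ _ _ numeas nuT.
pose P : probability T R := HB.pack nu nuM nuP.
have PE A : P A = (\int[m]_(x in A) (g x)%:E)%E by [].
have Pm : P `<< m.
  apply/null_content_dominatesP => A mA mA0; rewrite PE; apply: null_set_integral => //.
  by apply/measurable_EFinP; exact: measurable_funTS.
exists P; split=> // f mf f0.
rewrite -(Radon_Nikodym_SigmaFinite.change_of_variables Pm)//.
have RNi := Radon_Nikodym_SigmaFinite.f_integrable Pm.
have ae : ae_eq m setT (Radon_Nikodym_SigmaFinite.f P m) (EFin \o g).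
  apply: integral_ae_eq => //; first exact/measurable_EFinP.
  by move=> E _ mE; rewrite -Radon_Nikodym_SigmaFinite.f_integral//.
apply: ae_eq_integral => //.
- by apply: emeasurable_funM => //; exact: measurable_int RNi.
- by apply: emeasurable_funM => //; exact/measurable_EFinP.
- exact: ae_eqe_mul2l.
Qed.

(** Joint measurability of Caratheodory functions: the second variable is
    replaced by a grid point to its left, and the mesh is sent to zero. *)
Lemma caratheodory_measurable (f : T * measurableTypeR R -> R) :
  (forall t, measurable_fun setT (fun x => f (x, t))) ->
  (forall x, continuous (fun t : R => f (x, t))) ->
  measurable_fun setT f.
Proof.
move=> mf cf.
pose q (n : nat) (j : int) : R := j%:~R / n.+1%:R.
pose h n (z : T * measurableTypeR R) := f (z.1, q n (Num.floor (n.+1%:R * (z.2 : R)))).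
apply: (@measurable_fun_cvg _ _ _ _ h).
  move=> n _ B mB; rewrite setTI.
  have -> : h n @^-1` B = \bigcup_(j : int)
     (((fun x => f (x, q n j)) @^-1` B) `*` `[q n j, q n (j + 1)[%classic).
    have n0 : 0 < n.+1%:R :> R by rewrite ltr0n.
    apply/seteqP; split=> [[x t] /= Bh|[x t] [j _ [/= Bh]]].
      exists (Num.floor (n.+1%:R * t)) => //; split=> //=.
      rewrite in_itv/= /q ler_pdivrMr// ltr_pdivlMr// [t * _]mulrC.
      by rewrite floor_le_tmp/= floorD1_gt.
    rewrite in_itv/= /q ler_pdivrMr// ltr_pdivlMr// [t * _]mulrC => jt.
    by rewrite /h/=; rewrite (@floor_def _ _ j).
  apply: countable_bigcupT_measurable; first exact: countableP.
  move=> j; apply: measurableX; last exact: measurable_itv.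
  by rewrite -[X in measurable X]setTI; exact: mf.
move=> [x t] _; rewrite /h/=.
suff qt : q n (Num.floor (n.+1%:R * (t : R))) @[n --> \oo] --> (t : R).
  exact: (cvg_comp _ _ qt (cf x t)).
apply/cvgrPdist_lt => e e0; near=> n.
have n0 : 0 < n.+1%:R :> R by rewrite ltr0n.
have tq : t = (n.+1%:R * t) / n.+1%:R by rewrite mulrAC mulfV ?mul1r// gt_eqF.
rewrite {1}tq /q -mulrBl normrM (@gtr0_norm _ n.+1%:R^-1) ?invr_gt0//.
rewrite ltr_pdivrMr//.
apply: (@le_lt_trans _ _ 1).
  have := floor_le_tmp (n.+1%:R * t); have := floorD1_gt (n.+1%:R * t).
  rewrite intrD ler_norml; set a := _%:~R; lra.
rewrite -ltr_pdivrMr// div1r; near: n.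
exact: (near_infty_natSinv_lt (PosNum e0)).
Unshelve. all: by end_near. Qed.

End measure_preliminaries.

Section real_fubini.
Context d1 d2 (T1 : measurableType d1) (T2 : measurableType d2) (R : realType).
Variables (m1 : {sigma_finite_measure set T1 -> \bar R}).
Variables (m2 : {sigma_finite_measure set T2 -> \bar R}).
Implicit Types f : T1 * T2 -> R.

Lemma Rintegral12 f : (m1 \x m2)%E.-integrable setT (EFin \o f) ->
  \int[m1]_x \int[m2]_y f (x, y) = \int[(m1 \x m2)%E]_z f z.
Proof.
move=> fi; rewrite /Rintegral; congr fine.
rewrite -(integral12_prod_meas1 fi); apply: ae_eq_integral => //.
- apply/measurable_EFinP; apply: measurableT_comp => //.
  exact: measurable_fubini_F fi.
- exact: measurable_fubini_F fi.
- apply: filterS (ae_integrable1 fi) => x /= ? _.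
  by rewrite fineK//; exact: integrable_fin_num.
Qed.

Lemma Rintegral21 f : (m1 \x m2)%E.-integrable setT (EFin \o f) ->
  \int[m2]_y \int[m1]_x f (x, y) = \int[(m1 \x m2)%E]_z f z.
Proof.
move=> fi; rewrite /Rintegral; congr fine.
rewrite -(integral21_prod_meas1 fi); apply: ae_eq_integral => //.
- apply/measurable_EFinP; apply: measurableT_comp => //.
  exact: measurable_fubini_G fi.
- exact: measurable_fubini_G fi.
- apply: filterS (ae_integrable2 fi) => x /= ? _.
  by rewrite fineK//; exact: integrable_fin_num.
Qed.

Lemma Rintegral_exchange f : (m1 \x m2)%E.-integrable setT (EFin \o f) ->
  \int[m1]_x \int[m2]_y f (x, y) = \int[m2]_y \int[m1]_x f (x, y).
Proof. by move=> fi; rewrite Rintegral12// Rintegral21. Qed.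

End real_fubini.

(** Continuity from increments over forward intervals, the form delivered by the
    absolute continuity of the integral. *)
Lemma small_increments_continuous (R : realType) (f : R -> R) :
  (forall e, 0 < e -> exists2 d, 0 < d &
    forall x y, x <= y -> y - x < d -> `|f y - f x| < e) -> continuous f.
Proof.
move=> H z; apply/cvgrPdist_lt => e /H[d d0 key].
near=> y; have [yz|zy] := leP y z.
  apply: key => //; near: y.
  by exists d => //= y /=; rewrite ltr_norml => /andP[].
rewrite distrC; apply: key; first exact: ltW.
near: y; exists d => //= y /=; rewrite ltr_norml => /andP[+ _]; lra.
Unshelve. all: by end_near. Qed.

Section parametric_integral.
Context d1 d2 (T1 : measurableType d1) (T2 : measurableType d2) (R : realType).
Variable P : probability T2 R.

Lemma measurable_Rintegral_param (C : R) (f : T1 * T2 -> R) :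
  measurable_fun setT f -> (forall z, `|f z| <= C) ->
  measurable_fun setT (fun x => \int[P]_y f (x, y)).
Proof.
move=> mf fC.
have m2 x : measurable_fun setT (fun y => f (x, y)) by exact: measurableT_comp.
have -> : (fun x => \int[P]_y f (x, y)) = (fun x => fine (\int[P]_y (f (x, y) + C)%:E) - C).
  apply/funext => x; rewrite -[fine _]/(\int[P]_y (f (x, y) + C)) RintegralD//.
  - by rewrite Rintegral_cst_prob addrK.
  - exact: (@integrable_bounded _ _ _ P C).
  - exact: (@integrable_bounded _ _ _ P `|C|).
apply: measurable_funB => //; apply: measurableT_comp => //.
apply: (measurable_fun_fubini_tonelli_F (fun z => (f z + C)%:E)) => [|z].
  by apply/measurable_EFinP; exact: measurable_funD.
by rewrite lee_fin; have := fC z; rewrite ler_norml; lra.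
Qed.

End parametric_integral.

Section lebesgue_invariance.
Context (R : realType).
Notation mu := (@lebesgue_measure R).

Lemma lebesgue_itvoc_fin (a b : R) : (mu `]a, b]%classic < +oo)%E.
Proof. by rewrite lebesgue_measure_itv/=; case: ifP; rewrite ltry. Qed.

Lemma lebesgue_itvcc_fin (a b : R) : (mu `[a, b]%classic < +oo)%E.
Proof. by rewrite lebesgue_measure_itv/=; case: ifP; rewrite ltry. Qed.

Lemma Rintegral_indic_oc (a b : R) : a <= b ->
  \int[mu]_w \1_(`]a, b]%classic) w = b - a.
Proof.
move=> ab; rewrite /Rintegral integral_indic//= setIT.
have -> : lebesgue_measure `]a, b]%classic = (b - a)%:E; last by [].
rewrite lebesgue_measure_itv/= lte_fin; case: ltP => [_|ba] //.
by rewrite (@le_anti _ _ a b) ?subrr// ab.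
Qed.

Lemma lebesgue_measure_shift (c : R) (A : set R) : measurable A ->
  mu ((fun x => x + c) @^-1` A) = mu A.
Proof.
move=> mA.
have mphi : measurable_fun [set: measurableTypeR R]
  ((fun x => x + c) : measurableTypeR R -> measurableTypeR R).
  exact: measurable_funD.
pose nu : {measure set (measurableTypeR R) -> \bar R} := pushforward mu
   ((fun x => x + c) : measurableTypeR R -> measurableTypeR R).
have -> : mu A = nu mphi A; last by [].
apply: lebesgue_measure_unique => // _ [[a b] _ <-] /=.
rewrite /pushforward.
have -> : (fun x => x + c) @^-1` `]a, b]%classic = `]a - c, b - c]%classic.
  by apply/seteqP; split => x /=; rewrite !in_itv/= ltrBlDr lerBrDr.
rewrite !lebesgue_measure_itv/= !lte_fin ltrD2r.
by case: ifP => // _; rewrite -!EFinB; congr EFin; ring.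
Qed.

Lemma integral_shift (f : R -> \bar R) (c : R) : measurable_fun setT f ->
  (\int[mu]_x f (x + c)%R = \int[mu]_x f x)%E.
Proof.
have ge0 (g : R -> \bar R) : measurable_fun setT g -> (forall x, 0 <= g x)%E ->
    (\int[mu]_x g (x + c)%R = \int[mu]_x g x)%E.
  move=> mg g0.
  have mphi : measurable_fun [set: measurableTypeR R]
    ((fun x => x + c) : measurableTypeR R -> measurableTypeR R).
    exact: measurable_funD.
  have := @ge0_integral_pushforward _ _ (measurableTypeR R) (measurableTypeR R) R
     _ mphi mu setT g measurableT mg (fun x _ => g0 x).
  rewrite preimage_setT /= => <-.
  apply: eq_measure_integral => A mA _; exact: lebesgue_measure_shift.
move=> mf; rewrite [RHS]integralE [LHS]integralE.
congr (_ - _)%E.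
- rewrite -(ge0 (f^\+)%E (measurable_funepos mf) (fun x => funepos_ge0 f x)).
  by apply: eq_integral => x _; rewrite !funeposE.
- rewrite -(ge0 (f^\-)%E (measurable_funeneg mf) (fun x => funeneg_ge0 f x)).
  by apply: eq_integral => x _; rewrite !funenegE.
Qed.

Lemma integral_reflect (f : R -> \bar R) (c : R) : measurable_fun setT f ->
  (\int[mu]_x f (c - x)%R = \int[mu]_x f x)%E.
Proof.
move=> mf.
have ge0 (g : R -> \bar R) : measurable_fun setT g -> (forall x, 0 <= g x)%E ->
    (\int[mu]_x g (- x)%R = \int[mu]_x g x)%E.
  move=> mg g0.
  have mphi : measurable_fun [set: measurableTypeR R]
    ((fun x => - x) : measurableTypeR R -> measurableTypeR R) by exact: measurable_funN.
  have := @ge0_integral_pushforward _ _ (measurableTypeR R) (measurableTypeR R) R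
     _ mphi mu setT g measurableT mg (fun x _ => g0 x).
  rewrite preimage_setT /= => <-.
  apply: eq_measure_integral => A mA _; exact: lebesgue_measureN.
transitivity (\int[mu]_x f (- x)%R)%E.
  have -> : (fun x => f (c - x)) = (fun x => (fun y => f (- y)) (x - c)).
    by apply/funext => x; rewrite opprB.
  apply: (@integral_shift (fun y => f (- y))).
  by apply: (measurableT_comp mf); exact: measurable_funN.
rewrite [RHS]integralE [LHS]integralE.
congr (_ - _)%E.
- rewrite -(ge0 (f^\+)%E (measurable_funepos mf) (fun x => funepos_ge0 f x)).
  by apply: eq_integral => x _; rewrite !funeposE.
- rewrite -(ge0 (f^\-)%E (measurable_funeneg mf) (fun x => funeneg_ge0 f x)).
  by apply: eq_integral => x _; rewrite !funenegE.
Qed.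

End lebesgue_invariance.


(** * The primitive of the interaction kernel *)

Section kernel.
Context (R : realType).
Notation mu := (@lebesgue_measure R).
Variable Vx : R -> R.
Hypothesis Vxi : mu.-integrable setT (EFin \o Vx).

Definition step (y : R) : R := (0 <= y)%R%:R - 2^-1.

Lemma step_bound y : `|step y| <= 2^-1.
Proof. by rewrite /step; case: (0 <= y); rewrite /= ?mulr1n ?mulr0n ler_norml; lra. Qed.

Lemma step_le1 y : `|step y| <= 1.
Proof. by apply: (le_trans (step_bound y)); rewrite invf_le1// ler1n. Qed.

Lemma measurable_step : measurable_fun setT step.
Proof.
have -> : step = (fun y => \1_(`[0, +oo[%classic : set R) y - 2^-1).
  by apply/funext => y; rewrite /step indicE mem_setE in_itv/= andbT.
apply: measurable_funB => //; apply: measurable_indic; exact: measurable_itv.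
Qed.

(** The convolution of Vx with the centred step.  When Vx is the weak derivative
    of an integrable V, this is V almost everywhere; being continuous, it is the
    representative that the particles feel. *)
Definition kerV (z : R) : R := \int[mu]_w (Vx w * step (z - w)).

Lemma measurable_L1 : measurable_fun setT Vx.
Proof. by apply/measurable_EFinP; exact: measurable_int Vxi. Qed.

Lemma integrable_absVx : mu.-integrable setT (EFin \o (fun w => `|Vx w|)).
Proof. exact: (integrable_norm Vxi). Qed.

Lemma integrable_kerV z :
  mu.-integrable setT (EFin \o (fun w => Vx w * step (z - w))).
Proof.
apply: (@integrable_dominated _ _ _ mu _ (fun w : R => `|Vx w|)).
- apply: measurable_funM; first exact: measurable_L1.
  apply: measurableT_comp; first exact: measurable_step.
  exact: measurable_funB.
- exact: integrable_absVx.
- move=> w; by rewrite normrM ler_piMr// step_le1.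
Qed.

Lemma kerV_bound z : `|kerV z| <= (\int[mu]_w `|Vx w|) / 2.
Proof.
apply: (le_trans (le_normr_Rintegral measurableT (integrable_kerV z))).
rewrite -RintegralZr//; last exact: integrable_absVx.
apply: le_Rintegral => //.
- exact: (integrable_norm (integrable_kerV z)).
- have := integrableZr measurableT 2^-1 integrable_absVx.
  by apply: eq_integrable => // x _ /=; rewrite EFinM.
- by move=> w _; rewrite normrM ler_wpM2l// step_bound.
Qed.

Lemma kerV_diff z z' : z' <= z ->
  kerV z - kerV z' = \int[mu]_w (Vx w * \1_(`]z', z]%classic) w).
Proof.
move=> zz; rewrite -RintegralB//; [|exact: integrable_kerV..].
apply: eq_Rintegral => w _; rewrite -mulrBr /step indicE mem_setE in_itv/=.
rewrite !subr_ge0; congr (_ * _).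
case: (leP w z) => wz; case: (leP w z') => wz' /=; rewrite ?(ltW wz')//; try lra.
Qed.

Lemma integrable_absVxM (D : R -> R) : measurable_fun setT D ->
  (forall w, 0 <= D w <= 1) ->
  mu.-integrable setT (EFin \o (fun w => `|Vx w| * D w)).
Proof.
move=> mD D01; apply: (@integrable_dominated _ _ _ mu _ (fun w : R => `|Vx w|)).
- by apply: measurable_funM => //; exact: (measurableT_comp _ measurable_L1).
- exact: integrable_absVx.
- move=> w; have /andP[D0 D1] := D01 w.
  by rewrite normrM normr_id (ger0_norm D0) ler_piMr.
Qed.

Lemma kerV_diff_le z z' : z' <= z ->
  `|kerV z - kerV z'| <= \int[mu]_w (`|Vx w| * \1_(`]z', z]%classic) w).
Proof.
move=> zz; rewrite kerV_diff//.
have mI : measurable_fun setT (\1_(`]z', z]%classic) : R -> R).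
  by apply: measurable_indic; exact: measurable_itv.
have fi : mu.-integrable setT (EFin \o (fun w => Vx w * \1_(`]z', z]%classic) w)).
  apply: (@integrable_dominated _ _ _ mu _ (fun w : R => `|Vx w|)).
  - by apply: measurable_funM => //; exact: measurable_L1.
  - exact: integrable_absVx.
  - by move=> w; rewrite normrM ler_piMr// indicE; case: (_ \in _); rewrite ?normr1 ?normr0.
apply: (le_trans (le_normr_Rintegral measurableT fi)).
apply: le_Rintegral => //.
- exact: (integrable_norm fi).
- by apply: integrable_absVxM => // w; rewrite indicE; case: (_ \in _); rewrite ?lexx ?ler01.
- by move=> w _; rewrite normrM [X in _ * X]ger0_norm// indicE; case: (_ \in _).
Qed.

Lemma kerV_continuous : continuous kerV.
Proof.
apply: small_increments_continuous => e e0.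
have [d [d0 Hd]] := integral_normr_continuous Vxi e0; exists d => //.
move=> z1 z2 z12 zd; apply: (le_lt_trans (kerV_diff_le z12)).
have lt : (mu `]z1, z2]%classic < d%:E)%E.
  rewrite lebesgue_measure_itv/=; case: ifP => _; last by rewrite lte_fin.
  by rewrite -EFinB lte_fin.
have := Hd `]z1, z2]%classic (measurable_itv _) lt.
have -> : (\int[mu]_w (`|Vx w| * \1_(`]z1, z2]%classic) w)) =
          \int[mu]_(w in `]z1, z2]) `|Vx w|.
  rewrite [RHS]Rintegral_mkcond; apply: eq_Rintegral => w _.
  by rewrite patchE indicE; case: ifP => _; rewrite ?mulr1 ?mulr0.
by [].
Qed.

Lemma measurable_kerV : measurable_fun setT kerV.
Proof. exact: (continuous_measurable_fun kerV_continuous). Qed.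

(** The part of Vx below the level L acts like a Lipschitz kernel; the part above
    it is small in L1, and will be averaged over a cloud of bounded density. *)
Lemma Vx_truncation e : 0 < e -> exists2 L, 0 < L &
  \int[mu]_w (`|Vx w| * (L < `|Vx w|)%R%:R) < e.
Proof.
move=> e0.
pose f n w := `|Vx w| * (n%:R < `|Vx w|)%R%:R.
have mf n : measurable_fun setT (f n).
  apply: measurable_funM; first exact: (measurableT_comp _ measurable_L1).
  apply: (@measurableT_comp _ _ _ _ _ _ (fun b : bool => b%:R : R)) => //.
  apply: measurable_fun_ltr => //; exact: (measurableT_comp _ measurable_L1).
have [| | | | |_ _] := @dominated_convergence _ _ _ mu setT measurableT
  (fun n => EFin \o f n) (cst 0%E) (EFin \o (fun w => `|Vx w|)).
- by move=> n; apply/measurable_EFinP; exact: mf.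
- exact: measurable_cst.
- apply: aeW => w _; apply: cvg_near_cst; near=> n.
  rewrite /f/=; have : `|Vx w| <= n%:R by near: n; exact: nbhs_infty_ger.
  by rewrite leNgt => /negbTE ->; rewrite mulr0.
- exact: integrable_absVx.
- apply: aeW => w n _ /=; rewrite lee_fin /f normrM normr_id ler_piMr//.
  by case: (_ < _); rewrite ?normr1 ?normr0.
rewrite integral_cst// mul0e => cv.
have [N _ HN] := cvgr_lt _ (fine_cvg cv) _ e0.
exists N.+1%:R; [by rewrite ltr0n|exact: (HN N.+1 (leqnSn N))].
Unshelve. all: by end_near. Qed.

End kernel.


(** * The mass coordinate and expanding configurations *)

Section labels.
Context (R : realType).
Notation mu := (@lebesgue_measure R).
Variable P : probability (measurableTypeR R) R.

(** The distribution function, centred as the initial datum U0 is. *)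
Definition centered_cdf (xi : R) : R := fine (P `]-oo, xi]%classic) - 2^-1.
Local Notation G := centered_cdf.

Lemma fin_numP A : measurable A -> P A \is a fin_num.
Proof. by move=> mA; exact: fin_num_measure. Qed.

Lemma fine_prob_le1 A : measurable A -> fine (P A) <= 1.
Proof.
by move=> mA; rewrite -lee_fin fineK ?fin_numP// probability_le1.
Qed.

Lemma prob_le1 (A : set R) : measurable A -> (P A <= 1)%E.
Proof. by move=> mA; exact: probability_le1. Qed.

Lemma centered_cdf_nd : {homo G : x y / x <= y}.
Proof.
move=> x y xy; rewrite /centered_cdf lerD2r fine_le ?fin_numP//.
apply: le_measure; rewrite ?inE//; apply: subset_itvl; exact: xy.
Qed.

Lemma centered_cdf_bound xi : `|G xi| <= 2^-1.
Proof.
have h1 : 0 <= fine (P `]-oo, xi]%classic) by exact: fine_ge0.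
have h2 : fine (P `]-oo, xi]%classic) <= 1 by exact: fine_prob_le1.
rewrite /centered_cdf ler_norml; move: h1 h2; set p := fine _; lra.
Qed.

Lemma measurable_nd (f : R -> R) : {homo f : x y / x <= y} ->
  measurable_fun setT f.
Proof. by move=> h; exact: nondecreasing_measurable. Qed.

Lemma measurable_ccdf0 : measurable_fun setT G.
Proof. exact: measurable_nd centered_cdf_nd. Qed.

Lemma centered_cdf_gt (m : R) : m < 2^-1 -> exists b, m < G b.
Proof.
move=> m2.
pose F (n : nat) := `]-oo, n%:R : R]%classic.
have F1 : nondecreasing_seq F.
  by move=> i j ij; apply/subsetPset; apply: subset_itvl; rewrite bnd_simp ler_nat.
have FU : \bigcup_n F n = setT.
  apply/seteqP; split => // x _; exists (Num.bound `|x|) => //=.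
  by rewrite /F/= in_itv/= (le_trans (ler_norm x))// ltW// archi_boundP.
have := @nondecreasing_cvg_mu _ _ _ P F (fun n => measurable_itv _) _ F1.
rewrite FU => /(_ measurableT) cv.
have {}cv : P (F n) @[n --> \oo] --> 1%E by rewrite -(probability_setT P); exact: cv.
have m21 : m + 2^-1 < 1 by lra.
have [N _ HN] := cvgr_gt _ (fine_cvg cv) _ m21.
exists N%:R; have := HN N (leqnn N); rewrite /centered_cdf/=; lra.
Qed.

Lemma centered_cdf_lt (m : R) : - 2^-1 < m -> exists b, G b < m.
Proof.
move=> m2.
pose F (n : nat) := `](- n%:R : R), +oo[%classic.
have F1 : nondecreasing_seq F.
  move=> i j ij; apply/subsetPset; apply: subset_itvr.
  by rewrite bnd_simp lerN2 ler_nat.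
have FU : \bigcup_n F n = setT.
  apply/seteqP; split => // x _; exists (Num.bound `|x|) => //=.
  by rewrite /F/= in_itv/= andbT ltrNl (le_lt_trans (ler_norm _))// normrN archi_boundP.
have := @nondecreasing_cvg_mu _ _ _ P F (fun n => measurable_itv _) _ F1.
rewrite FU => /(_ measurableT) cv.
have {}cv : P (F n) @[n --> \oo] --> 1%E by rewrite -(probability_setT P); exact: cv.
have m21 : 2^-1 - m < 1 by lra.
have [N _ HN] := cvgr_gt _ (fine_cvg cv) _ m21.
exists (- N%:R); have := HN N (leqnn N); rewrite /centered_cdf/=.
have -> : F N = ~` `]-oo, - N%:R]%classic by rewrite /F setCitvl.
rewrite probability_setC// fineB ?fin_numP//=; lra.
Qed.

Hypothesis Gcont : continuous G.

Lemma centered_cdf_surj (m : R) : - 2^-1 < m < 2^-1 -> exists b, G b = m.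
Proof.
move=> /andP[m1 m2].
have [a Ga] := centered_cdf_lt m1; have [b Gb] := centered_cdf_gt m2.
have ab : a <= b.
  by rewrite leNgt; apply/negP => ba; have := centered_cdf_nd (ltW ba); lra.
have [] := @IVT _ G a b m ab.
- by apply: continuous_subspaceT.
- rewrite minEle maxEle; have -> : G a <= G b by lra.
  by rewrite !ltW.
- by move=> c _ <-; exists c.
Qed.

Lemma measurable_ccdf0_le m : measurable [set xi | G xi <= m].
Proof.
have := measurable_ccdf0 measurableT (measurable_itv `]-oo, m]); rewrite setTI.
by congr measurable; apply/seteqP; split => x /=; rewrite in_itv.
Qed.

Lemma measurable_ccdf0_lt m : measurable [set xi | G xi < m].
Proof.
have := measurable_ccdf0 measurableT (measurable_itv `]-oo, m[); rewrite setTI.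
by congr measurable; apply/seteqP; split => x /=; rewrite in_itv.
Qed.

Lemma prob_itv b : P `]-oo, b]%classic = (G b + 2^-1)%:E.
Proof. by rewrite /centered_cdf subrK fineK// fin_numP. Qed.

Lemma centered_cdf_uniform_le m : - 2^-1 <= m -> (P [set xi | (G xi <= m)%R] <= (m + 2^-1)%:E)%E.
Proof.
move=> m1; have [m2|m2] := leP 2^-1 m.
  apply: (le_trans (prob_le1 (measurable_ccdf0_le m))).
  by rewrite lee_fin; lra.
apply/lee_addgt0Pr => e e0.
have [|b Gb] := @centered_cdf_surj (m + Num.min e (2^-1 - m) / 2).
  have : 0 < Num.min e (2^-1 - m) by rewrite lt_min e0; lra.
  have : Num.min e (2^-1 - m) <= 2^-1 - m by rewrite ge_min lexx orbT.
  set q := Num.min _ _; lra.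
apply: (@le_trans _ _ (P `]-oo, b]%classic)).
  apply: le_measure; rewrite ?inE//; first exact: measurable_ccdf0_le.
  move=> x /= Gx; rewrite in_itv/= leNgt; apply/negP => bx.
  have := centered_cdf_nd (ltW bx); rewrite Gb => h.
  have : 0 < Num.min e (2^-1 - m) by rewrite lt_min e0; lra.
  move: Gx h; set q := Num.min _ _; lra.
rewrite prob_itv Gb -EFinD lee_fin.
have : Num.min e (2^-1 - m) <= e by rewrite ge_min lexx.
set q := Num.min _ _; lra.
Qed.

Lemma centered_cdf_uniform_ge m : m <= 2^-1 -> ((m + 2^-1)%:E <= P [set xi | (G xi < m)%R])%E.
Proof.
move=> m2; have [m1|m1] := leP m (- 2^-1).
  by rewrite (@le_trans _ _ 0%E)// lee_fin; lra.
apply/lee_addgt0Pr => e e0.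
have [|b Gb] := @centered_cdf_surj (m - Num.min e (m + 2^-1) / 2).
  have : 0 < Num.min e (m + 2^-1) by rewrite lt_min e0; lra.
  have : Num.min e (m + 2^-1) <= m + 2^-1 by rewrite ge_min lexx orbT.
  set q := Num.min _ _; lra.
apply: (@le_trans _ _ (P `]-oo, b]%classic + e%:E)%E).
  rewrite prob_itv Gb -EFinD lee_fin.
  have : Num.min e (m + 2^-1) <= e by rewrite ge_min lexx.
  set q := Num.min _ _; lra.
rewrite leeD2r//.
apply: le_measure; rewrite ?inE//; first exact: measurable_ccdf0_lt.
move=> x /=; rewrite in_itv/= => xb; have := centered_cdf_nd xb; rewrite Gb => h.
have : 0 < Num.min e (m + 2^-1) by rewrite lt_min e0; lra.
move: h; set q := Num.min _ _; lra.
Qed.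

(** Probability integral transform; the continuity of G excludes atoms. *)
Lemma centered_cdf_uniform m : - 2^-1 <= m <= 2^-1 ->
  P [set xi | (G xi <= m)%R] = (m + 2^-1)%:E.
Proof.
move=> /andP[m1 m2]; apply/eqP; rewrite eq_le centered_cdf_uniform_le//=.
apply: (le_trans (centered_cdf_uniform_ge m2)).
apply: le_measure; rewrite ?inE.
- exact: measurable_ccdf0_lt.
- exact: measurable_ccdf0_le.
- by move=> x /= /ltW.
Qed.

(** A configuration that is expanding at rate k relative to the mass
    coordinate G carries the law P to a measure of density at most 1/k. *)
Definition expands (k : R) (X : R -> R) :=
  forall zeta xi, zeta <= xi -> k * (G xi - G zeta) <= X xi - X zeta.

Lemma expands_nd k X : 0 <= k -> expands k X -> {homo X : x y / x <= y}.
Proof.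
move=> k0 eX x y xy; have := eX x y xy.
move=> h; rewrite -subr_ge0; apply: le_trans h.
by rewrite mulr_ge0// subr_ge0 centered_cdf_nd.
Qed.

Lemma measurable_expands k X : 0 <= k -> expands k X -> measurable_fun setT X.
Proof. by move=> k0 /(expands_nd k0)/measurable_nd. Qed.

(** On the preimage of an interval, G oscillates by at most its length over k;
    as G is uniform, this bounds the probability of the preimage. *)
Lemma expands_itv k X p q : 0 < k -> expands k X -> p <= q ->
  (P (X @^-1` `[p, q]%classic) <= ((q - p) / k)%:E)%E.
Proof.
move=> k0 eX pq.
have mX := measurable_expands (ltW k0) eX.
set S := X @^-1` _.
have mS : measurable S by rewrite -[S]setTI; apply: mX => //; exact: measurable_itv.
have [->|/set0P[s0 Ss0]] := eqVneq S set0.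
  by rewrite measure0 lee_fin divr_ge0 ?subr_ge0 ?(ltW k0).
have dif x y : S x -> S y -> G y - G x <= (q - p) / k.
  move=> Sx Sy; rewrite ler_pdivlMr//.
  have [xy|yx] := leP x y.
    have := eX _ _ xy; move: Sx Sy; rewrite /S/= !in_itv/=.
    by move=> /andP[? ?] /andP[? ?]; rewrite mulrC; lra.
  have := centered_cdf_nd (ltW yx); rewrite -subr_le0 => h.
  by apply: (@le_trans _ _ 0); [rewrite mulr_le0_ge0// ltW|rewrite subr_ge0].
have neGS : (G @` S) !=set0 by exists (G s0), s0.
have ub x : S x -> G x <= sup (G @` S).
  move=> Sx; apply: ub_le_sup; last by exists x.
  by exists 2^-1 => _ [z _ <-]; rewrite (le_trans (ler_norm _) (centered_cdf_bound z)).
have lb x : S x -> inf (G @` S) <= G x.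
  move=> Sx; apply: ge_inf; last by exists x.
  exists (- 2^-1) => _ [z _ <-].
  by have := centered_cdf_bound z; rewrite ler_norml => /andP[].
have ij : sup (G @` S) - inf (G @` S) <= (q - p) / k.
  rewrite lerBlDr; apply: ge_sup => // _ [y Sy <-].
  rewrite -lerBlDl; apply: lb_le_inf => // _ [x Sx <-].
  by have := dif _ _ Sx Sy; lra.
have i1 : - 2^-1 <= inf (G @` S).
  apply: lb_le_inf => // _ [z _ <-].
  by have := centered_cdf_bound z; rewrite ler_norml => /andP[].
have j1 : sup (G @` S) <= 2^-1.
  apply: ge_sup => // _ [z _ <-].
  by rewrite (le_trans (ler_norm _) (centered_cdf_bound z)).
have ilej : inf (G @` S) <= sup (G @` S) by exact: le_trans (lb _ Ss0) (ub _ Ss0).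
apply: (@le_trans _ _ (P ([set xi | (G xi <= sup (G @` S))%R] `\`
                         [set xi | (G xi < inf (G @` S))%R]))).
  apply: le_measure; rewrite ?inE//.
    by apply: measurableD; [exact: measurable_ccdf0_le|exact: measurable_ccdf0_lt].
  move=> x Sx /=; split; first exact: ub.
  by apply/negP; rewrite -leNgt lb.
rewrite measureD; last 3 first.
- exact: measurable_ccdf0_le.
- exact: measurable_ccdf0_lt.
- by rewrite -ge0_fin_numE// fin_numP//; exact: measurable_ccdf0_le.
rewrite setIidr; last by move=> x /= /ltW h; exact: le_trans h ilej.
apply: (@le_trans _ _ ((sup (G @` S) + 2^-1)%:E - (inf (G @` S) + 2^-1)%:E)%E).
  apply: leeB; first by apply: centered_cdf_uniform_le; exact: le_trans ilej.
  by apply: centered_cdf_uniform_ge; exact: le_trans j1.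
by rewrite -EFinB lee_fin; lra.
Qed.

(** Lebesgue measure is an infimum over covers by intervals, and on each interval
    of a cover the bound is that of [expands_itv]. *)
Lemma expands_measure k X B : 0 < k -> expands k X -> measurable B ->
  (P (X @^-1` B) <= k^-1%:E * mu B)%E.
Proof.
move=> k0 eX mB.
have mX := measurable_expands (ltW k0) eX.
have mpre C : measurable C -> measurable (X @^-1` C).
  by move=> mC; rewrite -[X in measurable X]setTI; exact: mX.
rewrite -lee_pdivrMl ?invr_gt0// invrK.
rewrite /lebesgue_measure /lebesgue_stieltjes_measure /measure_extension.
apply: le_ereal_inf_tmp => _ [A [mA BA] <-].
apply: (@le_trans _ _ (k%:E * \sum_(i <oo) P (X @^-1` (A i)))%E).
  rewrite lee_pmul2l//.
  have mA' i : measurable (A i : set (measurableTypeR R)).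
    exact: sub_sigma_algebra (mA i).
  apply: (@measure_sigma_subadditive _ _ _ P (X @^-1` B) (fun i => X @^-1` A i)); [by move=> i; apply: mpre; exact: mA'|exact: mpre|].
  by rewrite -preimage_bigcup; exact: preimage_subset.
rewrite -nneseriesZl//.
apply: lee_nneseries => i _; first by rewrite mule_ge0 ?lee_fin ?(ltW k0).
have [[a b] _ <-] := mA i.
have [ab|ba] := ltP a b; last first.
  rewrite /= set_itv_ge ?bnd_simp -?leNgt//.
  by rewrite preimage_set0 !measure0 mule0.
rewrite -lee_pdivlMl//= wlength_itv/= lte_fin ab.
apply: (@le_trans _ _ (P (X @^-1` `[a, b]%classic))).
  apply: le_measure; rewrite ?inE.
  - by apply: mpre; exact: measurable_itv.
  - by apply: mpre; exact: measurable_itv.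
  - by apply: preimage_subset; exact: subset_itv_oc_cc.
by apply: (le_trans (expands_itv k0 eX (ltW ab))); rewrite -EFinB -EFinM mulrC.
Qed.

Lemma expands_integral k X (f : R -> \bar R) : 0 < k -> expands k X ->
  measurable_fun setT f -> (forall x, 0 <= f x)%E ->
  (\int[P]_xi f (X xi) <= k^-1%:E * \int[mu]_x f x)%E.
Proof.
move=> k0 eX mf f0.
have mX := measurable_expands (ltW k0) eX.
have k1 : 0 <= k^-1 by rewrite invr_ge0 ltW.
rewrite -(@ge0_integral_pushforward _ _ (measurableTypeR R) (measurableTypeR R) R X mX P setT f)//.
rewrite -(@ge0_integral_mscale _ _ _ mu setT measurableT (NngNum k1) f)//.
by apply: ge0_le_measure_integral => // B mB; exact: expands_measure.
Qed.

End labels.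


(** * The nonlocal drift *)

Section velocity.
Context (R : realType).
Notation mu := (@lebesgue_measure R).
Variable P : probability (measurableTypeR R) R.
Local Notation G := (centered_cdf P).
Hypothesis Gcont : continuous G.
Variable Vx : R -> R.
Hypothesis Vxi : mu.-integrable setT (EFin \o Vx).
Local Notation a := (\int[mu]_w `|Vx w|).
Local Notation V := (kerV Vx).

Lemma indic_window (p q x w : R) :
  \1_(`]p - x, q - x]%classic) w = \1_(`]p, q]%classic) (w + x) :> R.
Proof. by rewrite !indicE !mem_setE !in_itv/= ltrBlDr lerBrDr. Qed.

Lemma measurable_indic_itv (i : interval R) :
  measurable_fun setT (\1_([set` i]) : R -> R).
Proof. by apply: measurable_indic; exact: measurable_itv. Qed.

Lemma measurable_window (g X : R -> R) p q :
  measurable_fun setT g -> measurable_fun setT X ->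
  measurable_fun [set: measurableTypeR R * measurableTypeR R]
    (fun z => (g z.2 * \1_(`]p, q]%classic) (z.2 + X z.1))%:E).
Proof.
move=> mg mX; apply/measurable_EFinP; apply: measurable_funM.
  exact: (measurableT_comp mg).
apply: (measurableT_comp (measurable_indic_itv _)).
by apply: measurable_funD => //; exact: (measurableT_comp mX).
Qed.

(** By Tonelli, the mass that g puts on average in a window attached to a random
    particle is governed by the probability that the particle sees a given w. *)
Lemma window_mass k X (g : R -> R) p q : 0 < k -> expands P k X ->
  measurable_fun setT g -> (forall w, 0 <= g w) -> p <= q ->
  (\int[P]_eta \int[mu]_w (g w * \1_(`]p, q]%classic) (w + X eta))%:E
   <= ((q - p) / k)%:E * \int[mu]_w (g w)%:E)%E.
Proof.
move=> k0 eX mg g0 pq; have mX := measurable_expands (ltW k0) eX.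
have mw := measurable_window p q mg mX.
have w0 z : (0 <= (g z.2 * \1_(`]p, q]%classic) (z.2 + X z.1))%:E)%E.
  by rewrite lee_fin mulr_ge0// indicE.
have -> := @fubini_tonelli _ _ (measurableTypeR R) (measurableTypeR R) R P mu _ mw w0.
have qp0 : 0 <= (q - p) / k by rewrite divr_ge0 ?subr_ge0// ltW.
rewrite -ge0_integralZl//; last 2 first.
- exact/measurable_EFinP.
- by move=> w _; rewrite lee_fin.
apply: ge0_le_integral => //.
- by move=> w _; apply: integral_ge0 => eta _; exact: (w0 (eta, w)).
- exact: (@measurable_fun_fubini_tonelli_G _ _ (measurableTypeR R) (measurableTypeR R) R P _ mw w0).
- by apply/measurable_EFinP; exact: measurable_funM.
move=> w _ /=.
under eq_integral do rewrite EFinM.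
rewrite ge0_integralZl//; last 2 first.
- apply/measurable_EFinP; apply: (measurableT_comp (measurable_indic_itv _)).
  by apply: measurable_funD.
- by rewrite lee_fin.
rewrite muleC EFinM lee_wpmul2r ?lee_fin//.
have -> : (fun eta => (\1_(`]p, q]%classic) (w + X eta))%:E) =
          (fun eta => (\1_(X @^-1` `]p - w, q - w]%classic) eta)%:E :> \bar R).
  apply/funext => eta; congr EFin.
  by rewrite addrC -indic_window /= !indicE.
have mS : measurable (X @^-1` `]p - w, q - w]%classic).
  by rewrite -[X in measurable X]setTI; apply: mX => //; exact: measurable_itv.
rewrite integral_indic// setIT.
apply: (@le_trans _ _ (P (X @^-1` `[p - w, q - w]%classic))).
  apply: le_measure; rewrite ?inE//.
    by rewrite -[X in measurable X]setTI; apply: mX => //; exact: measurable_itv.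
  by apply: preimage_subset; exact: subset_itv_oc_cc.
apply: (le_trans (expands_itv Gcont k0 eX _)); first by rewrite lerD2r.
by rewrite -EFinM lee_fin; apply: eq_ler; congr (_ / _); ring.
Qed.

Lemma Rintegral_le_ereal (h : R -> R) (H : R -> \bar R) (C B : R) :
  measurable_fun setT h -> (forall x, `|h x| <= C) ->
  measurable_fun setT H -> (forall x, `|h x|%:E <= H x)%E ->
  (\int[P]_x H x <= B%:E)%E -> `|\int[P]_x h x| <= B.
Proof.
move=> mh hC mH hH HB; have hi := integrable_bounded P mh hC.
rewrite -lee_fin (EFin_normr_Rintegral measurableT hi).
apply: (le_trans _ HB); apply: (le_trans (le_abse_integral _ _ _)) => //.
  exact/measurable_EFinP.
apply: ge0_le_integral => //; last by move=> x _ /=; exact: hH.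
by apply: measurableT_comp => //; exact/measurable_EFinP.
Qed.

Lemma measurable_kerV_from (X : R -> R) z : measurable_fun setT X ->
  measurable_fun setT (fun eta => V (z - X eta)).
Proof.
move=> mX; apply: (measurableT_comp (measurable_kerV Vxi)).
exact: measurable_funB.
Qed.

Lemma L1_norm_ge0 : 0 <= a. Proof. exact: Rintegral_ge0. Qed.

Lemma kerV_le_L1 z : `|V z| <= a.
Proof. by apply: (le_trans (kerV_bound Vxi z)); have := L1_norm_ge0; lra. Qed.

Lemma integrable_kerV_from (X : R -> R) z : measurable_fun setT X ->
  P.-integrable setT (EFin \o (fun eta => V (z - X eta))).
Proof.
by move=> mX; apply: (integrable_bounded P (measurable_kerV_from z mX)) => eta; exact: kerV_le_L1.
Qed.

Definition drift (X : R -> R) (z : R) := \int[P]_eta V (z - X eta).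

(** The increment of kerV over an interval is at most the mass of Vx in it, which
    [window_mass] averages: over a cloud of density at most 1/k a kernel with an
    integrable derivative acts like a Lipschitz one. *)
Lemma drift_diff k X z z' : 0 < k -> expands P k X -> z' <= z ->
  `|drift X z - drift X z'| <= a / k * (z - z').
Proof.
move=> k0 eX zz; have mX := measurable_expands (ltW k0) eX.
rewrite /drift -RintegralB//; [|exact: integrable_kerV_from..].
apply: (@Rintegral_le_ereal _ (fun eta => \int[mu]_w
   (`|Vx w| * \1_(`]z', z]%classic) (w + X eta))%:E)%E (a + a)).
- by apply: measurable_funB; exact: measurable_kerV_from.
- by move=> x; rewrite (le_trans (ler_normB _ _))// lerD// kerV_le_L1.
- have mw := measurable_window z' z (measurableT_comp (@normr_measurable R setT) (measurable_L1 Vxi)) mX.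
  apply: (@measurable_fun_fubini_tonelli_F _ _ (measurableTypeR R) (measurableTypeR R)
    R mu _ mw) => z0.
  by rewrite lee_fin mulr_ge0//= indicE.
- move=> eta.
  have -> : (fun w => (`|Vx w| * \1_(`]z', z]%classic) (w + X eta))%:E) =
     EFin \o (fun w => `|Vx w| * \1_(`]z' - X eta, z - X eta]%classic) w).
    by apply/funext => w /=; rewrite indic_window.
  rewrite -EFin_Rintegral//.
    by rewrite lee_fin; apply: kerV_diff_le => //; rewrite lerD2r.
  apply: (integrable_absVxM Vxi); first exact: measurable_indic_itv.
  by move=> w; rewrite indicE; case: (_ \in _); rewrite ?lexx ?ler01.
- apply: (le_trans (@window_mass k X (fun w => `|Vx w|) z' z k0 eX _ _ zz)) => //.
    exact: (measurableT_comp _ (measurable_L1 Vxi)).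
  have -> : (fun w => `|Vx w|%:E) = EFin \o (fun w => `|Vx w|) by [].
  rewrite -EFin_Rintegral//; last exact: integrable_absVx.
  by rewrite -EFinM lee_fin; apply: eq_ler; rewrite mulrAC [RHS]mulrC mulrA.
Qed.

(** Below the level L, the increment of kerV is at most L times the distance, and
    the rest is averaged by [window_mass].  The windows are centred at the
    positions Y, whose density is controlled, and have the half-width 2 d because
    the arguments z - X eta and z' - Y eta differ by at most 2 d. *)
Lemma drift_lip L k (X Y : R -> R) (d z z' : R) : 0 <= L -> 0 < k -> expands P k Y ->
  measurable_fun setT X -> (forall eta, `|X eta - Y eta| <= d) ->
  `|z - z'| <= d ->
  `|drift X z - drift Y z'| <=
  (2 * L + 4 * (\int[mu]_w (`|Vx w| * (L < `|Vx w|)%R%:R)) / k) * d.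
Proof.
move=> L0 k0 eY mX XY zz; have mY := measurable_expands (ltW k0) eY.
have d0 : 0 <= d := le_trans (normr_ge0 _) zz.
set g := fun w => `|Vx w| * (L < `|Vx w|)%R%:R.
have mg : measurable_fun setT g.
  apply: measurable_funM; first exact: (measurableT_comp _ (measurable_L1 Vxi)).
  apply: (@measurableT_comp _ _ _ _ _ _ (fun b : bool => b%:R : R)) => //.
  by apply: measurable_fun_ltr => //; exact: (measurableT_comp _ (measurable_L1 Vxi)).
have g0 w : 0 <= g w by rewrite /g mulr_ge0.
have gi : mu.-integrable setT (EFin \o g).
  apply: (@integrable_dominated _ _ _ mu _ (fun w : R => `|Vx w|)) => //.
    exact: integrable_absVx.
  move=> w; rewrite (ger0_norm (g0 w)) /g ler_piMr//.
  by case: (_ < _); rewrite ?mulr1n ?mulr0n.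
rewrite /drift -RintegralB//; [|exact: integrable_kerV_from..].
pose W eta w := g w * \1_(`]z' - 2 * d, z' + 2 * d]%classic) (w + Y eta).
have mW : measurable_fun [set: measurableTypeR R * measurableTypeR R]
    (fun z0 => (W z0.1 z0.2)%:E) by exact: measurable_window.
have mH : measurable_fun setT (fun eta => \int[mu]_w (W eta w)%:E)%E.
  apply: (@measurable_fun_fubini_tonelli_F _ _ (measurableTypeR R) (measurableTypeR R)
    R mu _ mW) => z0.
  by rewrite lee_fin /W mulr_ge0//= indicE.
apply: (@Rintegral_le_ereal _ (fun eta => (2 * L * d)%:E +
   \int[mu]_w (W eta w)%:E)%E (a + a)).
- by apply: measurable_funB; exact: measurable_kerV_from.
- by move=> x; rewrite (le_trans (ler_normB _ _))// lerD// kerV_le_L1.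
- by apply: emeasurable_funD.
- move=> eta; set p := z - X eta; set q := z' - Y eta.
  have pq : `|p - q| <= 2 * d.
    have -> : p - q = (z - z') - (X eta - Y eta) by rewrite /p /q; ring.
    by rewrite (le_trans (ler_normB _ _))// mulr2n mulrDl mul1r lerD.
  have WE : (\int[mu]_w (W eta w)%:E = (\int[mu]_w (g w *
      \1_(`]q - 2 * d, q + 2 * d]%classic) w))%:E)%E.
    rewrite EFin_Rintegral//.
      apply: eq_integral => w _; congr EFin; rewrite /W -indic_window /q.
      by rewrite addrAC [z' + _ - _]addrAC.
    apply: (@integrable_dominated _ _ _ mu _ g) => //.
      by apply: measurable_funM => //; exact: measurable_indic_itv.
    move=> w; rewrite normrM (ger0_norm (g0 w)) ler_piMr// indicE.
    by case: (_ \in _); rewrite ?normr1 ?normr0.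
  rewrite WE -EFinD lee_fin.
  have key x y : y <= x -> x - y <= 2 * d -> q - 2 * d <= y -> x <= q + 2 * d ->
      `|V x - V y| <= 2 * L * d + \int[mu]_w (g w *
      \1_(`]q - 2 * d, q + 2 * d]%classic) w).
    move=> yx xyd qy xq; apply: (le_trans (kerV_diff_le Vxi yx)).
    have i1 : mu.-integrable setT (EFin \o (fun w => L * \1_(`]y, x]%classic) w)).
      apply: (@integrable_bounded_support _ _ _ mu `]y, x]%classic L) => //.
      - exact: lebesgue_itvoc_fin.
      - by apply: measurable_funM => //; exact: measurable_indic_itv.
      - by move=> w; rewrite ger0_norm// mulr_ge0// indicE.
    have i2 : mu.-integrable setT (EFin \o (fun w => g w *
        \1_(`]q - 2 * d, q + 2 * d]%classic) w)).
      apply: (@integrable_dominated _ _ _ mu _ g) => //.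
        by apply: measurable_funM => //; exact: measurable_indic_itv.
      move=> w; rewrite normrM (ger0_norm (g0 w)) ler_piMr// indicE.
      by case: (_ \in _); rewrite ?normr1 ?normr0.
    apply: (@le_trans _ _ (\int[mu]_w (L * \1_(`]y, x]%classic) w + g w *
        \1_(`]q - 2 * d, q + 2 * d]%classic) w))).
      apply: le_Rintegral => //.
      - apply: (integrable_absVxM Vxi); first exact: measurable_indic_itv.
        by move=> w; rewrite indicE; case: (_ \in _); rewrite ?lexx ?ler01.
      - exact: (integrableD measurableT i1 i2).
      - move=> w _; rewrite !indicE !mem_setE !in_itv/=.
        have [/andP[yw wx]|_] := boolP (y < w <= x); last first.
          by rewrite mulr0n !mulr0 add0r mulr_ge0.
        have -> : (q - 2 * d < w <= q + 2 * d) = true.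
          by rewrite (le_lt_trans qy yw) (le_trans wx xq).
        rewrite mulr1n !mulr1 /g; case: ltP => h; rewrite ?mulr1n ?mulr0n ?mulr1 ?mulr0 ?addr0//.
        by rewrite lerDr.
    rewrite RintegralD// lerD2r RintegralZl//; last first.
      apply: (@integrable_bounded_support _ _ _ mu `]y, x]%classic 1) => //.
      - exact: lebesgue_itvoc_fin.
      - by move=> w; rewrite ger0_norm ?mul1r// indicE.
    rewrite mulrAC [2 * d * L]mulrC ler_wpM2l//.
    by rewrite Rintegral_indic_oc.
  move: pq; rewrite ler_norml => /andP[pq1 pq2].
  have [qp|pq] := leP q p; first by apply: key => //; lra.
  by rewrite distrC; apply: key => //; lra.
- rewrite ge0_integralD//; last 2 first.
    by move=> x _; rewrite lee_fin !mulr_ge0.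
    by move=> x _; apply: integral_ge0 => w _; rewrite lee_fin /W mulr_ge0// indicE.
  rewrite integral_cst_prob.
  have zd : z' - 2 * d <= z' + 2 * d by lra.
  have := @window_mass k Y g _ _ k0 eY mg g0 zd.
  have -> : (fun w => (g w)%:E) = EFin \o g by [].
  rewrite -EFin_Rintegral// -EFinM => h.
  apply: (le_trans (leeD (lexx _) h)); rewrite -EFinD lee_fin.
  by apply: eq_ler; field; rewrite gt_eqF.
Qed.

(** The density bound again, used against kerV itself: this is where the
    integrability of V makes the interaction fade as the cloud spreads. *)
Lemma drift_decay k X z : 0 < k -> expands P k X ->
  (`|drift X z|%:E <= k^-1%:E * \int[mu]_w `|V w|%:E)%E.
Proof.
move=> k0 eX; have mX := measurable_expands (ltW k0) eX.
rewrite (EFin_normr_Rintegral measurableT (integrable_kerV_from z mX)).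
apply: (le_trans (le_abse_integral _ _ _)) => //.
  by apply/measurable_EFinP; exact: measurable_kerV_from.
have mV : measurable_fun setT (fun x : R => `|V (z - x)|%:E).
  apply/measurable_EFinP; apply: measurableT_comp => //.
  apply: (measurableT_comp (measurable_kerV Vxi)); exact: measurable_funB.
apply: (le_trans (expands_integral Gcont k0 eX mV _)).
  by move=> x; rewrite lee_fin.
rewrite (@integral_reflect _ (fun x => `|V x|%:E)); first exact: lexx.
by apply/measurable_EFinP; apply: measurableT_comp => //; exact: measurable_kerV.
Qed.

End velocity.


(** * Existence of the particle flow *)

Section geometric_limits.
Context (R : realType).

(** The intervals around u n with radii equal to the tails of the series are
    nested, and the limit is the supremum of their left ends. *)
Lemma geometric_limit (u : nat -> R) (C q : R) : 0 <= q < 1 -> 0 <= C ->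
  (forall n, `|u n - u n.+1| <= C * q ^+ n) ->
  exists l, forall n, `|u n - l| <= C / (1 - q) * q ^+ n.
Proof.
move=> /andP[q0 q1] C0 Hu.
have q1' : 0 < 1 - q by lra.
pose e n := C / (1 - q) * q ^+ n.
have e0 n : 0 <= e n by rewrite /e mulr_ge0 ?exprn_ge0// divr_ge0// ltW.
have eS n : e n.+1 = e n - C * q ^+ n.
  by rewrite /e exprS; field; rewrite gt_eqF.
pose a n := u n - e n; pose b n := u n + e n.
have aS n : a n <= a n.+1.
  by have := Hu n; rewrite /a eS ler_norml; lra.
have bS n : b n.+1 <= b n.
  by have := Hu n; rewrite /b eS ler_norml; lra.
have a_nd : {homo a : n m / (n <= m)%N >-> n <= m}.
  exact: (homo_leq (fun x => lexx x) (fun y x z => @le_trans _ _ y x z)).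
have b_ni : {homo b : n m / (n <= m)%N >-> m <= n}.
  by apply: (homo_leq (r := fun x y => y <= x)) => // y x z h1 h2; exact: le_trans h2 h1.
have ab n m : a n <= b m.
  have [nm|mn] := leqP n m.
    by apply: (le_trans (a_nd _ _ nm)); rewrite /a /b; have := e0 m; lra.
  apply: (le_trans _ (b_ni _ _ (ltnW mn))).
  by rewrite /a /b; have := e0 n; lra.
exists (sup (range a)) => n; rewrite -/(e n).
have h1 : a n <= sup (range a).
  by apply: ub_le_sup; [exists (b 0%N) => _ [m _ <-]|exists n].
have h2 : sup (range a) <= b n.
  by apply: ge_sup; [exists (a 0%N), 0%N|move=> _ [m _ <-]].
by move: h1 h2; rewrite /a /b ler_norml; lra.
Qed.

Lemma ler_geometric (a b K q : R) : 0 <= q < 1 ->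
  (forall n : nat, a <= b + K * q ^+ n) -> a <= b.
Proof.
move=> /andP[q0 q1] H.
have cv : (fun n : nat => b + K * q ^+ n) @ \oo --> b + K * 0.
  apply: cvgD; first exact: cvg_cst.
  by apply: cvgMr; apply: cvg_expr; rewrite ger0_norm.
rewrite mulr0 addr0 in cv.
rewrite -(cvg_lim _ cv)//; apply: limr_ge; first by apply/cvg_ex; exists b.
exact: nearW.
Qed.

(** One step from x against two half steps from y.  The slack b, the distance that
    a particle can travel in a full step, is kept in the induction hypothesis to
    pay for the change of position between the two half steps. *)
Lemma halving_step (x y vx vy vy' tau ell M b : R) :
  0 < tau -> 0 <= ell -> 0 <= b -> `|y - x| <= M - b ->
  `|vy - vx| <= ell * (M - b) -> `|vy' - vx| <= ell * (M - b / 2) ->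
  `|x + tau * vx - (y + tau / 2 * vy + tau / 2 * vy')| + b <= M * (1 + tau * ell).
Proof.
move=> t0 ell0 b0 h1 h2 h3.
have -> : x + tau * vx - (y + tau / 2 * vy + tau / 2 * vy') =
  - ((y - x) + tau / 2 * ((vy - vx) + (vy' - vx))) by field.
rewrite normrN [M * (1 + _)]mulrDr mulr1.
have n1 : `|tau / 2 * ((vy - vx) + (vy' - vx))| <= M * (tau * ell).
  rewrite normrM gtr0_norm; last by lra.
  have -> : M * (tau * ell) = tau / 2 * (ell * M + ell * M) by field.
  rewrite ler_wpM2l//; first by lra.
  apply: (le_trans (ler_normD _ _)); apply: lerD.
    by apply: (le_trans h2); rewrite ler_wpM2l//; lra.
  by apply: (le_trans h3); rewrite ler_wpM2l//; lra.
have := ler_normD (y - x) (tau / 2 * ((vy - vx) + (vy' - vx))); lra.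
Qed.

(* sqrt (k + 1) (1 + 1 / (3 (k + 1))) <= sqrt (k + 2), by squaring *)
Lemma halving_growth (l : R) k : 0 <= l ->
  (1 + (l + (3 * k.+1%:R)^-1)) * Num.sqrt k.+1%:R <= expR l * Num.sqrt k.+2%:R.
Proof.
move=> l0; have K0 : 0 < k.+1%:R :> R by [].
have i0 : 0 <= (3 * k.+1%:R)^-1 :> R by rewrite invr_ge0 mulr_ge0.
apply: (@le_trans _ _ ((1 + l) * ((1 + (3 * k.+1%:R)^-1) * Num.sqrt k.+1%:R))).
  rewrite mulrA ler_wpM2r ?sqrtr_ge0//.
  by move: (3 * _)^-1 i0 => i i0; have := mulr_ge0 l0 i0; lra.
rewrite ler_pM//.
- by rewrite addr_ge0.
- exact: expR_ge1Dx.
rewrite -[leLHS]ger0_norm; last by rewrite mulr_ge0 ?sqrtr_ge0// addr_ge0.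
rewrite -sqrtr_sqr ler_wsqrtr// exprMn sqr_sqrtr//.
have -> : (1 + (3 * k.+1%:R)^-1) ^+ 2 * k.+1%:R = k.+1%:R + 2/3 + (9 * k.+1%:R)^-1 :> R.
  have : k.+1%:R != 0 :> R by rewrite pnatr_eq0.
  by move: (k.+1%:R) => K Kn0; field; rewrite Kn0.
rewrite -(natr1 k.+1) -addrA lerD2l.
have : (9 * k.+1%:R)^-1 <= 9^-1 :> R.
  by rewrite lef_pV2 ?posrE ?mulr_gt0// ler_peMr// ler1n.
by move: (9 * _)^-1 => i; lra.
Qed.

End geometric_limits.

Section euler_scheme.
Context (R : realType).
Notation mu := (@lebesgue_measure R).
Variable P : probability (measurableTypeR R) R.
Local Notation G := (centered_cdf P).
Hypothesis Gcont : continuous G.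
Variable Vx : R -> R.
Hypothesis Vxi : mu.-integrable setT (EFin \o Vx).
Variables (A a : R).
Hypothesis A_gt0 : 0 < A.
Hypothesis normVx : \int[mu]_w `|Vx w| <= a.
Hypothesis aA : a < A.
Local Notation c := (A - a).
Local Notation B := (2 * A).

Definition vel (X : R -> R) (xi : R) := A * G xi - drift P Vx X (X xi).

(** The scheme starts from the position after one step without drift: the identity
    does not expand at any positive rate, while this position already expands at
    the rate A tau. *)
Fixpoint euler (tau : R) (k : nat) (xi : R) : R :=
  if k is k'.+1 then euler tau k' xi + tau * vel (euler tau k') xi
  else xi + A * tau * G xi.

Lemma norm_bound_ge0 : 0 <= a.
Proof. exact: le_trans (L1_norm_ge0 Vx) normVx. Qed.

Lemma c_gt0 : 0 < c. Proof. by rewrite subr_gt0. Qed.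

Lemma expands_le k k' X : k' <= k -> expands P k X -> expands P k' X.
Proof.
move=> kk eX zeta xi h; apply: le_trans (eX _ _ h).
by rewrite ler_wpM2r// subr_ge0 centered_cdf_nd.
Qed.

Lemma drift_bound (X : R -> R) z : measurable_fun setT X -> `|drift P Vx X z| <= a.
Proof.
move=> mX; apply: Rintegral_prob_bound; first exact: measurable_kerV_from.
by move=> x; apply: le_trans normVx; exact: kerV_le_L1.
Qed.

Lemma vel_bound (X : R -> R) xi : measurable_fun setT X -> `|vel X xi| <= B.
Proof.
move=> mX; have h1 := drift_bound (X xi) mX; have h2 := centered_cdf_bound P xi.
have A0 : 0 <= A by exact: ltW.
rewrite /vel (le_trans (ler_normB _ _))// normrM (ger0_norm A0).
have : A * `|G xi| <= A * 2^-1 by rewrite ler_wpM2l.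
move: h1 aA A0; move: (A * `|G xi|) (`|drift P Vx X (X xi)|) => g d h1 h3 h4 h5.
by lra.
Qed.

(** During a step the attraction shortens distances by the factor
    1 - tau a / k at most, hence the rate by tau a, while the term A G adds tau A. *)
Lemma expands_step k tau X : 0 < k -> 0 < tau -> tau * a <= k -> expands P k X ->
  expands P (k + tau * c) (fun xi => X xi + tau * vel X xi).
Proof.
move=> k0 t0 tak eX zeta xi h.
have D := eX _ _ h; have mono := expands_nd (ltW k0) eX h.
have := drift_diff Gcont Vxi k0 eX mono; rewrite ler_norml => /andP[_].
rewrite /vel; move: (drift P Vx X (X xi)) (drift P Vx X (X zeta)) => d1 d2.
move: D mono; rewrite -[X zeta <= X xi]subr_ge0.
have -> : X xi + tau * (A * G xi - d1) - (X zeta + tau * (A * G zeta - d2)) =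
  X xi - X zeta + tau * A * (G xi - G zeta) - tau * (d1 - d2) by ring.
move: (X xi - X zeta) (G xi - G zeta) => DX dl D mono dd0.
have dd : d1 - d2 <= a / k * DX.
  by apply: (le_trans dd0); apply: ler_wpM2r => //; rewrite ler_wpM2r// invr_ge0 ltW.
apply: (@le_trans _ _ (DX + tau * A * dl - tau * (a / k * DX))).
  have -> : DX + tau * A * dl - tau * (a / k * DX) =
            DX * (1 - tau * a / k) + tau * A * dl by field; rewrite gt_eqF.
  have r0 : 0 <= 1 - tau * a / k by rewrite subr_ge0 ler_pdivrMr// mul1r.
  have := ler_wpM2r r0 D.
  have -> : k * dl * (1 - tau * a / k) = k * dl - tau * a * dl by field; rewrite gt_eqF.
  lra.
by rewrite lerD2l lerN2 ler_wpM2l// ltW.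
Qed.

Lemma euler_expands0 tau k : 0 < tau ->
  expands P (A * tau + k%:R * (tau * c)) (euler tau k).
Proof.
move=> t0; have c0 := c_gt0; elim: k => [|k IH].
  by move=> zeta xi h /=; rewrite mul0r addr0 mulrBr; lra.
have k0 : 0 <= k%:R * (tau * c) by rewrite !mulr_ge0// ltW.
have At : 0 < A * tau by rewrite mulr_gt0.
have := expands_step _ t0 _ IH; rewrite -natr1 mulrDl mul1r addrA; apply.
  by rewrite ltr_wpDr.
apply: (@le_trans _ _ (A * tau)); last by rewrite lerDl.
by rewrite mulrC ler_wpM2r// ltW.
Qed.

Lemma euler_expands tau k : 0 < tau -> expands P (c * (k.+1%:R * tau)) (euler tau k).
Proof.
move=> t0; apply: expands_le (euler_expands0 k t0).
rewrite -natr1; have -> : c * ((k%:R + 1) * tau) = c * tau + k%:R * (tau * c) by ring.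
by rewrite lerD2r ler_wpM2r ?(ltW t0)// gerBl norm_bound_ge0.
Qed.

Lemma euler_rate_gt0 tau k : 0 < tau -> 0 < c * (k.+1%:R * tau).
Proof. by move=> t0; rewrite !mulr_gt0// c_gt0. Qed.

Lemma measurable_euler tau k : 0 < tau -> measurable_fun setT (euler tau k).
Proof.
move=> t0; apply: measurable_expands (euler_expands k t0).
by apply: ltW; exact: euler_rate_gt0.
Qed.

Lemma euler_step_bound tau k xi : 0 < tau ->
  `|euler tau k.+1 xi - euler tau k xi| <= B * tau.
Proof.
move=> t0 /=; rewrite addrAC subrr add0r normrM (gtr0_norm t0) mulrC.
by rewrite ler_wpM2r ?(ltW t0)// vel_bound//; exact: measurable_euler.
Qed.

Lemma euler_steps_bound tau k j xi : 0 < tau ->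
  `|euler tau (k + j) xi - euler tau k xi| <= B * tau * j%:R.
Proof.
move=> t0; elim: j => [|j IH]; first by rewrite addn0 subrr normr0 mulr0.
rewrite addnS -[j.+1%:R]natr1 [_ * (j%:R + 1)]mulrDr mulr1.
have -> : euler tau (k + j).+1 xi - euler tau k xi =
  (euler tau (k + j) xi - euler tau k xi) +
  (euler tau (k + j).+1 xi - euler tau (k + j) xi) by ring.
by rewrite (le_trans (ler_normD _ _))// lerD// euler_step_bound.
Qed.

(** Only the part of Vx above the level L is affected by the rate k.  The factor
    c / 3 makes the singular part of the Lipschitz constant 1 / (3 k), small
    enough for the errors to be summed in [euler_halving]. *)
Variable L : R.
Hypothesis L_ge0 : 0 <= L.
Hypothesis tailL : 4 * (\int[mu]_w (`|Vx w| * (L < `|Vx w|)%R%:R)) <= c / 3.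

Lemma vel_lip k (X Y : R -> R) d xi : 0 < k -> expands P (c * k) Y ->
  measurable_fun setT X -> (forall eta, `|X eta - Y eta| <= d) ->
  `|vel X xi - vel Y xi| <= (2 * L + (3 * k)^-1) * d.
Proof.
move=> k0 eY mX XY; have c0 := c_gt0.
have ck : 0 < c * k by rewrite mulr_gt0.
have d0 : 0 <= d := le_trans (normr_ge0 _) (XY xi).
have := drift_lip Gcont Vxi L_ge0 ck eY mX XY (XY xi).
move: tailL; set e := \int[mu]_w _ => tailL'.
have -> : vel X xi - vel Y xi = - (drift P Vx X (X xi) - drift P Vx Y (Y xi)).
  by rewrite /vel opprB opprD addrACA subrr add0r addrC opprK.
rewrite normrN => h; apply: (le_trans h).
rewrite ler_wpM2r// lerD2l ler_pdivrMr//.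
have -> : (3 * k)^-1 * (c * k) = c / 3 by field; rewrite gt_eqF.
exact: tailL'.
Qed.

(** One step of length tau against two steps of length tau/2.  The Lipschitz
    constant of the k-th step is of order 1/(3k), which accumulates to the
    square root of k only: less than the factor 1/tau that is available. *)
Lemma euler_halving tau k xi : 0 < tau ->
  `|euler tau k xi - euler (tau / 2) k.*2 xi| + B * tau <=
  3 * B * tau * (expR (2 * L * tau * k%:R) * Num.sqrt k.+1%:R).
Proof.
move=> t0; have h0 : 0 < tau / 2 by lra.
have Bt : 0 <= B * tau by rewrite !mulr_ge0// ltW.
have A0 : 0 <= A by exact: ltW.
elim: k xi => [xi|k IH xi].
  rewrite mulr0 expR0 sqrtr1 !mulr1 /=.
  have -> : xi + A * tau * G xi - (xi + A * (tau / 2) * G xi) = A * tau * (G xi / 2) by field.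
  rewrite normrM (ger0_norm (mulr_ge0 A0 (ltW t0))).
  have : `|G xi / 2| <= 1.
    have := centered_cdf_bound P xi; rewrite normrM => h; rewrite (ger0_norm (x := 2^-1))//; lra.
  move=> /(ler_wpM2l (mulr_ge0 A0 (ltW t0))).
  by move: (A * tau * _) => z; rewrite mulr1 -!mulrA; move: Bt; rewrite -!mulrA; lra.
set M := 3 * B * tau * _ in IH.
have XY eta : `|euler (tau / 2) k.*2 eta - euler tau k eta| <= M - B * tau.
  by rewrite lerBrDr distrC.
have XY' eta : `|euler (tau / 2) k.*2.+1 eta - euler tau k eta| <= M - B * tau / 2.
  rewrite -(subrK (euler (tau / 2) k.*2 eta) (euler (tau / 2) k.*2.+1 eta)) -addrA.
  apply: (le_trans (ler_normD _ _)).
  apply: (le_trans (lerD (euler_step_bound k.*2 eta h0) (XY eta))).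
  by apply: eq_ler; clearbody M; field.
have kt : 0 < k.+1%:R * tau by rewrite mulr_gt0.
have eX := euler_expands k t0.
have v1 := vel_lip xi kt eX (measurable_euler k.*2 h0) XY.
have v2 := vel_lip xi kt eX (measurable_euler k.*2.+1 h0) XY'.
have ell0 : 0 <= 2 * L + (3 * (k.+1%:R * tau))^-1.
  by rewrite addr_ge0 ?mulr_ge0// invr_ge0 mulr_ge0// ltW.
have M0 : 0 <= M by rewrite /M !mulr_ge0 ?expR_ge0 ?sqrtr_ge0// ltW.
rewrite doubleS.
apply: (le_trans (halving_step t0 ell0 Bt (XY xi) v1 v2)).
have -> : tau * (2 * L + (3 * (k.+1%:R * tau))^-1) = 2 * L * tau + (3 * k.+1%:R)^-1.
  have : k.+1%:R != 0 :> R by rewrite pnatr_eq0.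
  by move: (k.+1%:R) => K K0; field; rewrite (gt_eqF t0) K0.
have l0 : 0 <= 2 * L * tau by rewrite !mulr_ge0// ltW.
rewrite /M -mulrA ler_wpM2l//; first by rewrite !mulr_ge0// ltW.
rewrite -[k.+1%:R in X in _ <= X]natr1 [_ * (k%:R + 1)]mulrDr mulr1 expRD -!mulrA.
rewrite ler_wpM2l ?expR_ge0// !mulrA mulrC.
exact: halving_growth.
Qed.

Definition mesh (n : nat) : R := 2^-1 ^+ n.
Definition nstep (n : nat) (t : R) : nat := Num.truncn (t / mesh n).
Definition approx (n : nat) (t : R) : R -> R := euler (mesh n) (nstep n t).

Lemma mesh_gt0 n : 0 < mesh n. Proof. by rewrite exprn_gt0. Qed.

Lemma mesh_le1 n : mesh n <= 1.
Proof. by rewrite exprn_ile1// ?invr_ge0// invf_le1// ler1n. Qed.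

Lemma meshS n : mesh n.+1 = mesh n / 2.
Proof. by rewrite /mesh exprSr. Qed.

Lemma nstep_itv n t : 0 <= t ->
  (nstep n t)%:R * mesh n <= t < (nstep n t).+1%:R * mesh n.
Proof.
move=> t0; have m0 := mesh_gt0 n.
rewrite -ler_pdivlMr// -ltr_pdivrMr//; apply: truncn_itv.
by rewrite divr_ge0// ltW.
Qed.

Lemma nstepS n t : 0 <= t ->
  ((nstep n t).*2 <= nstep n.+1 t <= (nstep n t).*2.+1)%N.
Proof.
move=> t0; have /andP[h1 h2] := nstep_itv n t0.
have /andP[h3 h4] := nstep_itv n.+1 t0.
have m0 := mesh_gt0 n.
move: h3 h4; rewrite meshS => h3 h4.
apply/andP; split.
  have : ((nstep n t).*2%:R : R) < (nstep n.+1 t).+1%:R.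
    rewrite -(ltr_pM2r m0) -muln2 natrM; lra.
  by rewrite ltr_nat ltnS.
have : ((nstep n.+1 t)%:R : R) < (nstep n t).*2.+2%:R.
  rewrite -doubleS -(ltr_pM2r m0) -muln2 natrM; lra.
by rewrite ltr_nat ltnS.
Qed.

Definition halfroot : R := Num.sqrt 2^-1.

Lemma halfroot01 : 0 <= halfroot < 1.
Proof.
by rewrite sqrtr_ge0/= -[X in _ < X]sqrtr1 ltr_sqrt// invf_lt1// ltr1n.
Qed.

Lemma mesh_halfroot n : mesh n = halfroot ^+ n * halfroot ^+ n.
Proof. by rewrite -exprMn -expr2 sqr_sqrtr// invr_ge0. Qed.

Definition halving_const (T : R) := 4 * B * (expR (2 * L * T) * Num.sqrt (T + 1)).

Lemma halving_const_ge0 T : 0 <= halving_const T.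
Proof. by rewrite !mulr_ge0 ?expR_ge0 ?sqrtr_ge0// ltW. Qed.

Lemma approx_cauchy n t T xi : 0 <= t -> t <= T ->
  `|approx n t xi - approx n.+1 t xi| <= halving_const T * halfroot ^+ n.
Proof.
move=> t0 tT; have m0 := mesh_gt0 n; have A0 := ltW A_gt0.
have /andP[h1 h2] := nstep_itv n t0; have m1 := mesh_le1 n.
set k := nstep n t in h1 h2.
have h12 : 0 < mesh n / 2 by lra.
have E : `|euler (mesh n / 2) k.*2 xi - approx n.+1 t xi| <= B * mesh n.
  rewrite /approx meshS distrC.
  have /andP[k1 k2] := nstepS n t0.
  have [->|/eqP ne] := eqVneq (nstep n.+1 t) k.*2.
    by rewrite subrr normr0 mulr_ge0 ?mulr_ge0// ltW.
  have -> : nstep n.+1 t = k.*2.+1.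
    by apply/eqP; rewrite eqn_leq k2 ltn_neqAle k1 andbT eq_sym; apply/eqP.
  apply: (le_trans (euler_step_bound k.*2 xi h12)).
  by rewrite ler_wpM2l ?mulr_ge0//; lra.
have H := euler_halving k xi m0.
have F : `|approx n t xi - approx n.+1 t xi| <=
    3 * B * mesh n * (expR (2 * L * mesh n * k%:R) * Num.sqrt k.+1%:R).
  apply: le_trans H.
  rewrite -(subrK (euler (mesh n / 2) k.*2 xi) (approx n t xi)) -addrA.
  by apply: (le_trans (ler_normD _ _)); rewrite lerD.
apply: (le_trans F).
have q0 : 0 <= halfroot ^+ n by rewrite exprn_ge0//; case/andP: halfroot01.
have S : mesh n * Num.sqrt k.+1%:R <= halfroot ^+ n * Num.sqrt (T + 1).
  rewrite {1}mesh_halfroot -mulrA ler_wpM2l//.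
  rewrite -[halfroot ^+ n](ger0_norm q0) -sqrtr_sqr expr2 -mesh_halfroot.
  rewrite -sqrtrM ?(ltW m0)// ler_wsqrtr//.
  by rewrite mulrC -natr1 mulrDl mul1r; lra.
have Ex : expR (2 * L * mesh n * k%:R) <= expR (2 * L * T).
  by rewrite ler_expR -mulrA ler_wpM2l ?mulr_ge0// mulrC; lra.
apply: (@le_trans _ _ (4 * B * (expR (2 * L * T) * (halfroot ^+ n * Num.sqrt (T + 1))))).
  have -> : 3 * B * mesh n * (expR (2 * L * mesh n * k%:R) * Num.sqrt k.+1%:R) =
     3 * B * (expR (2 * L * mesh n * k%:R) * (mesh n * Num.sqrt k.+1%:R)).
    by move: (expR _) (Num.sqrt _) => x y; ring.
  rewrite ler_pM ?mulr_ge0 ?expR_ge0 ?sqrtr_ge0 ?(ltW m0)//.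
    by rewrite ler_wpM2r ?mulr_ge0// ler_nat.
  by rewrite ler_pM ?mulr_ge0 ?expR_ge0 ?sqrtr_ge0 ?(ltW m0).
rewrite /halving_const; apply: eq_ler.
by move: (expR _) (Num.sqrt _) (halfroot ^+ n) => x y z; ring.
Qed.

Definition limit_const (T : R) := halving_const T / (1 - halfroot).

Lemma halfroot_lt1 : 0 < 1 - halfroot.
Proof. by rewrite subr_gt0; case/andP: halfroot01. Qed.

Lemma limit_const_ge0 T : 0 <= limit_const T.
Proof. by rewrite divr_ge0 ?halving_const_ge0// ltW// halfroot_lt1. Qed.

Lemma halving_const_le T T' : 0 <= T -> T <= T' -> halving_const T <= halving_const T'.
Proof.
move=> T0 TT; have A0 := ltW A_gt0.
rewrite ler_wpM2l ?mulr_ge0// ler_pM ?expR_ge0 ?sqrtr_ge0//.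
  by rewrite ler_expR ler_wpM2l ?mulr_ge0.
by rewrite ler_wsqrtr// lerD2r.
Qed.

Lemma limit_const_le T T' : 0 <= T -> T <= T' -> limit_const T <= limit_const T'.
Proof.
move=> T0 TT; rewrite ler_wpM2r ?halving_const_le//.
by rewrite invr_ge0 ltW// halfroot_lt1.
Qed.

Lemma approx_limit : exists X : R -> R -> R, forall t T xi n, 0 <= t -> t <= T ->
  `|approx n t xi - X t xi| <= limit_const T * halfroot ^+ n.
Proof.
have H (z : R * R) : {l : R | 0 <= z.1 -> forall n,
    `|approx n z.1 z.2 - l| <= limit_const z.1 * halfroot ^+ n}.
  have [z0|z0] := leP 0 z.1; last by exists 0.
  have := geometric_limit halfroot01 (halving_const_ge0 z.1)
    (fun n => approx_cauchy n z.2 z0 (lexx _)).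
  by move=> /cid[l Hl]; exists l.
exists (fun t xi => sval (H (t, xi))) => t T xi n t0 tT.
case: (H (t, xi)) => l /= Hl; apply: (le_trans (Hl t0 n)).
rewrite ler_wpM2r ?limit_const_le// exprn_ge0//; by case/andP: halfroot01.
Qed.

Lemma mesh_le_halfroot n : mesh n <= halfroot ^+ n.
Proof.
have /andP[q0 q1] := halfroot01.
by rewrite mesh_halfroot ler_piMr ?exprn_ge0// exprn_ile1// ltW.
Qed.

Lemma nstep_mesh n j : nstep n (j%:R * mesh n) = j.
Proof. by rewrite /nstep mulfK ?gt_eqF ?mesh_gt0// natrK. Qed.

Section limit_flow.
Variable X : R -> R -> R.
Hypothesis HX : forall t T xi n, 0 <= t -> t <= T ->
  `|approx n t xi - X t xi| <= limit_const T * halfroot ^+ n.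

Lemma limit_start xi : X 0 xi = xi.
Proof.
apply/eqP; rewrite -subr_eq0 -normr_le0.
apply: (@ler_geometric _ _ 0 (limit_const 0 + A) _ halfroot01) => n.
rewrite add0r -(subrK (approx n 0 xi) (X 0 xi)) -addrA.
apply: (le_trans (ler_normD _ _)); rewrite mulrDl lerD//.
  by rewrite distrC; exact: HX.
have -> : approx n 0 xi - xi = A * mesh n * G xi.
  by rewrite /approx /nstep mul0r truncn0 /= addrAC subrr add0r.
rewrite normrM ger0_norm; last by rewrite mulr_ge0 ?(ltW A_gt0)// ltW// mesh_gt0.
apply: (@le_trans _ _ (A * mesh n)).
  rewrite ler_piMr ?mulr_ge0 ?(ltW A_gt0) ?(ltW (mesh_gt0 n))//.
  by have := centered_cdf_bound P xi; lra.
by rewrite ler_wpM2l ?(ltW A_gt0)// mesh_le_halfroot.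
Qed.

Lemma nstep_diff n s t : 0 <= s -> s <= t ->
  exists2 i : nat, nstep n t = (nstep n s + i)%N & `|i%:R * mesh n - (t - s)| <= mesh n.
Proof.
move=> s0 st; have t0 := le_trans s0 st.
have /andP[h1 h2] := nstep_itv n s0; have /andP[h3 h4] := nstep_itv n t0.
have m0 := mesh_gt0 n.
have kk : (nstep n s <= nstep n t)%N by apply: le_truncn; rewrite ler_wpM2r// invr_ge0 ltW.
exists (nstep n t - nstep n s)%N; first by rewrite subnKC.
rewrite natrB// mulrBl; move: h2 h4; rewrite -!natr1 !mulrDl mul1r => h2 h4.
by rewrite ler_norml; lra.
Qed.

Lemma limit_lipschitz_le s t xi : 0 <= s -> s <= t -> `|X t xi - X s xi| <= B * (t - s).
Proof.
move=> s0 st; have t0 := le_trans s0 st; have A0 := ltW A_gt0.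
apply: (@ler_geometric _ _ _ (limit_const t + limit_const t + B) _ halfroot01) => n.
have [i iE iB] := nstep_diff n s0 st.
have E1 := HX xi n t0 (lexx t); have E2 := HX xi n s0 st.
have E3 : `|approx n t xi - approx n s xi| <= B * (t - s) + B * halfroot ^+ n.
  rewrite /approx iE; apply: (le_trans (euler_steps_bound _ _ xi (mesh_gt0 n))).
  rewrite -mulrA -mulrDr ler_wpM2l ?mulr_ge0// mulrC.
  have := mesh_le_halfroot n; move: iB; rewrite ler_norml; lra.
have -> : X t xi - X s xi = - (approx n t xi - X t xi) + (approx n s xi - X s xi) +
   (approx n t xi - approx n s xi) by ring.
apply: (le_trans (ler_normD _ _)).
apply: (le_trans (lerD (ler_normD _ _) E3)); rewrite normrN.
move: E1 E2; move: (limit_const t) (halfroot ^+ n) `|_| `|_| => x y z w; lra.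
Qed.

Lemma limit_lipschitz s t xi : 0 <= s -> 0 <= t -> `|X t xi - X s xi| <= B * `|t - s|.
Proof.
move=> s0 t0; have [st|ts] := leP s t.
  by rewrite (ger0_norm (x := t - s)) ?subr_ge0// limit_lipschitz_le.
rewrite distrC [`|t - s|]distrC (ger0_norm (x := s - t)) ?subr_ge0 ?(ltW ts)//.
by rewrite limit_lipschitz_le// ltW.
Qed.

Lemma limit_expands t : 0 <= t -> expands P (c * t) (X t).
Proof.
move=> t0 zeta xi h.
apply: (@ler_geometric _ _ _ (limit_const t + limit_const t) _ halfroot01) => n.
have /andP[h1 h2] := nstep_itv n t0.
have e := euler_expands (nstep n t) (mesh_gt0 n).
have ct : c * t <= c * ((nstep n t).+1%:R * mesh n).
  by rewrite ler_wpM2l ?(ltW c_gt0)// ltW.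
have := expands_le ct e h; rewrite -/(approx n t).
have := HX xi n t0 (lexx t); have := HX zeta n t0 (lexx t).
rewrite !ler_norml; move: (limit_const t) (halfroot ^+ n) => x y; lra.
Qed.

Lemma euler_near t0 r n j eta : 0 <= t0 -> 0 <= r ->
  `|j%:R * mesh n - t0| <= r + mesh n -> j%:R * mesh n <= t0 + r ->
  `|euler (mesh n) j eta - X t0 eta| <=
  limit_const (t0 + r) * halfroot ^+ n + B * (r + mesh n).
Proof.
move=> t00 r0 h1 h2.
have jm : 0 <= j%:R * mesh n by rewrite mulr_ge0// ltW// mesh_gt0.
have := HX eta n jm h2; rewrite /approx nstep_mesh => e1.
have e2 := limit_lipschitz eta t00 jm.
rewrite -(subrK (X (j%:R * mesh n) eta) (euler (mesh n) j eta)) -addrA.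
apply: (le_trans (ler_normD _ _)); apply: lerD => //.
by apply: (le_trans e2); rewrite ler_wpM2l// mulr_ge0// ltW.
Qed.

(** Near t0 all positions are within B r of X t0, up to the mesh, so by [vel_lip]
    the velocities along the scheme differ from that at t0 by at most a constant
    times B r; these errors are summed over the steps between s and t. *)
Lemma limit_taylor_le t0 r s t xi : 0 < t0 -> 0 <= s -> s <= t ->
  `|s - t0| <= r -> `|t - t0| <= r ->
  `|X t xi - X s xi - (t - s) * vel (X t0) xi| <=
  (t - s) * ((2 * L + (3 * t0)^-1) * (B * r)).
Proof.
move=> t00 s0 st sr tr.
have r0 : 0 <= r := le_trans (normr_ge0 _) sr.
have t_ge0 := le_trans s0 st; have A0 := ltW A_gt0.
have tT : t <= t0 + r by move: tr; rewrite ler_norml; lra.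
have sT : s <= t0 + r by exact: le_trans tT.
set v := vel (X t0) xi; set Lp := 2 * L + _.
have Lp0 : 0 <= Lp by rewrite addr_ge0 ?mulr_ge0// invr_ge0 mulr_ge0// ltW.
set E := limit_const (t0 + r).
have E0 : 0 <= E by exact: limit_const_ge0.
apply: (@ler_geometric _ _ _ (2 * E + `|v| + ((t - s) * (Lp * (E + B)) +
   Lp * (E + B * (r + 1)))) _ halfroot01) => n.
have m0 := mesh_gt0 n; have mq := mesh_le_halfroot n; have m1 := mesh_le1 n.
have /andP[q0 q1] := halfroot01.
have y0 : 0 <= halfroot ^+ n by rewrite exprn_ge0.
have y1 : halfroot ^+ n <= 1 by rewrite exprn_ile1// ltW.
have [i iE iB] := nstep_diff n s0 st.
have /andP[h1 h2] := nstep_itv n s0; have /andP[h3 h4] := nstep_itv n t_ge0.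
pose D := E * halfroot ^+ n + B * (r + mesh n).
have D0 : 0 <= D.
  by rewrite /D addr_ge0//; apply: mulr_ge0 => //; [exact: mulr_ge0|lra].
have eX := limit_expands (ltW t00).
have key (j : nat) : (j <= i)%N ->
  `|euler (mesh n) (nstep n s + j) xi - euler (mesh n) (nstep n s) xi - j%:R * mesh n * v|
  <= j%:R * mesh n * (Lp * D).
  elim: j => [|j IH] ji; first by rewrite addn0 !mul0r subr0 subrr normr0.
  have {}IH := IH (ltnW ji).
  set J := (nstep n s + j)%N in IH.
  have Jm1 : s - mesh n <= J%:R * mesh n.
    apply: (@le_trans _ _ ((nstep n s)%:R * mesh n)).
      by move: h2; rewrite -natr1 mulrDl mul1r; lra.
    by rewrite ler_wpM2r ?(ltW m0)// ler_nat leq_addr.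
  have Jm2 : J%:R * mesh n <= t.
    apply: le_trans h3; rewrite ler_wpM2r ?(ltW m0)// ler_nat iE leq_add2l.
    exact: ltnW.
  have near eta : `|euler (mesh n) J eta - X t0 eta| <= D.
    apply: euler_near => //; first exact: ltW.
      by move: sr tr; rewrite !ler_norml; lra.
    exact: le_trans Jm2 tT.
  have vl := vel_lip xi t00 eX (measurable_euler J m0) near.
  rewrite addnS /= -/J -natr1.
  have -> : euler (mesh n) J xi + mesh n * vel (euler (mesh n) J) xi -
     euler (mesh n) (nstep n s) xi - (j%:R + 1) * mesh n * v =
    (euler (mesh n) J xi - euler (mesh n) (nstep n s) xi - j%:R * mesh n * v) +
    mesh n * (vel (euler (mesh n) J) xi - v).
    by move: (euler (mesh n) J xi) (euler _ (nstep n s) xi) (vel _ xi) => x y z; ring.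
  have -> : (j%:R + 1) * mesh n * (Lp * D) = j%:R * mesh n * (Lp * D) + mesh n * (Lp * D).
    by move: (Lp * D) => z; ring.
  apply: (le_trans (ler_normD _ _)); apply: lerD => //.
  by rewrite normrM (gtr0_norm m0) ler_wpM2l// ltW.
have := key i (leqnn i); rewrite -iE -/(approx n t) -/(approx n s) => K.
have E1 := HX xi n t_ge0 tT; have E2 := HX xi n s0 sT.
have -> : X t xi - X s xi - (t - s) * v =
  (- (approx n t xi - X t xi) + (approx n s xi - X s xi)) +
  ((approx n t xi - approx n s xi - i%:R * mesh n * v) + (i%:R * mesh n - (t - s)) * v).
  by move: (approx n t xi) (approx n s xi) => x y; ring.
apply: (le_trans (ler_normD _ _)).
have F1 : `|- (approx n t xi - X t xi) + (approx n s xi - X s xi)| <= 2 * E * halfroot ^+ n.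
  apply: (le_trans (ler_normD _ _)); rewrite normrN.
  by apply: (le_trans (lerD E1 E2)); apply: eq_ler; rewrite /E; ring.
have F2 : `|(i%:R * mesh n - (t - s)) * v| <= `|v| * halfroot ^+ n.
  by rewrite normrM mulrC ler_wpM2l// (le_trans iB).
have F3 : i%:R * mesh n * (Lp * D) <= (t - s) * (Lp * (B * r)) +
   ((t - s) * (Lp * (E + B)) + Lp * (E + B * (r + 1))) * halfroot ^+ n.
  have im : i%:R * mesh n <= t - s + halfroot ^+ n by move: iB; rewrite ler_norml; lra.
  have LD0 : 0 <= Lp * D by rewrite mulr_ge0.
  apply: (le_trans (ler_wpM2r LD0 im)).
  have D1 : D <= B * r + (E + B) * halfroot ^+ n.
    rewrite /D mulrDr [(E + B) * _]mulrDl.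
    have := ler_wpM2l (mulr_ge0 (ler0n R 2) A0) mq; lra.
  have D2 : D <= E + B * (r + 1).
    have B0 : 0 <= B by rewrite mulr_ge0.
    have u1 : E * halfroot ^+ n <= E by rewrite ler_piMr.
    have u2 : B * (r + mesh n) <= B * (r + 1) by rewrite ler_wpM2l// lerD2l.
    by rewrite /D; lra.
  rewrite mulrDl.
  have ts0 : 0 <= t - s by rewrite subr_ge0.
  have w1 := ler_wpM2l (mulr_ge0 ts0 Lp0) D1.
  have w2 := ler_wpM2l (mulr_ge0 y0 Lp0) D2.
  move: w1 w2; clearbody D Lp E; move: (halfroot ^+ n) => y w1 w2.
  apply: (le_trans (y := (t - s) * Lp * (B * r + (E + B) * y) + y * Lp * (E + B * (r + 1)))).
    by rewrite [X in X + _ <= _]mulrA [X in _ + X <= _]mulrA; exact: lerD w1 w2.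
  by apply: eq_ler; ring.
apply: (le_trans (lerD F1 (le_trans (ler_normD _ _) (lerD (le_trans K F3) F2)))).
apply: eq_ler; clearbody D Lp E v; move: (halfroot ^+ n) `|v| => y w; ring.
Qed.

Lemma limit_taylor t0 t xi : 0 < t0 -> 0 <= t ->
  `|X t xi - X t0 xi - (t - t0) * vel (X t0) xi| <=
  (2 * L + (3 * t0)^-1) * B * (t - t0) ^+ 2.
Proof.
move=> t00 t_ge0; have [tt|tt] := leP t0 t.
  have := @limit_taylor_le t0 `|t - t0| t0 t xi t00 (ltW t00) tt.
  rewrite subrr normr0 lexx (ger0_norm (x := t - t0)) ?subr_ge0// => /(_ tt isT) h.
  by apply: (le_trans h); apply: eq_ler; ring.
have := @limit_taylor_le t0 `|t - t0| t t0 xi t00 t_ge0 (ltW tt).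
rewrite subrr normr0 lexx (ler0_norm (x := t - t0)) ?subr_le0 ?(ltW tt)// => h.
rewrite -normrN.
have -> : - (X t xi - X t0 xi - (t - t0) * vel (X t0) xi) =
  X t0 xi - X t xi - (t0 - t) * vel (X t0) xi by ring.
apply: (le_trans (h isT _)); first by rewrite oppr_ge0 subr_le0 ltW.
by apply: eq_ler; ring.
Qed.

End limit_flow.

(** The flow is extended by the identity to negative times, which makes it
    continuous on the whole line.  The last clause is the differential equation
    at positive times, with a quadratic remainder. *)
Lemma flow_exists : exists X : R -> R -> R,
  [/\ (forall t xi, t <= 0 -> X t xi = xi),
      (forall s t xi, `|X t xi - X s xi| <= B * `|t - s|),
      (forall t, 0 < t -> expands P (c * t) (X t)) &
      (forall t0 t xi, 0 < t0 -> 0 <= t ->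
        `|X t xi - X t0 xi - (t - t0) * vel (X t0) xi| <=
        (2 * L + (3 * t0)^-1) * B * (t - t0) ^+ 2)].
Proof.
have [X HX] := approx_limit.
have mx (t : R) : 0 <= t -> Num.max 0 t = t by move=> t0; rewrite max_r.
exists (fun t => X (Num.max 0 t)); split.
- by move=> t xi t0; rewrite max_l// (limit_start HX).
- move=> s t xi.
  have h0 (u : R) : 0 <= Num.max 0 u by rewrite le_max lexx.
  apply: (le_trans (limit_lipschitz HX xi (h0 s) (h0 t))).
  rewrite ler_wpM2l ?mulr_ge0 ?(ltW A_gt0)//.
  rewrite /Num.max; case: ltP => ht; case: ltP => hs //; rewrite ?subrr ?normr0// ?sub0r ?subr0 ?normrN.
    by rewrite !gtr0_norm ?subr_gt0//; lra.
  rewrite gtr0_norm// ltr0_norm; lra.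
- by move=> t t0; rewrite mx ?(ltW t0)//; apply: (limit_expands HX); exact: ltW.
- move=> t0 t xi t00 t_ge0; rewrite !mx ?(ltW t00)//.
  exact: (limit_taylor HX).
Qed.

End euler_scheme.


(** * The solution carried by the flow *)

Fact symmetric_pairs (R : realType) (J q : R) :
  J + 2^-1 * q = q * q - J - 2^-1 * q -> J = (q * q - q) / 2.
Proof. lra. Qed.

Section solution.
Context (R : realType).
Notation mu := (@lebesgue_measure R).
Variable P : probability (measurableTypeR R) R.
Local Notation G := (centered_cdf P).
Hypothesis Gcont : continuous G.
Variables (B c : R) (X : R -> R -> R).
Hypothesis B_ge0 : 0 <= B.
Hypothesis c_gt0 : 0 < c.
Hypothesis X_start : forall t xi, t <= 0 -> X t xi = xi.
Hypothesis X_lip : forall s t xi, `|X t xi - X s xi| <= B * `|t - s|.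
Hypothesis X_expands : forall t, 0 < t -> expands P (c * t) (X t).

Lemma X_nd t : {homo X t : x y / x <= y}.
Proof.
have [t0|t0] := leP t 0; first by move=> x y xy; rewrite !X_start.
by apply: expands_nd (X_expands t0); rewrite mulr_ge0// ltW.
Qed.

Lemma measurable_X t : measurable_fun setT (X t).
Proof. exact: measurable_nd (@X_nd t). Qed.

Lemma X_continuous xi : continuous (fun t => X t xi).
Proof.
move=> t; apply/cvgrPdist_lt => e e0; near=> s.
apply: (le_lt_trans (X_lip _ _ _)).
apply: (@le_lt_trans _ _ ((B + 1) * `|t - s|)).
  by rewrite ler_wpM2r// lerDl.
rewrite mulrC -ltr_pdivlMr; last by rewrite ltr_wpDl.
near: s; apply: (@cvgr_dist_lt _ _ _ (nbhs t) _ id t); first exact: cvg_id.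
by rewrite divr_gt0// ltr_wpDl.
Unshelve. all: by end_near. Qed.

Lemma measurable_X2 :
  measurable_fun [set: measurableTypeR R * measurableTypeR R] (fun z => X z.2 z.1).
Proof.
apply: (@caratheodory_measurable _ (measurableTypeR R)).
  by move=> t; exact: measurable_X.
by move=> xi; exact: X_continuous.
Qed.

Definition U (z : R * R) : R := \int[P]_xi step (z.1 - X z.2 xi).

Lemma measurable_stepX t x : measurable_fun setT (fun xi => step (x - X t xi)).
Proof.
apply: (measurableT_comp (@measurable_step R)).
by apply: measurable_funB => //; exact: measurable_X.
Qed.

Lemma integrable_stepX t x : P.-integrable setT (EFin \o (fun xi => step (x - X t xi))).
Proof.
apply: (@integrable_bounded _ _ _ P 2^-1); first exact: measurable_stepX.
by move=> xi; exact: step_bound.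
Qed.

Lemma U_bound z : `|U z| <= 2^-1.
Proof.
apply: Rintegral_prob_bound; first exact: measurable_stepX.
by move=> xi; exact: step_bound.
Qed.

Lemma step_le (x y : R) : x <= y -> step x <= step y.
Proof.
move=> xy; rewrite /step lerD2r ler_nat.
by case: (leP 0 x) => // x0; rewrite (le_trans x0 xy).
Qed.

Lemma U_nd t : {homo (fun x => U (x, t)) : x y / x <= y}.
Proof.
move=> x y xy; apply: le_Rintegral => //; [exact: integrable_stepX..|].
by move=> xi _; apply: step_le => /=; rewrite lerD2r.
Qed.

Lemma U_lip t x y : 0 < t -> x <= y -> U (y, t) - U (x, t) <= (y - x) / (c * t).
Proof.
move=> t0 xy; have ct : 0 < c * t by exact: mulr_gt0.
rewrite /U -RintegralB//=; [|exact: integrable_stepX..].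
have -> : (fun xi => step (y - X t xi) - step (x - X t xi)) =
  \1_(X t @^-1` `]x, y]%classic) :> (R -> R).
  apply/funext => xi; rewrite -[RHS]/(\1_(`]x, y]%classic) (X t xi)).
  rewrite /step indicE mem_setE in_itv/= !subr_ge0.
  rewrite opprB addrA subrK.
  case: (leP (X t xi) y) => h1; case: (leP (X t xi) x) => h2 /=; rewrite ?subr0 ?subrr//.
  by have := le_lt_trans (le_trans h2 xy) h1; rewrite ltxx.
have mS : measurable (X t @^-1` `]x, y]%classic).
  rewrite -[X in measurable X]setTI; apply: measurable_X => //; exact: measurable_itv.
rewrite /Rintegral integral_indic// setIT.
rewrite -lee_fin fineK; last by exact: fin_num_measure.
apply: le_trans (expands_itv Gcont ct (X_expands t0) xy).
apply: le_measure; rewrite ?inE//.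
  rewrite -[X in measurable X]setTI; apply: measurable_X => //; exact: measurable_itv.
by apply: preimage_subset; exact: subset_itv_oc_cc.
Qed.

Lemma U_lip_norm t x y : 0 < t -> `|U (y, t) - U (x, t)| <= `|y - x| / (c * t).
Proof.
move=> t0; have [xy|yx] := leP x y.
  by rewrite !ger0_norm ?subr_ge0 ?U_nd// U_lip.
by rewrite distrC [`|y - x|]distrC !ger0_norm ?subr_ge0 ?(ltW yx) ?U_nd ?(ltW yx)// U_lip// ltW.
Qed.

(** Between the times s and t no particle moves by more than B * |t - s|. *)
Lemma U_time t s x : U (x, t) <= U (x + B * `|t - s|, s).
Proof.
apply: le_Rintegral => //; [exact: integrable_stepX..|].
move=> xi _; apply: step_le => /=; have := X_lip s t xi; rewrite ler_norml; lra.
Qed.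

Lemma U_dist z w : 0 < z.2 ->
  `|U w - U z| <= (`|w.1 - z.1| + B * `|w.2 - z.2|) / (c * z.2).
Proof.
case: z => x t; case: w => y s /= t0.
have ct : 0 < c * t by exact: mulr_gt0.
have h1 := U_time s t y; have h2 := U_time t s (y - B * `|s - t|).
rewrite [`|t - s|]distrC subrK in h2.
set d := B * `|s - t| in h1 h2 *.
have d0 : 0 <= d by rewrite mulr_ge0.
rewrite ler_norml; apply/andP; split.
  have := U_lip_norm (y - d) x t0; rewrite ler_norml => /andP[h3 h4].
  have : `|x - (y - d)| / (c * t) <= (`|y - x| + d) / (c * t).
    rewrite ler_wpM2r ?invr_ge0 ?(ltW ct)//.
    have -> : x - (y - d) = (x - y) + d by ring.
    by rewrite (le_trans (ler_normD _ _))// distrC (ger0_norm d0).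
  lra.
have := U_lip_norm x (y + d) t0; rewrite ler_norml => /andP[h3 h4].
have : `|y + d - x| / (c * t) <= (`|y - x| + d) / (c * t).
  rewrite ler_wpM2r ?invr_ge0 ?(ltW ct)//.
  have -> : y + d - x = (y - x) + d by ring.
  by rewrite (le_trans (ler_normD _ _))// (ger0_norm d0).
lra.
Qed.

Lemma U_continuous : {within @upper_half R, continuous U}.
Proof.
apply: continuous_in_subspaceT => -[x t]; rewrite inE /upper_half/= in_itv/= andbT => -[_ t0].
apply/cvgrPdist_lt => e e0.
have ct : 0 < c * t by exact: mulr_gt0.
have K0 : 0 < e * (c * t) / (1 + B).
  by rewrite divr_gt0 ?mulr_gt0// ltr_wpDr.
near=> w; rewrite distrC; apply: (le_lt_trans (U_dist w (z := (x, t)) t0)) => /=.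
rewrite ltr_pdivrMr//.
have [h1 h2] : `|w.1 - x| < e * (c * t) / (1 + B) /\ `|w.2 - t| < e * (c * t) / (1 + B).
  near: w; exists (ball x (e * (c * t) / (1 + B)), ball t (e * (c * t) / (1 + B))).
    by split; exact: nbhsx_ballx.
  by move=> [y s] [/=]; rewrite -!ball_normE/= ![`|_ - x|]distrC ![`|_ - t|]distrC.
have B1 : 1 + B != 0 by rewrite gt_eqF// ltr_wpDr.
have -> : e * (c * t) = e * (c * t) / (1 + B) + B * (e * (c * t) / (1 + B)) by field.
by apply: ltr_leD => //; rewrite ler_wpM2l// ltW.
Unshelve. all: by end_near. Qed.

Lemma measurable_U : measurable_fun [set: measurableTypeR R * measurableTypeR R] U.
Proof.
apply: (@measurable_Rintegral_param _ _ _ (measurableTypeR R) R P 2^-1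
  (fun z : (measurableTypeR R * measurableTypeR R) * measurableTypeR R => step (z.1.1 - X z.1.2 z.2))).
  apply: (measurableT_comp (@measurable_step R)); apply: measurable_funB.
    exact: (measurableT_comp measurable_fst measurable_fst).
  have h : measurable_fun setT (fun z : (measurableTypeR R * measurableTypeR R) *
      measurableTypeR R => (z.2, z.1.2)).
    apply: measurable_fun_pair => //.
    exact: (measurableT_comp measurable_snd measurable_fst).
  exact: (measurableT_comp measurable_X2 h).
by move=> z; exact: step_bound.
Qed.

Lemma U_start x : U (x, 0) = G x.
Proof.
rewrite /U /centered_cdf/=.
have -> : (fun xi => step (x - X 0 xi)) = (fun xi => \1_(`]-oo, x]%classic) xi - 2^-1).
  by apply/funext => xi; rewrite X_start// /step indicE mem_setE in_itv/= subr_ge0.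
rewrite RintegralB//.
- rewrite Rintegral_cst_prob; congr (_ - _).
  by rewrite /Rintegral integral_indic// setIT.
- apply: (@integrable_bounded _ _ _ P 1); first exact: measurable_indic_itv.
  by move=> y; rewrite indicE; case: (_ \in _); rewrite ?normr1 ?normr0.
- exact: (@integrable_bounded _ _ _ P `|2^-1|).
Qed.

Lemma measurable_wstepX (b : R -> R) t : measurable_fun setT b ->
  measurable_fun [set: measurableTypeR R * measurableTypeR R]
    (fun z => b z.2 * step (z.1 - X t z.2)).
Proof.
move=> mb; apply: measurable_funM; first exact: (measurableT_comp mb).
apply: (measurableT_comp (@measurable_step R)); apply: measurable_funB => //.
exact: (measurableT_comp (measurable_X t)).
Qed.

(** Integrating against a superposition of steps is integrating against the
    single steps, which sit at the particles. *)
Lemma integral_steps t (b g : R -> R) : measurable_fun setT b ->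
  (forall xi, `|b xi| <= 1) -> mu.-integrable setT (EFin \o g) ->
  \int[mu]_x (g x * \int[P]_xi (b xi * step (x - X t xi))) =
  \int[P]_xi (b xi * \int[mu]_x (g x * step (x - X t xi))).
Proof.
move=> mb b1 gi.
have mg : measurable_fun setT g by apply/measurable_EFinP; exact: measurable_int gi.
have mw := measurable_wstepX t mb.
have bs1 xi z : `|b xi * step z| <= 1.
  by rewrite normrM mulr_ile1// step_le1.
have mg2 : measurable_fun [set: measurableTypeR R * measurableTypeR R]
    (fun z => g z.1 * (b z.2 * step (z.1 - X t z.2))).
  by apply: measurable_funM => //; exact: (measurableT_comp mg).
transitivity (\int[mu]_x \int[P]_xi (g x * (b xi * step (x - X t xi)))).
  apply: eq_Rintegral => x _; rewrite RintegralZl//.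
  apply: (@integrable_bounded _ _ _ P 1) => //.
  exact: (measurableT_comp mw (pair1_measurable x)).
transitivity (\int[P]_xi \int[mu]_x (g x * (b xi * step (x - X t xi)))); last first.
  apply: eq_Rintegral => xi _; rewrite -RintegralZl//.
    by apply: eq_Rintegral => x _; rewrite mulrCA.
  apply: (@integrable_dominated _ _ _ mu _ (fun x : R => `|g x|)).
  - apply: measurable_funM => //; apply: (measurableT_comp (@measurable_step R)).
    exact: measurable_funB.
  - exact: (integrable_norm gi).
  - by move=> x; rewrite normrM ler_piMr// step_le1.
apply: (@Rintegral_exchange _ _ (measurableTypeR R) (measurableTypeR R) R mu P
  (fun z => g z.1 * (b z.2 * step (z.1 - X t z.2)))).
apply/integrable12ltyP; first exact/measurable_EFinP.
have /integrableP[_] := gi; apply: le_lt_trans.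
apply: ge0_le_integral => //.
- by move=> x _; apply: integral_ge0.
- apply: (@measurable_fun_fubini_tonelli_F _ _ (measurableTypeR R) (measurableTypeR R) R P
    (fun z => `|(g z.1 * (b z.2 * step (z.1 - X t z.2)))%:E|%E)) => //.
  by apply: measurableT_comp => //; exact/measurable_EFinP.
- by apply: measurableT_comp => //; exact: measurable_int gi.
- move=> x _ /=; rewrite -[leRHS](integral_cst_prob P).
  apply: ge0_le_integral => //.
  + apply/measurable_EFinP; apply: measurableT_comp => //.
    exact: (measurableT_comp mg2 (pair1_measurable x)).
  + by move=> xi _; rewrite lee_fin normrM ler_piMr.
Qed.

Lemma integral_U t (g : R -> R) : mu.-integrable setT (EFin \o g) ->
  \int[mu]_x (g x * U (x, t)) = \int[P]_xi \int[mu]_x (g x * step (x - X t xi)).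
Proof.
move=> gi.
have h := @integral_steps t (cst 1) g (measurable_cst _) (fun=> eq_ler (normr1 _)) gi.
transitivity (\int[mu]_x (g x * \int[P]_xi (cst 1 xi * step (x - X t xi)))).
  by apply: eq_Rintegral => x _; congr (_ * _); apply: eq_Rintegral => xi _; rewrite mul1r.
by rewrite h; apply: eq_Rintegral => xi _; rewrite mul1r.
Qed.

Lemma prob_point xi : P [set xi] = 0%E.
Proof.
apply/eqP; rewrite eq_le measure_ge0 andbT; apply/lee_addgt0Pr => e e0; rewrite add0e.
have /cvgrPdist_lt /(_ e e0) [d /= d0 Hd] := @Gcont xi.
pose y := xi - d / 2.
have yx : y < xi by rewrite /y; lra.
have := Hd y; rewrite /= /y opprB addrC subrK gtr0_norm ?divr_gt0// => /(_ _) h.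
have {}h : `|G xi - G y| < e by apply: h; lra.
apply: (@le_trans _ _ (P `]y, xi]%classic)).
  apply: le_measure; rewrite ?inE//; last by move=> z ->; rewrite /= in_itv/= yx lexx.
rewrite -[P _]fineK; last exact: fin_num_measure.
rewrite lee_fin; apply: le_trans (ltW h); apply: le_trans (ler_norm _).
rewrite /centered_cdf opprB addrA subrK lerBrDr -lee_fin EFinD !fineK; try exact: fin_num_measure.
rewrite -measureU//; last first.
  by apply/seteqP; split => // z [/=]; rewrite !in_itv/= => /andP[h1 _] h2; lra.
apply: le_measure; rewrite ?inE//; first by apply: measurableU; exact: measurable_itv.
by move=> z [/=|/=]; rewrite !in_itv/=; lra.
Qed.

Lemma integrable_bool (b : R -> bool) : measurable_fun setT (fun xi => (b xi)%:R : R) ->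
  P.-integrable setT (EFin \o (fun xi => (b xi)%:R : R)).
Proof.
move=> mb; apply: (@integrable_bounded _ _ _ P 1) => // xi.
by case: (b xi); rewrite ?normr1 ?normr0.
Qed.

Lemma centered_cdf_open xi : \int[P]_zeta (zeta < xi)%R%:R = G xi + 2^-1.
Proof.
have mI (i : interval R) : measurable_fun setT (\1_([set` i]) : R -> R) by exact: measurable_indic_itv.
transitivity (fine (P `]-oo, xi[%classic)).
  rewrite /Rintegral -[X in _ = fine (P X)]setIT -integral_indic//; congr fine.
  by apply: eq_integral => z _; rewrite indicE mem_setE in_itv/=.
rewrite /centered_cdf subrK; congr fine.
have -> : `]-oo, xi]%classic = `]-oo, xi[%classic `|` [set xi].
  apply/seteqP; split=> [z /=|z [/=|->/=]]; rewrite !in_itv/=; [|exact: ltW|by []].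
  by rewrite le_eqVlt => /orP[/eqP ->|]; [right|left].
rewrite measureU//; first by rewrite [X in (_ + X)%E]prob_point adde0.
by apply/seteqP; split => // z [/=]; rewrite in_itv/= => /[swap] ->; rewrite ltxx.
Qed.

Lemma centered_cdf_closed xi : \int[P]_zeta (zeta <= xi)%R%:R = G xi + 2^-1.
Proof.
rewrite /centered_cdf subrK /Rintegral -[X in _ = fine (P X)]setIT -integral_indic//; congr fine.
by apply: eq_integral => z _; rewrite indicE mem_setE in_itv/=.
Qed.

(** The square of the solution is again a superposition of steps: expanding
    the square gives pairs of labels, and by symmetry of the pair it is enough
    to keep those in which the second label is to the left of the first. *)
Lemma U_square t x : U (x, t) ^+ 2 =
  4^-1 + \int[P]_xi G xi + 2 * \int[P]_xi (G xi * step (x - X t xi)).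
Proof.
pose s (xi : R) : R := (0 <= x - X t xi)%R%:R.
have sE xi : s xi = step (x - X t xi) + 2^-1 by rewrite /step subrK.
have ms : measurable_fun setT s.
  rewrite (_ : s = fun xi => step (x - X t xi) + 2^-1); last by apply/funext.
  by apply: measurable_funD => //; exact: measurable_stepX.
have mG := measurable_ccdf0 P.
have s01 xi : 0 <= s xi <= 1 by rewrite /s ler0n lern1 leq_b1.
have ib (f : R -> R) : measurable_fun setT f -> (forall y, `|f y| <= 1) ->
    P.-integrable setT (EFin \o f).
  by move=> mf fb; exact: (@integrable_bounded _ _ _ P 1).
have is_ : P.-integrable setT (EFin \o s) by exact: integrable_bool.
have G1 xi : `|G xi| <= 1.
  by rewrite (le_trans (centered_cdf_bound _ _))// invf_le1// ler1n.
have iG : P.-integrable setT (EFin \o G) by exact: ib.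
have isG : P.-integrable setT (EFin \o (fun xi => s xi * G xi)).
  apply: ib; first exact: measurable_funM.
  move=> xi; have /andP[h0 h1] := s01 xi.
  by rewrite normrM (ger0_norm h0) mulr_ile1.
pose q := \int[P]_xi s xi.
pose J := \int[P]_xi (s xi * G xi).
have Uq : U (x, t) = q - 2^-1.
  rewrite /U /q -[in RHS](Rintegral_cst_prob P 2^-1) -RintegralB//.
  by apply: (@integrable_bounded _ _ _ P `|2^-1|).
have gE : \int[P]_xi (G xi * step (x - X t xi)) = J - 2^-1 * \int[P]_xi G xi.
  rewrite /J -RintegralZl// -RintegralB//.
    by apply: eq_Rintegral => xi _; rewrite sE; ring.
  exact: (integrable_scale 2^-1 iG).
have sX (xi zeta : R) : zeta <= xi -> s xi * s zeta = s xi.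
  move=> h; have := X_nd t h; rewrite /s !subr_ge0 => h2.
  case: (leP (X t xi) x) => h3; last by rewrite mul0r.
  by rewrite (le_trans h2 h3) mulr1.
have mle : measurable_fun [set: measurableTypeR R * measurableTypeR R]
    (fun z : measurableTypeR R * measurableTypeR R => ((z.2 : R) <= z.1)%R%:R : R).
  apply: (@measurableT_comp _ _ _ _ _ _ (fun b : bool => b%:R : R)) => //.
  exact: measurable_fun_ler.
have mss : measurable_fun [set: measurableTypeR R * measurableTypeR R]
   (fun z : measurableTypeR R * measurableTypeR R => s z.1 * s z.2 * ((z.2 : R) <= z.1)%R%:R).
  apply: measurable_funM => //; apply: measurable_funM; exact: (measurableT_comp ms).
(* pairs with zeta <= xi: given xi in the sublevel set, all such zeta are in it *)
have D1 : \int[P]_xi \int[P]_zeta (s xi * s zeta * (zeta <= xi)%R%:R) = J + 2^-1 * q.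
  rewrite /J /q -RintegralZl// -RintegralD//; last first.
    exact: (integrable_scale 2^-1 is_).
  apply: eq_Rintegral => xi _.
  transitivity (\int[P]_zeta (s xi * (zeta <= xi)%R%:R)).
    apply: eq_Rintegral => zeta _; case: (leP zeta xi) => h; last by rewrite !mulr0.
    by rewrite !mulr1 sX.
  rewrite RintegralZl//; first by rewrite centered_cdf_closed mulrDr [_ * s xi]mulrC.
  by apply: integrable_bool; exact: (measurableT_comp mle (pair1_measurable xi)).
(* the same quantity with the roles exchanged, evaluated by the complement; the
   diagonal does not count as P has no atoms *)
have D2 : \int[P]_xi \int[P]_zeta (s zeta * s xi * (xi <= zeta)%R%:R) = q * q - J - 2^-1 * q.
  have iz : P.-integrable setT (EFin \o (fun xi => 2^-1 * s xi)).
    exact: (integrable_scale 2^-1 is_).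
  have iqs : P.-integrable setT (EFin \o (fun xi => q * s xi)).
    exact: (integrable_scale q is_).
  transitivity (\int[P]_xi (q * s xi - (s xi * G xi + 2^-1 * s xi))).
    apply: eq_Rintegral => xi _.
    transitivity (\int[P]_zeta (s xi * (s zeta - (zeta < xi)%R%:R))).
      apply: eq_Rintegral => zeta _; case: (leP xi zeta) => h.
        by rewrite mulr1 subr0 mulrC.
      by rewrite mulr0 mulrBr (sX _ _ (ltW h)) mulr1 subrr.
    have il : P.-integrable setT (EFin \o (fun zeta : R => (zeta < xi)%R%:R : R)).
      apply: integrable_bool.
      apply: (@measurableT_comp _ _ _ _ _ _ (fun b : bool => b%:R : R)) => //.
      exact: measurable_fun_ltr.
    rewrite RintegralZl//; last first.
      by have := integrableB measurableT is_ il; apply: eq_integrable.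
    by rewrite RintegralB// centered_cdf_open -/q; ring.
  rewrite RintegralB//; last first.
    by have := integrableD measurableT isG iz; apply: eq_integrable.
  by rewrite RintegralD// !RintegralZl// -/J -/q; ring.
have DD : \int[P]_xi \int[P]_zeta (s xi * s zeta * (zeta <= xi)%R%:R) =
          \int[P]_xi \int[P]_zeta (s zeta * s xi * (xi <= zeta)%R%:R).
  apply: (@Rintegral_exchange _ _ (measurableTypeR R) (measurableTypeR R) R P P
    (fun z => s z.1 * s z.2 * ((z.2 : R) <= z.1)%R%:R)).
  apply: (@integrable_bounded_support _ (measurableTypeR R * measurableTypeR R)%type _
    (P \x P)%E setT 1) => //.
    rewrite -setXTT -[X in (X < _)%E]/((P \x P)%E (setT `*` setT)).
    rewrite product_measure1E//; apply: lte_mul_pinfty; first exact: measure_ge0.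
      exact: fin_num_measure.
    by apply: (@le_lt_trans _ _ 1%E); [exact: prob_le1|exact: ltry].
  move=> z; rewrite indicT mulr1 !normrM.
  have /andP[a0 a1] := s01 z.1; have /andP[b0 b1] := s01 z.2.
  rewrite (ger0_norm a0) (ger0_norm b0) (ger0_norm (ler0n _ _)).
  by apply: mulr_ile1; rewrite ?mulr_ge0 ?ler0n ?lern1 ?leq_b1 ?mulr_ile1.
rewrite D1 D2 in DD.
rewrite Uq gE; move: DD; move: (\int[P]_xi G xi) => m; clearbody J q.
move=> DD; by rewrite (symmetric_pairs DD); field.
Qed.

Variable Vx : R -> R.
Hypothesis Vxi : mu.-integrable setT (EFin \o Vx).

(** The nonlocal term of the equation at x is the drift of a particle at x: each
    step contributes the convolution of Vx with this step. *)
Lemma conv_U t x : Defs.conv Vx (fun y => U (y, t)) x = drift P Vx (X t) x.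
Proof.
have mV := measurable_L1 Vxi.
have gi : mu.-integrable setT (EFin \o (fun y => Vx (x - y))).
  apply/integrableP; split.
    apply/measurable_EFinP; apply: (measurableT_comp mV); exact: measurable_funB.
  have /integrableP[m1] := Vxi.
  rewrite -(@integral_reflect _ (fun y => `|(Vx y)%:E|%E) x)//.
  by apply/measurable_EFinP; exact: measurableT_comp.
rewrite /Defs.conv (integral_U t gi) /drift; apply: eq_Rintegral => xi _.
rewrite /kerV /Rintegral; congr fine.
rewrite -(@integral_reflect _ (fun y => (Vx y * step (x - X t xi - y))%:E) x).
  by apply: eq_integral => y _; congr (_ * step _)%:E; ring.
apply/measurable_EFinP; apply: measurable_funM => //.
apply: (measurableT_comp (@measurable_step R)); exact: measurable_funB.
Qed.

End solution.


(** * The space derivative as a density *)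

Section density.
Context (R : realType).
Notation mu := (@lebesgue_measure R).
Local Notation T := (measurableTypeR R).
Variable P : probability T R.
Variable X : R -> R -> R.
Hypothesis mX : measurable_fun [set: T * T] (fun z => X z.2 z.1).
Variable K : R -> R.
Hypothesis mK : measurable_fun setT K.
Hypothesis K_ge0 : forall t, 0 < t -> 0 <= K t.
Hypothesis X_mass : forall t (A : set R), 0 < t -> measurable A ->
  (P (X t @^-1` A) <= (K t)%:E * mu A)%E.

Definition pos_time (t : R) : R := (0 < t)%R%:R.

Lemma pos_time_ge0 t : 0 <= pos_time t. Proof. by rewrite /pos_time ler0n. Qed.

Lemma measurable_pos_time : measurable_fun setT pos_time.
Proof.
have -> : pos_time = \1_(`]0, +oo[%classic : set R).
  by apply/funext => t; rewrite /pos_time indicE mem_setE in_itv/= andbT.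
by apply: measurable_indic; exact: measurable_itv.
Qed.

Let Phi (z : T * T) : T * T := (X z.2 z.1, z.2).

Lemma measurable_Phi : measurable_fun setT Phi.
Proof. by apply: measurable_fun_pair. Qed.

Lemma X_mass_integral t (f : R -> \bar R) : 0 < t -> measurable_fun setT f ->
  (forall x, 0 <= f x)%E -> (\int[P]_xi f (X t xi) <= (K t)%:E * \int[mu]_x f x)%E.
Proof.
move=> t0 mf f0.
have mXt : measurable_fun [set: T] (X t : T -> T).
  exact: (measurableT_comp mX (pair2_measurable t)).
rewrite -(@ge0_integral_pushforward _ _ T T R (X t) mXt P setT f)//.
rewrite -(@ge0_integral_mscale _ _ _ mu setT measurableT (NngNum (K_ge0 t0)) f)//.
by apply: ge0_le_measure_integral => // A mA; exact: X_mass.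
Qed.

Lemma plane_sigma_finite : sigma_finite setT (mu \x mu)%E.
Proof.
have /sigma_finiteP[F [TF ndF Foo]] := sigma_finiteT mu.
exists (fun n => F n `*` F n).
  rewrite -setXTT TF predeqE => -[x y]; split.
    move=> [/= [n _ Fnx] [k _ Fky]]; exists (maxn n k) => //; split.
    - by move: x Fnx; exact/subsetPset/ndF/leq_maxl.
    - by move: y Fky; exact/subsetPset/ndF/leq_maxr.
  by move=> [n _ []/= ? ?]; split; exists n.
move=> k; have [mFk Fk] := Foo k; split; first exact: measurableX.
by rewrite product_measure1E// lte_mul_pinfty// ge0_fin_numE.
Qed.

(** The image of P x dt under the flow, restricted to positive times, has a density
    of at most K t at time t.  To apply the Radon-Nikodym theorem to a probability,
    time is given the exponential law, and its density is divided out at the end;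
    the bound, which holds almost everywhere, is made pointwise by truncation. *)
Lemma spread_density : exists u : T * T -> R,
  [/\ measurable_fun setT u,
      (forall z, 0 <= u z <= K z.2 * pos_time z.2) &
      forall f : T * T -> \bar R, measurable_fun setT f -> (forall z, 0 <= f z)%E ->
      (\int[(mu \x mu)%E]_z (f z * (u z)%:E) =
       \int[(P \x mu)%E]_z (f (Phi z) * (pos_time z.2)%:E))%E].
Proof.
pose e t := @exponential_pdf R 1 t * pos_time t.
have e0 t : 0 <= e t by rewrite mulr_ge0 ?pos_time_ge0// exponential_pdf_ge0.
have me : measurable_fun setT e.
  apply: measurable_funM; [exact: measurable_exponential_pdf|exact: measurable_pos_time].
have epos t : 0 < t -> 0 < e t.
  by move=> t0; rewrite /e exponential_pdfE ?ltW// mul1r /pos_time t0 mulr1 expR_gt0.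
have e1 : (\int[mu]_t (e t)%:E = 1)%E.
  rewrite -(@integral_exponential_pdf R 1 ltr01); apply: ae_eq_integral => //.
  - exact/measurable_EFinP.
  - by apply/measurable_EFinP; exact: measurable_exponential_pdf.
  - exists [set 0]; split => //; first exact: lebesgue_measure_set1.
    move=> t /= /not_implyP[_]; apply: contra_notP => /eqP t0.
    rewrite /e /pos_time; case: (ltP 0 t) => h; first by rewrite mulr1.
    rewrite mulr0 /exponential_pdf patchE; case: ifPn => //.
    by rewrite mem_setE in_itv/= andbT => h'; case/negP: t0; rewrite eq_le h h'.
have [W [_ WE]] := @integrable_density _ T R mu e me e0 e1.
pose Phif : {mfun (T * T)%type >-> (T * T)%type} := HB.pack Phi (@isMeasurableFun.Build _ _ (T * T)%type (T * T)%type Phi measurable_Phi).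
pose nu : probability (T * T)%type R := distribution (P \x W)%E Phif.
have nuE (f : T * T -> \bar R) : measurable_fun setT f -> (forall z, 0 <= f z)%E ->
    (\int[nu]_z f z = \int[mu]_t (\int[P]_xi f (X t xi, t) * (e t)%:E))%E.
  move=> mf f0.
  rewrite (ge0_integral_pushforward measurable_Phi)//=.
  rewrite fubini_tonelli2//=; last by exact: (measurableT_comp mf measurable_Phi).
  rewrite WE//.
  - apply: (@measurable_fun_fubini_tonelli_G _ _ T T R P (f \o Phi)) => //=.
    exact: (measurableT_comp mf measurable_Phi).
  - by move=> t; apply: integral_ge0.
(* the cloud has density at most K t at time t, and time has density e: this
   bounds the density of nu by w *)
pose w (z : T * T) := e z.2 * (K z.2 * pos_time z.2).
have mw : measurable_fun setT w.
  apply: measurable_funM; first exact: (measurableT_comp me).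
  apply: measurable_funM; first exact: (measurableT_comp mK).
  exact: (measurableT_comp measurable_pos_time).
have w0 z : 0 <= w z.
  rewrite /w mulr_ge0// /pos_time; case: ltP => h; rewrite ?mulr0// mulr1.
  exact: K_ge0.
have nule (f : T * T -> \bar R) : measurable_fun setT f -> (forall z, 0 <= f z)%E ->
    (\int[nu]_z f z <= \int[(mu \x mu)%E]_z (f z * (w z)%:E))%E.
  move=> mf f0; rewrite nuE//.
  have mfw : measurable_fun setT (fun z => f z * (w z)%:E)%E.
    by apply: emeasurable_funM => //; exact/measurable_EFinP.
  have fw0 z : (0 <= f z * (w z)%:E)%E by rewrite mule_ge0// lee_fin.
  rewrite (fubini_tonelli2 _ mfw fw0).
  have mG : measurable_fun setT (fun t => \int[P]_xi f (X t xi, t))%E.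
    apply: (@measurable_fun_fubini_tonelli_G _ _ T T R P (f \o Phi)) => //=.
    exact: (measurableT_comp mf measurable_Phi).
  apply: ge0_le_integral => //.
  - by move=> t _; rewrite mule_ge0 ?lee_fin//; apply: integral_ge0.
  - by apply: emeasurable_funM => //; exact/measurable_EFinP.
  - exact: measurable_fun_fubini_tonelli_G mfw fw0.
  - move=> t _; have [t0|t0] := leP t 0.
      have -> : e t = 0 by rewrite /e /pos_time ltNge t0/= mulr0.
      by rewrite mule0; apply: integral_ge0.
    rewrite /fubini_G /w/=.
    have mft : measurable_fun setT (fun x => f (x, t)).
      exact: (measurableT_comp mf (pair2_measurable t)).
    have c0 : (0 <= (e t * (K t * pos_time t))%:E)%E.
      rewrite lee_fin; apply: mulr_ge0; first exact: e0.
      by apply: mulr_ge0; [exact: K_ge0|exact: pos_time_ge0].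
    rewrite ge0_integralZr// [K t * _](_ : _ = K t); last by rewrite /pos_time t0 mulr1.
    rewrite [(e t * K t)%:E]EFinM [leRHS]muleC -muleA [leRHS]muleC.
    apply: lee_wpmul2r; first by rewrite lee_fin.
    exact: X_mass_integral t0 mft (fun x => f0 (x, t)).
pose mm : {sigma_finite_measure set (T * T)%type -> \bar R} := HB.pack (mu \x mu)%E
  (Measure_isSigmaFinite.Build _ _ _ (mu \x mu)%E plane_sigma_finite).
have dom : nu `<< mm.
  apply/null_content_dominatesP => A mA A0; apply/eqP; rewrite -measure_le0.
  apply: (@le_trans _ _ (\int[nu]_z (\1_A z)%:E)%E).
    by rewrite integral_indic// setIT.
  apply: (le_trans (nule _ _ _)).
  - by apply/measurable_EFinP; exact: measurable_indic.
  - by move=> z; rewrite lee_fin indicE.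
  have -> : (fun z => (\1_A z)%:E * (w z)%:E)%E = ((EFin \o w) \_ A).
    apply/funext => z; rewrite patchE indicE; case: (z \in A) => /=.
      by rewrite mul1e.
    by rewrite mul0e.
  rewrite -integral_mkcond null_set_integral//.
  by apply/measurable_EFinP; exact: measurable_funTS.
pose hr z := fine (Radon_Nikodym_SigmaFinite.f nu mm z).
have hrE z : Radon_Nikodym_SigmaFinite.f nu mm z = (hr z)%:E.
  by rewrite /hr fineK//; exact: Radon_Nikodym_SigmaFinite.f_fin_num.
have hr0 z : 0 <= hr z by rewrite -lee_fin -hrE; exact: Radon_Nikodym_SigmaFinite.f_ge0.
have mhr : measurable_fun setT hr.
  apply: measurableT_comp => //.
  exact: measurable_int (Radon_Nikodym_SigmaFinite.f_integrable dom).
have CV (f : T * T -> \bar R) : measurable_fun setT f -> (forall z, 0 <= f z)%E ->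
    (\int[(mu \x mu)%E]_z (f z * (hr z)%:E) = \int[nu]_z f z)%E.
  move=> mf f0; rewrite -(Radon_Nikodym_SigmaFinite.change_of_variables dom)//.
  by apply: eq_integral => z _; rewrite hrE.
pose E := [set z | w z < hr z].
have mE : measurable E.
  have := @measurable_fun_ltr _ _ _ setT w hr mw mhr measurableT [set true] I.
  by rewrite setTI; congr measurable; apply/seteqP; split => z.
have aele : {ae (mu \x mu)%E, forall z, hr z <= w z}.
  have mE1 : measurable_fun setT (\1_E : T * T -> R) by exact: measurable_indic.
  have E01 z : 0 <= \1_E z :> R by rewrite indicE.
  pose g z := (hr z - w z) * \1_E z.
  have g0 z : 0 <= g z.
    rewrite /g indicE; case: (boolP (z \in E)) => [/set_mem zE|_].
      by rewrite mulr1 subr_ge0 ltW.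
    by rewrite mulr0.
  have mg : measurable_fun setT g.
    by apply: measurable_funM => //; exact: measurable_funB.
  have J1 : (\int[(mu \x mu)%E]_z ((\1_E z)%:E * (hr z)%:E) = nu E)%E.
    rewrite (CV (fun z => (\1_E z)%:E)).
    - by rewrite integral_indic// setIT.
    - exact/measurable_EFinP.
    - by move=> z; rewrite lee_fin.
  have J2 : (nu E <= \int[(mu \x mu)%E]_z ((\1_E z)%:E * (w z)%:E))%E.
    apply: (@le_trans _ _ (\int[nu]_z (\1_E z)%:E)%E).
      by rewrite integral_indic// setIT.
    apply: nule; first exact/measurable_EFinP.
    by move=> z; rewrite lee_fin.
  have J3 : (\int[(mu \x mu)%E]_z ((\1_E z)%:E * (hr z)%:E) =
      \int[(mu \x mu)%E]_z (g z)%:E +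
      \int[(mu \x mu)%E]_z ((\1_E z)%:E * (w z)%:E))%E.
    rewrite -ge0_integralD//.
    - by apply: eq_integral => z _; rewrite -!EFinM -EFinD /g; congr EFin; ring.
    - by move=> z _; rewrite lee_fin.
    - exact/measurable_EFinP.
    - by move=> z _; rewrite mule_ge0 ?lee_fin.
    - by apply: emeasurable_funM; exact/measurable_EFinP.
  have Ig : (\int[(mu \x mu)%E]_z `|(g z)%:E| = 0)%E.
    under eq_integral do rewrite gee0_abs ?lee_fin//.
    apply/eqP; rewrite eq_le; apply/andP; split; last first.
      by apply: integral_ge0 => z _; rewrite lee_fin.
    have nuf : nu E \is a fin_num by exact: fin_num_measure.
    rewrite -(subee nuf) leeBrDr// -{2}J1 J3; apply: leeD => //.
  have /ae_eq_integral_abs : measurable_fun setT (EFin \o g) by exact/measurable_EFinP.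
  move=> /(_ (mu \x mu)%E measurableT) [/(_ Ig) aeg _].
  apply: filterS aeg => z /= /(_ I) [gz]; rewrite leNgt; apply/negP => zE.
  move: gz; rewrite /g indicE mem_set// mulr1 => /eqP; rewrite subr_eq0 => /eqP h.
  by move: zE; rewrite h ltxx.
(* min makes the bound hold everywhere; expR undoes the exponential density *)
pose u z := Num.min (hr z) (w z) * (pos_time z.2 * expR z.2).
have ee t : e t * expR t = pos_time t.
  rewrite /e /pos_time; case: (ltP 0 t) => t0; last by rewrite mulr0 mul0r.
  by rewrite exponential_pdfE ?(ltW t0)// mul1r mulr1 -expRD mulN1r addNr expR0.
have pp t : pos_time t * pos_time t = pos_time t.
  by rewrite /pos_time; case: (0 < t); rewrite ?mulr1 ?mulr0.
have pe0 z : 0 <= pos_time z.2 * expR z.2 :> R by rewrite mulr_ge0 ?pos_time_ge0 ?expR_ge0.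
have mpe : measurable_fun setT (fun z : T * T => pos_time z.2 * expR z.2).
  apply: measurable_funM; first exact: (measurableT_comp measurable_pos_time).
  exact: measurableT_comp.
exists u; split.
- apply: measurable_funM => //; exact: measurable_minr.
- move=> z; apply/andP; split; first by rewrite mulr_ge0// le_min hr0 w0.
  apply: (@le_trans _ _ (w z * (pos_time z.2 * expR z.2))).
    by rewrite ler_wpM2r// ge_min lexx orbT.
  apply: eq_ler; rewrite /w.
  transitivity ((e z.2 * expR z.2) * (K z.2 * (pos_time z.2 * pos_time z.2))); first ring.
  by rewrite ee pp mulrCA pp.
move=> f mf f0.
transitivity (\int[(mu \x mu)%E]_z ((f z * (pos_time z.2 * expR z.2)%:E) * (hr z)%:E))%E.
  apply: ae_eq_integral => //.
  - apply: emeasurable_funM => //; apply/measurable_EFinP.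
    by apply: measurable_funM => //; exact: measurable_minr.
  - by do 2?[apply: emeasurable_funM => //]; exact/measurable_EFinP.
  - apply: filterS aele => z hw _.
    by rewrite /u min_l// -muleA -EFinM [hr z * _]mulrC.
rewrite CV; last 2 first.
- by apply: emeasurable_funM => //; exact/measurable_EFinP.
- by move=> z; rewrite mule_ge0 ?lee_fin.
rewrite nuE; last 2 first.
- by apply: emeasurable_funM => //; exact/measurable_EFinP.
- by move=> z; rewrite mule_ge0 ?lee_fin.
rewrite fubini_tonelli2; last 2 first.
- apply: emeasurable_funM; first exact: (measurableT_comp mf measurable_Phi).
  by apply/measurable_EFinP; exact: (measurableT_comp measurable_pos_time).
- by move=> z; rewrite mule_ge0 ?lee_fin// pos_time_ge0.
apply: eq_integral => t _; rewrite /fubini_G/=.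
have mft : measurable_fun setT (fun xi => f (X t xi, t)).
  exact: (measurableT_comp (measurableT_comp mf measurable_Phi) (pair2_measurable t)).
rewrite ge0_integralZr//; last by rewrite lee_fin mulr_ge0 ?pos_time_ge0 ?expR_ge0.
rewrite ge0_integralZr//; last by rewrite lee_fin pos_time_ge0.
by rewrite -muleA -EFinM -mulrA [expR t * _]mulrC ee pp.
Qed.

Lemma integrable_time_bounded (M N : R) (g : T * T -> R) : 0 <= M ->
  measurable_fun setT g -> (forall z, `|g z| <= M * (`|z.2| <= N)%R%:R) ->
  (P \x mu)%E.-integrable setT (EFin \o g).
Proof.
move=> M0 mg gb.
have mI : measurable (`[- N, N]%classic : set T) by exact: measurable_itv.
have fI : (mu (`[(- N)%R, N]%classic : set R) < +oo)%E by exact: lebesgue_itvcc_fin.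
apply: (@integrable_bounded_support _ (T * T)%type _ (P \x mu)%E (setT `*` `[- N, N]%classic) M) => //.
- exact: measurableX.
- rewrite -[X in (X < _)%E]/((P \x mu)%E ((setT : set T) `*` `[(- N)%R, N]%classic)).
  rewrite product_measure1E// lte_mul_pinfty//; last exact: fin_num_measure.
- move=> z; apply: (le_trans (gb z)); rewrite ler_wpM2l// indicE in_setX !mem_setE !in_itv/=.
  by rewrite in_setT /= ler_norml.
Qed.

Lemma spacetime_int_plane (h : R * R -> R) : (mu \x mu)%E.-integrable setT (EFin \o h) ->
  (forall z, z.2 <= 0 -> h z = 0) ->
  spacetime_int h = \int[(mu \x mu)%E]_z h z.
Proof.
move=> hi h0; rewrite -(Rintegral21 hi) /spacetime_int Rintegral_mkcond.
apply: eq_Rintegral => t _; rewrite patchE mem_setE in_itv/= andbT.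
case: ltP => // t0; rewrite /Rintegral integral0_eq// => x _.
by rewrite h0.
Qed.

Section signed.
Variable u : T * T -> R.
Hypothesis mu_ : measurable_fun setT u.
Hypothesis u_bound : forall z, 0 <= u z <= K z.2 * pos_time z.2.
Hypothesis u_density : forall f : T * T -> \bar R, measurable_fun setT f ->
  (forall z, 0 <= f z)%E ->
  (\int[(mu \x mu)%E]_z (f z * (u z)%:E) =
   \int[(P \x mu)%E]_z (f (Phi z) * (pos_time z.2)%:E))%E.

Let u_early z : z.2 <= 0 -> u z = 0.
Proof.
move=> z0; have := u_bound z; rewrite /pos_time ltNge z0/= mulr0 => h.
by apply/eqP; rewrite eq_le andbC.
Qed.

Let density_ge0 (M N : R) (f : T * T -> R) : 0 <= M -> measurable_fun setT f ->
  (forall z, 0 <= f z <= M * (`|z.2| <= N)%R%:R) ->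
  [/\ (mu \x mu)%E.-integrable setT (EFin \o (fun z => u z * f z)),
      (P \x mu)%E.-integrable setT (EFin \o (fun z => f (Phi z) * pos_time z.2)) &
      \int[(mu \x mu)%E]_z (u z * f z) = \int[(P \x mu)%E]_z (f (Phi z) * pos_time z.2)].
Proof.
move=> M0 mf fb.
have f0 z : 0 <= f z by have /andP[] := fb z.
have mg : measurable_fun setT (fun z => f (Phi z) * pos_time z.2).
  apply: measurable_funM; first exact: (measurableT_comp mf measurable_Phi).
  exact: (measurableT_comp measurable_pos_time).
have gi : (P \x mu)%E.-integrable setT (EFin \o (fun z => f (Phi z) * pos_time z.2)).
  apply: (@integrable_time_bounded M N) => // z.
  rewrite normrM (ger0_norm (f0 _)) (ger0_norm (pos_time_ge0 _)).
  have /andP[_] := fb (Phi z); apply: le_trans; rewrite ler_piMr//.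
  by rewrite /pos_time; case: (0 < z.2).
have E : (\int[(mu \x mu)%E]_z (u z * f z)%:E =
    \int[(P \x mu)%E]_z (f (Phi z) * pos_time z.2)%:E)%E.
  have := @u_density (EFin \o f) _ _.
  rewrite (_ : (fun z => _) = (fun z => (u z * f z)%:E)); last first.
    by apply/funext => z; rewrite /= -EFinM mulrC.
  move=> -> //; last exact/measurable_EFinP.
split => //; last by rewrite /Rintegral E.
apply/integrableP; split; first by apply/measurable_EFinP; exact: measurable_funM.
have /integrableP[_] := gi; apply: le_lt_trans.
under eq_integral do rewrite /= ger0_norm ?mulr_ge0 ?(andP (u_bound _)).1//.
under [leRHS]eq_integral do rewrite /= ger0_norm ?mulr_ge0 ?pos_time_ge0//.
by rewrite E.
Qed.

(** The identity of [spread_density] for signed f, by positive and negative parts;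
    the bound on the support in time makes both sides finite. *)
Lemma density_test (M N : R) (f : T * T -> R) : 0 <= M -> measurable_fun setT f ->
  (forall z, `|f z| <= M * (`|z.2| <= N)%R%:R) ->
  [/\ spacetime_integrable (fun z => u z * f z) &
      spacetime_int (fun z => u z * f z) =
      \int[mu]_t (pos_time t * \int[P]_xi f (X t xi, t))].
Proof.
move=> M0 mf fb.
pose fp z := Num.max (f z) 0; pose fm z := Num.max (- f z) 0.
have fE z : f z = fp z - fm z.
  by rewrite /fp /fm; case: (leP (f z) 0) => h; case: (leP (- f z) 0) => h2; lra.
have pb z : 0 <= fp z <= M * (`|z.2| <= N)%R%:R.
  rewrite /fp le_max lexx orbT ge_max (le_trans (ler_norm _) (fb z))/=.
  by rewrite mulr_ge0.
have nb z : 0 <= fm z <= M * (`|z.2| <= N)%R%:R.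
  rewrite /fm le_max lexx orbT ge_max (le_trans (ler_norm _))/= ?normrN//.
  by rewrite mulr_ge0.
have mp : measurable_fun setT fp by exact: measurable_maxr.
have mm : measurable_fun setT fm.
  by apply: measurable_maxr => //; exact: measurable_funN.
have [p1 p2 p3] := density_ge0 M0 mp pb.
have [m1 m2 m3] := density_ge0 M0 mm nb.
have hE : (fun z => u z * f z) = (fun z => u z * fp z - u z * fm z).
  by apply/funext => z; rewrite fE mulrBr.
have gE : (fun z => f (Phi z) * pos_time z.2) =
    (fun z => fp (Phi z) * pos_time z.2 - fm (Phi z) * pos_time z.2).
  by apply/funext => z; rewrite fE mulrBl.
have hi : (mu \x mu)%E.-integrable setT (EFin \o (fun z => u z * f z)).
  by rewrite hE; have := integrableB measurableT p1 m1; apply: eq_integrable.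
have gi : (P \x mu)%E.-integrable setT (EFin \o (fun z => f (Phi z) * pos_time z.2)).
  by rewrite gE; have := integrableB measurableT p2 m2; apply: eq_integrable.
split.
  apply: (integrableS measurableT) hi => //.
  by apply: measurableX => //; exact: measurable_itv.
rewrite spacetime_int_plane//; last by move=> z z0; rewrite u_early// mul0r.
rewrite hE RintegralB// p3 m3 -RintegralB// -gE -(Rintegral21 gi).
apply: eq_Rintegral => t _ /=.
have mft : measurable_fun setT (fun xi => f (X t xi, t)).
  exact: (measurableT_comp (measurableT_comp mf measurable_Phi) (pair2_measurable t)).
rewrite RintegralZr//; first by rewrite mulrC.
apply: (@integrable_bounded _ _ _ P M) => // xi.
by apply: (le_trans (fb _)) => /=; rewrite ler_piMr//; case: (`|t| <= N).
Qed.

End signed.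

End density.

(** * Test functions and steps *)

Section test_functions.
Context (R : realType).
Notation mu := (@lebesgue_measure R).

Lemma is_derive_continuous (f f' : R -> R) : (forall x : R, is_derive x 1 f (f' x)) -> continuous f.
Proof.
move=> df x; have [d1 _] := df x.
exact: differentiable_continuous (proj1 (derivable1_diffP _ _) d1).
Qed.

Definition in_box (N : R) (z : R * R) : bool := (`|z.1| <= N) && (`|z.2| <= N).

(** A bound for the size and the support of f in a single inequality, the form in
    which both serve as a domination. *)
Definition boxed (N M : R) (f : R * R -> R) := forall z, `|f z| <= M * (in_box N z)%:R.

Lemma boxed_le N M f z : 0 <= M -> boxed N M f -> `|f z| <= M.
Proof. by move=> M0 fb; apply: (le_trans (fb z)); rewrite ler_piMr//; case: (in_box _ _). Qed.

Lemma boxed_out N M f z : boxed N M f -> ~~ in_box N z -> f z = 0.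
Proof. by move=> fb zN; apply/eqP; rewrite -normr_le0; have := fb z; rewrite (negbTE zN) mulr0. Qed.

Lemma boxed_near0 N M (f : R * R -> R) : (forall z, in_box N z -> `|f z| <= M) ->
  (forall z, ~~ in_box N z -> f z = 0) -> boxed N M f.
Proof.
move=> f1 f2 z; case: (boolP (in_box N z)) => zN; first by rewrite mulr1 f1.
by rewrite f2// normr0 mulr0.
Qed.

Lemma test_function_continuous (D : set (R * R)) phi : test_function D phi ->
  [/\ continuous phi, continuous (dx phi) & continuous (dt phi)].
Proof.
move=> [+ _ _] => /(_ 1%N)[cphi h]; split => //.
- by have [_ []] := h ((1, 0) : R * R).
- by have [_ []] := h ((0, 1) : R * R).
Qed.

Lemma fsupport_out (f : R * R -> R) z : ~ fsupport f z -> \near z, f z = 0.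
Proof.
move=> fz; have : open (~` fsupport f) by apply: closed_openC; exact: closed_closure.
rewrite openE => /(_ z fz); rewrite /interior => h; near=> w.
have : ~ fsupport f w by near: w; exact: h.
by move=> fw; apply/eqP; apply: contrapT => /negP h2; apply: fw; exact: subset_closure.
Unshelve. all: by end_near. Qed.

Lemma fsupport_derive (f : R * R -> R) v z : ~ fsupport f z -> 'D_v f z = 0.
Proof.
move=> fz; rewrite -(@derive_cst _ _ _ (0 : R) z v); apply: near_eq_derive.
exact: fsupport_out.
Qed.

Lemma test_function_boxed (D : set (R * R)) phi : test_function D phi ->
  exists N M, [/\ 0 < N, 0 < M, boxed N M phi, boxed N M (dx phi) & boxed N M (dt phi)].
Proof.
move=> tphi; have [cf cx ct] := test_function_continuous tphi.
have [_ cK _] := tphi.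
have bnd (f : R * R -> R) : continuous f -> \forall M \near +oo,
    forall z, fsupport phi z -> `|f z| <= M.
  move=> fc; have := compact_bounded (continuous_compact (continuous_subspaceT fc) cK).
  rewrite /bounded_near/= => hb; apply: filterS hb => M h z Kz.
  by apply: (h (f z)); exists z.
have bN : \forall M \near +oo, forall z, fsupport phi z -> in_box M z.
  have := compact_bounded cK; rewrite /bounded_near/= => hb.
  apply: filterS hb => M h z /h /=.
  by rewrite prod_normE ge_max.
have b1 := bnd _ cf; have b2 := bnd _ cx; have b3 := bnd _ ct.
have : exists M, [/\ 0 < M, (forall z, fsupport phi z -> in_box M z),
   (forall z, fsupport phi z -> `|phi z| <= M),
   (forall z, fsupport phi z -> `|dx phi z| <= M) &
   (forall z, fsupport phi z -> `|dt phi z| <= M)].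
  have b0 : \forall M \near +oo, (0 : R) < M by exact: nbhs_pinfty_gt.
  have [M [M0 [k1 [k2 [k3 k4]]]]] :=
    filter_ex (filterI b0 (filterI bN (filterI b1 (filterI b2 b3)))).
  by exists M.
move=> [M [M0 hN h1 h2 h3]]; exists M, M.
have aux (f : R * R -> R) : (forall z, fsupport phi z -> `|f z| <= M) ->
    (forall z, ~ fsupport phi z -> f z = 0) -> boxed M M f.
  move=> k1 k2; apply: boxed_near0 => z zM.
    by have [Kz|/k2 ->] := pselect (fsupport phi z); [exact: k1|rewrite normr0 ltW].
  by apply: k2 => /hN; rewrite (negbTE zM).
split => //; apply: aux => // z Kz.
- by have := fsupport_out Kz => /nbhs_singleton.
- exact: fsupport_derive.
- exact: fsupport_derive.
Unshelve. all: by end_near. Qed.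

Lemma test_function_dx (D : set (R * R)) phi x t : test_function D phi ->
  is_derive (x : R) 1 (fun y : R => phi (y, t)) (dx phi (x, t)).
Proof.
move=> [+ _ _] => /(_ 1%N)[_ /(_ (1, 0)) [+ _]] => /(_ (x, t)).
rewrite /dx => d1; have e : (fun h : R => h^-1 *: (phi (h *: (1, 0) + (x, t)) - phi (x, t))) =
   (fun h : R => h^-1 *: (phi (h *: 1 + x, t) - phi (x, t))).
  apply/funext => h; congr (_ *: (phi _ - _)).
  by rewrite -[h *: (1, 0)]/(h * 1, h * 0)/= -[LHS]/(h * 1 + x, h * 0 + t) mulr0 add0r.
by split; rewrite /derivable /derive /= -?e.
Qed.

Lemma test_function_dt (D : set (R * R)) phi x t : test_function D phi ->
  is_derive (t : R) 1 (fun s : R => phi (x, s)) (dt phi (x, t)).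
Proof.
move=> [+ _ _] => /(_ 1%N)[_ /(_ (0, 1)) [+ _]] => /(_ (x, t)).
rewrite /dt => d1; have e : (fun h : R => h^-1 *: (phi (h *: (0, 1) + (x, t)) - phi (x, t))) =
   (fun h : R => h^-1 *: (phi (x, h *: 1 + t) - phi (x, t))).
  apply/funext => h; congr (_ *: (phi _ - _)).
  by rewrite -[h *: (0, 1)]/(h * 0, h * 1)/= -[LHS]/(h * 0 + x, h * 1 + t) mulr0 add0r.
by split; rewrite /derivable /derive /= -?e.
Qed.

Lemma slice_x_continuous (f : R * R -> R) t : continuous f -> continuous (fun x : R => f (x, t)).
Proof.
move=> fc x; apply: (@continuous_comp _ _ _ (fun x : R => (x, t)) f); last exact: fc.
exact: (@cvg_pair _ _ _ (nbhs x) (nbhs x) (nbhs t) _ _ _ id (cst t) cvg_id (cvg_cst _)).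
Qed.

Lemma slice_t_continuous (f : R * R -> R) x : continuous f -> continuous (fun t : R => f (x, t)).
Proof.
move=> fc t; apply: (@continuous_comp _ _ _ (fun t : R => (x, t)) f); last exact: fc.
exact: (@cvg_pair _ _ _ (nbhs t) (nbhs x) (nbhs t) _ _ _ (cst x) id (cvg_cst _) cvg_id).
Qed.

Lemma measurable_plane (f : R * R -> R) : continuous f ->
  measurable_fun [set: measurableTypeR R * measurableTypeR R] f.
Proof.
move=> fc; apply: caratheodory_measurable.
  move=> t; exact: (continuous_measurable_fun (slice_x_continuous fc)).
by move=> x; exact: slice_t_continuous.
Qed.

(** The increment is split into one in x, treated by the mean value theorem and the
    continuity of fx, and one in time at the fixed position g t. *)
Lemma chain_rule (f fx ft : R * R -> R) (g : R -> R) (t g' : R) :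
  (forall x s, is_derive (x : R) 1 (fun y : R => f (y, s)) (fx (x, s))) ->
  (forall x s, is_derive (s : R) 1 (fun r : R => f (x, r)) (ft (x, s))) ->
  continuous fx -> is_derive t 1 g g' ->
  is_derive t 1 (fun s => f (g s, s)) (fx (g t, t) * g' + ft (g t, t)).
Proof.
move=> dfx dft cx dg.
suff h : h^-1 *: (f (g (h *: 1 + t), h *: 1 + t) - f (g t, t)) @[h --> 0^'] -->
   fx (g t, t) * g' + ft (g t, t).
  by split; [apply/cvg_ex; eexists; exact: h|exact/cvg_lim].
have h2 : h^-1 *: (f (g t, h *: 1 + t) - f (g t, t)) @[h --> 0^'] --> ft (g t, t).
  by have [d1 d2] := dft (g t) t; rewrite -d2; exact: d1.
have ct : h *: 1 + t @[h --> (0 : R)^'] --> t.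
  apply: cvg_within_filter.
  apply/cvgrPdist_lt => e e0; near=> h.
  rewrite opprD addrCA subrr addr0 normrN [h *: 1]mulr1 -[h]subr0 distrC; near: h.
  exact: (@cvgr_dist_lt _ _ _ (nbhs (0 : R)) _ id 0 cvg_id).
have gt : g (h *: 1 + t) @[h --> (0 : R)^'] --> g t.
  have dgt : derivable g t 1 by case: dg.
  apply: (cvg_comp _ _ ct).
  exact: differentiable_continuous (proj1 (derivable1_diffP _ _) dgt).
have h1 : h^-1 *: (f (g (h *: 1 + t), h *: 1 + t) - f (g t, h *: 1 + t)) @[h --> 0^'] -->
    fx (g t, t) * g'.
  have mvt (x y s : R) : exists2 xi, `|xi - x| <= `|y - x| &
      f (y, s) - f (x, s) = fx (xi, s) * (y - x).
    have cs := is_derive_continuous (dfx^~ s).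
    have [xy|yx] := leP x y.
      have [xi] := MVT_segment xy (fun z _ => dfx z s) (continuous_subspaceT cs).
      rewrite in_itv/= => /andP[x1 x2] e; exists xi => //.
      by rewrite !ger0_norm ?subr_ge0// lerD2r.
    have [xi] := MVT_segment (ltW yx) (fun z _ => dfx z s) (continuous_subspaceT cs).
    rewrite in_itv/= => /andP[x1 x2] e; exists xi => //.
      by rewrite !ler0_norm ?subr_le0 ?(ltW yx)// lerN2 lerD2r.
    by rewrite -[LHS]opprB e -mulrN opprB.
  have gg : h^-1 *: (g (h *: 1 + t) - g t) @[h --> 0^'] --> g'.
    by have [d1 d2] := dg; rewrite -d2; exact: d1.
  pose xi h := sval (cid2 (mvt (g t) (g (h *: 1 + t)) (h *: 1 + t))).
  have xi1 h : `|xi h - g t| <= `|g (h *: 1 + t) - g t| by rewrite /xi; case: cid2.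
  have xi2 h : f (g (h *: 1 + t), h *: 1 + t) - f (g t, h *: 1 + t) =
     fx (xi h, h *: 1 + t) * (g (h *: 1 + t) - g t) by rewrite /xi; case: cid2.
  have xit : xi h @[h --> (0 : R)^'] --> g t.
    apply/cvgrPdist_lt => e e0; near=> h; rewrite distrC; apply: (le_lt_trans (xi1 h)).
    rewrite distrC; near: h; exact: (@cvgr_dist_lt _ _ _ ((0 : R)^') _ _ _ gt e e0).
  under eq_fun do rewrite xi2 scalerAr.
  apply: cvgM => //.
  have cp : (xi h, h *: 1 + t) @[h --> (0 : R)^'] --> (g t, t).
    exact: (@cvg_pair _ _ _ ((0 : R)^') (nbhs (g t)) (nbhs t) _ _ _ _ _ xit ct).
  exact: (cvg_comp _ _ cp (cx _)).
have -> : (fun h : R => h^-1 *: (f (g (h *: 1 + t), h *: 1 + t) - f (g t, t))) =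
    (fun h : R => h^-1 *: (f (g (h *: 1 + t), h *: 1 + t) - f (g t, h *: 1 + t))) \+
    (fun h : R => h^-1 *: (f (g t, h *: 1 + t) - f (g t, t))).
  by apply/funext => h /=; rewrite -scalerDr addrA subrK.
exact: cvgD.
Unshelve. all: by end_near. Qed.

Lemma fundamental_theorem (h h' : R -> R) a b : a < b -> continuous h' ->
  (forall x, is_derive (x : R) 1 h (h' x)) ->
  \int[mu]_(x in `[a, b]) h' x = h b - h a.
Proof.
move=> ab ch dh; rewrite /Rintegral (@continuous_FTC2 _ h' h a b ab (continuous_subspaceT ch))//.
  have hc := is_derive_continuous dh.
  split.
  - by move=> x _; have [] := dh x.
  - exact: cvg_at_right_filter (hc a).
  - exact: cvg_at_left_filter (hc b).
by move=> x _; rewrite derive1E; have [_ ->] := dh x.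
Qed.

(** The distributional derivative of a step is the Dirac mass at its jump. *)
Lemma step_pairing (h h' : R -> R) (N z : R) : continuous h' ->
  (forall x, is_derive (x : R) 1 h (h' x)) ->
  (forall x, N < `|x| -> h x = 0 /\ h' x = 0) ->
  \int[mu]_x (h' x * step (x - z)) = - h z.
Proof.
move=> ch dh hN.
pose L := `|N| + `|z| + 1.
have zL : z < L by rewrite /L; have := ler_norm z; have := normr_ge0 N; lra.
have Lz : - L < z by rewrite /L; have := ler_norm (- z); rewrite normrN; have := normr_ge0 N; lra.
have NL : N < L by rewrite /L; have := ler_norm N; have := normr_ge0 z; lra.
have L0 : 0 < L by rewrite /L ltr_wpDl// addr_ge0.
have [hL _] : h L = 0 /\ h' L = 0 by apply: hN; rewrite gtr0_norm.
have [hL' _] : h (- L) = 0 /\ h' (- L) = 0 by apply: hN; rewrite normrN gtr0_norm.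
have mh : measurable_fun setT h' by exact: (continuous_measurable_fun ch).
have ii a b : mu.-integrable setT (EFin \o (fun x => h' x * \1_(`[a, b]%classic) x)).
  have := @continuous_compact_integrable _ h' _ (@segment_compact _ a b) (continuous_subspaceT ch).
  move=> hi; have := proj1 (@integrable_mkcond _ _ _ mu _ (EFin \o h') (measurable_itv `[a, b])) hi.
  apply: eq_integrable => // x _.
  by rewrite /= patchE indicE; case: ifP => _; rewrite ?mulr1 ?mulr0.
have iE a b : a < b -> \int[mu]_x (h' x * \1_(`[a, b]%classic) x) = h b - h a.
  move=> ab; rewrite -(fundamental_theorem ab ch dh) [RHS]Rintegral_mkcond.
  by apply: eq_Rintegral => x _; rewrite patchE indicE; case: ifP => _; rewrite ?mulr1 ?mulr0.
transitivity (\int[mu]_x (h' x * \1_(`[z, L]%classic) x - 2^-1 * (h' x * \1_(`[- L, L]%classic) x))).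
  apply: eq_Rintegral => x _; have [xL|Lx] := leP `|x| L; last first.
    have [_ ->] : h x = 0 /\ h' x = 0 by apply: hN; exact: lt_trans Lx.
    by rewrite !mul0r mulr0 subr0.
  have := xL; rewrite ler_norml => /andP[x1 x2].
  rewrite /step !indicE !mem_setE !in_itv/= x1 x2 /= subr_ge0 andbT mulr1.
  by rewrite mulrBr [2^-1 * _]mulrC.
rewrite RintegralB//; first rewrite RintegralZl// !iE// ?hL ?hL'; try lra.
exact: (integrable_scale 2^-1 (ii (- L) L)).
Qed.

Lemma integrable_boxed_slice N M (f : R * R -> R) t : 0 <= M -> boxed N M f ->
  measurable_fun setT (fun x : R => f (x, t)) ->
  mu.-integrable setT (EFin \o (fun x => f (x, t))).
Proof.
move=> M0 fb mf; apply: (@integrable_bounded_support _ (measurableTypeR R) _ mu `[- N, N]%classic M) => //.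
- exact: lebesgue_itvcc_fin.
- move=> x; apply: (le_trans (fb (x, t))); rewrite ler_wpM2l// indicE mem_setE in_itv/= -ler_norml.
  by rewrite /in_box/=; case: (`|x| <= N) => //=; case: (`|t| <= N).
Qed.

Lemma integrable_boxed_plane N M (f : R * R -> R) : 0 <= M -> boxed N M f ->
  measurable_fun [set: measurableTypeR R * measurableTypeR R] f ->
  (mu \x mu)%E.-integrable setT (EFin \o f).
Proof.
move=> M0 fb mf.
have mI : measurable (`[- N, N]%classic : set R) by exact: measurable_itv.
have fI : (mu (`[(- N)%R, N]%classic : set R) < +oo)%E by exact: lebesgue_itvcc_fin.
apply: (@integrable_bounded_support _ (measurableTypeR R * measurableTypeR R)%type _ _
   (`[- N, N]%classic `*` `[- N, N]%classic) M) => //.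
- exact: measurableX.
- rewrite -[X in (X < _)%E]/((mu \x mu)%E (`[(- N)%R, N]%classic `*` `[(- N)%R, N]%classic)).
  by rewrite product_measure1E// lte_mul_pinfty// ge0_fin_numE.
- move=> z; apply: (le_trans (fb z)); rewrite ler_wpM2l// indicE in_setX !mem_setE !in_itv/=.
  by rewrite -!ler_norml.
Qed.

End test_functions.

(** * The weak formulation *)

Section moving_test.
Context (R : realType).
Notation mu := (@lebesgue_measure R).

Lemma boxed_window (N M : R) (f : R * R -> R) (r x s y : R) : 0 <= M -> boxed N M f -> `|x| <= r ->
  `|f (x + y, s) * step y| <= M * \1_(`[- (N + r), N + r]%classic) y.
Proof.
move=> M0 fb xr; rewrite normrM; apply: (@le_trans _ _ (`|f (x + y, s)| * 1)).
  by rewrite ler_wpM2l// step_le1.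
rewrite mulr1 (le_trans (fb _))// ler_wpM2l// indicE mem_setE in_itv/= /in_box/=.
case: (leP `|x + y| N) => h; rewrite [X in X%:R <= _]/=; last by rewrite mulr0n ler0n.
have h2 : `|y| <= N + r.
  have -> : y = (x + y) - x by ring.
  by rewrite (le_trans (ler_normB _ _))// lerD.
by move: h2; rewrite ler_norml => ->; case: (`|s| <= N).
Qed.

Lemma measurable_window_step (f : R * R -> R) (x s : R) : continuous f ->
  measurable_fun setT (fun y : R => f (x + y, s) * step y).
Proof.
move=> cf; apply: measurable_funM; last exact: measurable_step.
apply: (measurableT_comp (f := fun y => f (y, s)) (g := fun y => x + y)).
  exact: (continuous_measurable_fun (slice_x_continuous cf)).
exact: measurable_funD.
Qed.

Lemma integrable_window_step (N M : R) (f : R * R -> R) (x s : R) : 0 <= M -> boxed N M f ->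
  continuous f -> mu.-integrable setT (EFin \o (fun y : R => f (x + y, s) * step y)).
Proof.
move=> M0 fb cf.
apply: (@integrable_bounded_support _ (measurableTypeR R) _ mu
  (`[- (N + `|x|), N + `|x|]%classic) M) => //.
- exact: lebesgue_itvcc_fin.
- exact: measurable_window_step.
- by move=> y; exact: boxed_window.
Qed.

Lemma integrable_cst_itv (M r : R) :
  mu.-integrable setT (EFin \o (fun y : R => M * \1_(`[- r, r]%classic) y)).
Proof.
apply: (@integrable_bounded_support _ (measurableTypeR R) _ mu (`[- r, r]%classic) `|M|) => //.
- exact: lebesgue_itvcc_fin.
- by apply: measurable_funM => //; exact: measurable_indic_itv.
- by move=> y; rewrite normrM (ger0_norm (x := \1_ _ _)) ?indicE.
Qed.

Lemma moving_steps_continuous (N M : R) (f : R * R -> R) (g1 g2 : R -> R) : 0 <= M ->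
  boxed N M f -> continuous f -> continuous g1 -> continuous g2 ->
  continuous (fun s => \int[mu]_y (f (g1 s + y, g2 s) * step y)).
Proof.
move=> M0 fb cf c1 c2 s0.
have : \forall s \near s0, `|g1 s| < `|g1 s0| + 1.
  near=> s; have : `|g1 s0 - g1 s| < 1.
    by near: s; exact: (@cvgr_dist_lt _ _ _ (nbhs s0) _ g1 (g1 s0) (c1 s0)).
  have := lerB_dist (g1 s) (g1 s0); rewrite [`|_ - g1 s0|]distrC; lra.
move=> [d /= d0 Hd].
have Hd' s : `]s0 - d, s0 + d[%classic s -> `|g1 s| <= `|g1 s0| + 1.
  rewrite /= in_itv/= => /andP[h1 h2]; apply: ltW; apply: Hd => /=.
  by rewrite distrC ltr_norml; lra.
have := @continuity_under_integral R _ (measurableTypeR R) mu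
  (fun s y => f (g1 s + y, g2 s) * step y) setT measurableT (s0 - d) (s0 + d).
move=> /(_ _ _ (fun y => M * \1_(`[- (N + (`|g1 s0| + 1)), N + (`|g1 s0| + 1)]%classic) y)).
apply.
- by move=> s _; exact: (integrable_window_step (g1 s) (g2 s) M0 fb cf).
- apply: aeW => y _ s _.
  apply: cvgM; last exact: cvg_cst.
  apply: (@continuous_comp _ _ _ (fun s : R => (g1 s + y, g2 s)) f); last exact: cf.
  apply: (@cvg_pair _ _ _ (nbhs s) (nbhs (g1 s + y)) (nbhs (g2 s))); last exact: c2.
  by apply: cvgD; [exact: c1|exact: cvg_cst].
- exact: integrable_cst_itv.
- by move=> s /Hd' sd; apply: aeW => y _; exact: boxed_window.
- by rewrite inE/= in_itv/=; lra.
Unshelve. all: by end_near. Qed.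

Lemma shift_steps (f : R * R -> R) (x t : R) : continuous f ->
  \int[mu]_y (f (x + y, t) * step y) = \int[mu]_y (f (y, t) * step (y - x)).
Proof.
move=> cf; rewrite /Rintegral; congr fine.
rewrite -(@integral_shift _ (fun y => (f (y, t) * step (y - x))%:E) x).
  by apply: eq_integral => y _; rewrite addrK [y + x]addrC.
apply/measurable_EFinP; apply: measurable_funM.
  exact: (continuous_measurable_fun (slice_x_continuous cf)).
by apply: (measurableT_comp (@measurable_step R)); exact: measurable_funB.
Qed.

Lemma taylor_is_derive (g : R -> R) (v K t0 : R) : 0 < t0 ->
  (forall t, 0 <= t -> `|g t - g t0 - (t - t0) * v| <= K * (t - t0) ^+ 2) ->
  is_derive t0 1 g v.
Proof.
move=> t00 gv.
suff h : h^-1 *: (g (h *: 1 + t0) - g t0) @[h --> 0^'] --> v.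
  by split; [apply/cvg_ex; eexists; exact: h|exact/cvg_lim].
apply/cvgrPdist_lt => e e0; near=> h.
have h0 : h != 0 by near: h; exact: nbhs_dnbhs_neq.
have ht : `|h| < t0.
  by near: h; apply: dnbhs0_lt.
have hK : `|h| < e / (`|K| + 1).
  by near: h; apply: dnbhs0_lt; rewrite divr_gt0// ltr_wpDl.
have := gv (h + t0); rewrite addrK => /(_ _) h1.
have {}h1 : `|g (h + t0) - g t0 - h * v| <= K * h ^+ 2.
  by apply: h1; move: ht; rewrite ltr_norml; lra.
rewrite distrC [h *: 1]mulr1.
have -> : h^-1 *: (g (h + t0) - g t0) - v = h^-1 * (g (h + t0) - g t0 - h * v).
  by rewrite [h^-1 *: _]/(h^-1 * _) mulrBr mulKf.
rewrite normrM normfV mulrC ltr_pdivrMr ?normr_gt0//; apply: (le_lt_trans h1).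
apply: (@le_lt_trans _ _ ((`|K| + 1) * `|h| * `|h|)).
  rewrite -mulrA -expr2 real_normK ?num_real// ler_wpM2r ?sqr_ge0//.
  by rewrite (le_trans (ler_norm K))// lerDl.
rewrite ltr_pM2r ?normr_gt0// mulrC -ltr_pdivlMr// ltr_wpDl//.
Unshelve. all: by end_near. Qed.

End moving_test.

Section weak_form.
Context (R : realType).
Notation mu := (@lebesgue_measure R).
Variable P : probability (measurableTypeR R) R.
Local Notation G := (centered_cdf P).
Hypothesis Gcont : continuous G.
Variable Vx : R -> R.
Hypothesis Vxi : mu.-integrable setT (EFin \o Vx).
Variables (A a : R).
Hypothesis A_gt0 : 0 < A.
Hypothesis normVx : \int[mu]_w `|Vx w| <= a.
Hypothesis aA : a < A.
Variables (K : R -> R) (X : R -> R -> R).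
Hypothesis X_start : forall t xi, t <= 0 -> X t xi = xi.
Hypothesis X_lip : forall s t xi, `|X t xi - X s xi| <= 2 * A * `|t - s|.
Hypothesis X_expands : forall t, 0 < t -> expands P ((A - a) * t) (X t).
Hypothesis X_taylor : forall t0 t xi, 0 < t0 -> 0 <= t ->
  `|X t xi - X t0 xi - (t - t0) * vel P Vx A (X t0) xi| <= K t0 * (t - t0) ^+ 2.

Let B_ge0 : 0 <= 2 * A. Proof. by rewrite mulr_ge0// ltW. Qed.
Let c_gt0 : 0 < A - a. Proof. by rewrite subr_gt0. Qed.
Let mX t : measurable_fun setT (X t) := measurable_X c_gt0 X_start X_expands t.
Let mX2 := measurable_X2 B_ge0 c_gt0 X_start X_lip X_expands.
Let X_cont xi : continuous (fun t => X t xi). Proof. exact: (@X_continuous _ _ _ B_ge0 X_lip xi). Qed.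

Lemma X_derive (t xi : R) : 0 < t -> is_derive t 1 (fun s => X s xi) (vel P Vx A (X t) xi).
Proof. by move=> t0; apply: (taylor_is_derive t0) => s; exact: X_taylor. Qed.

Lemma X_size t r xi : t <= r -> 0 <= r -> `|X t xi| <= `|xi| + 2 * A * r.
Proof.
move=> tr r0; have [t0|t0] := leP t 0; first by rewrite X_start// lerDl mulr_ge0.
have := X_lip 0 t xi; rewrite (X_start _ (lexx 0)) subr0 (gtr0_norm t0) => h.
have := lerB_dist (X t xi) xi.
have : 2 * A * t <= 2 * A * r by rewrite ler_wpM2l.
lra.
Qed.

Lemma drift_continuous (g1 g2 : R -> R) : continuous g1 -> continuous g2 ->
  continuous (fun s => drift P Vx (X (g2 s)) (g1 s)).
Proof.
move=> c1 c2 s0.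
have := @continuity_under_integral R _ (measurableTypeR R) P
  (fun s xi => kerV Vx (g1 s - X (g2 s) xi)) setT measurableT (s0 - 1) (s0 + 1).
move=> /(_ _ _ (cst a)); apply.
- move=> s _; exact: integrable_kerV_from.
- apply: aeW => xi _ s _.
  apply: (@continuous_comp _ _ _ (fun s : R => g1 s - X (g2 s) xi)); last exact: kerV_continuous.
  apply: cvgB; first exact: c1.
  exact: (continuous_comp (c2 s) (@X_cont xi (g2 s))).
- by apply: (@integrable_bounded _ _ _ P `|a|).
- by move=> s _; apply: aeW => xi _; apply: le_trans normVx; exact: kerV_le_L1.
- by rewrite inE/= in_itv/=; lra.
Qed.

Lemma measurable_drift_plane :
  measurable_fun [set: measurableTypeR R * measurableTypeR R]
    (fun z => drift P Vx (X z.2) z.1).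
Proof.
apply: caratheodory_measurable.
- move=> t; apply: continuous_measurable_fun.
  by apply: (@drift_continuous id (cst t)) => s; [exact: cvg_id|exact: cvg_cst].
- by move=> x; apply: (@drift_continuous (cst x) id) => s; [exact: cvg_cst|exact: cvg_id].
Qed.

Lemma vel_continuous xi : continuous (fun t => vel P Vx A (X t) xi).
Proof.
move=> t; apply: cvgB; first exact: cvg_cst.
by apply: (@drift_continuous (fun t => X t xi) id) => s; [exact: X_cont|exact: cvg_id].
Qed.

Let mPhi : measurable_fun [set: measurableTypeR R * measurableTypeR R]
  (fun z : measurableTypeR R * measurableTypeR R =>
     (X z.2 z.1, z.2) : measurableTypeR R * measurableTypeR R).
Proof. by apply: measurable_fun_pair. Qed.

Lemma measurable_vel_plane :
  measurable_fun [set: measurableTypeR R * measurableTypeR R]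
    (fun z => vel P Vx A (X z.2) z.1).
Proof.
apply: measurable_funB.
  apply: measurable_funM => //; exact: (measurableT_comp (measurable_ccdf0 P)).
exact: (measurableT_comp measurable_drift_plane mPhi).
Qed.

Section one_test_function.
Variable phi : R * R -> R.
Hypothesis tphi : test_function setT phi.
Variables (N M : R).
Hypothesis N_gt0 : 0 < N.
Hypothesis M_gt0 : 0 < M.
Hypothesis bphi : boxed N M phi.
Hypothesis bdx : boxed N M (dx phi).
Hypothesis bdt : boxed N M (dt phi).

Let cphi : continuous phi. Proof. by have [] := test_function_continuous tphi. Qed.
Let cdx : continuous (dx phi). Proof. by have [] := test_function_continuous tphi. Qed.
Let cdt : continuous (dt phi). Proof. by have [] := test_function_continuous tphi. Qed.
Let M_ge0 : 0 <= M. Proof. exact: ltW. Qed.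

Lemma dx_steps x t : \int[mu]_y (dx phi (y, t) * step (y - x)) = - phi (x, t).
Proof.
apply: (@step_pairing _ (fun y => phi (y, t)) (fun y => dx phi (y, t)) N).
- exact: slice_x_continuous.
- by move=> y; exact: test_function_dx tphi.
- move=> y Ny; split.
    by apply: (boxed_out bphi); rewrite /in_box/= leNgt Ny.
  by apply: (boxed_out bdx); rewrite /in_box/= leNgt Ny.
Qed.

(** The pairing of phi with the step at the particle, written in the frame of the
    particle: there the jump stays at the origin, and the time derivative can be
    taken under the integral. *)
Definition test_mass xi t := \int[mu]_y (phi (X t xi + y, t) * step y).

Lemma test_mass_derive (xi t : R) : 0 < t -> is_derive t 1 (test_mass xi)
  (\int[mu]_y (dt phi (y, t) * step (y - X t xi)) - vel P Vx A (X t) xi * phi (X t xi, t)).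
Proof.
move=> t0.
pose f s y := phi (X s xi + y, s) * step y.
pose v s := vel P Vx A (X s) xi.
have dX (s y : R) : 0 < s -> is_derive s 1 (fun s => X s xi + y) (v s).
  move=> s0; have := is_deriveD (X_derive xi s0) (is_derive_cst y s (1 : R)).
  by rewrite addr0.
have df (s y : R) : 0 < s -> is_derive s 1 (f^~ y)
   ((dx phi (X s xi + y, s) * v s + dt phi (X s xi + y, s)) * step y).
  move=> s0.
  have h := chain_rule (fun x r => test_function_dx x r tphi)
    (fun x r => test_function_dt x r tphi) cdx (dX s y s0).
  have := is_deriveZ (step y) h.
  rewrite [step y *: _]mulrC; congr is_derive.
  by apply/funext => r; rewrite /f /= [RHS]mulrC.
have v_le s : `|v s| <= 2 * A by exact: (vel_bound P Vxi A_gt0 normVx aA).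
have t1 : `]0, t + 1[%classic t by rewrite /= in_itv/= t0; lra.
pose M' := M * (2 * A) + M.
have M'0 : 0 <= M' by rewrite addr_ge0// mulr_ge0.
pose r := `|xi| + 2 * A * (t + 1).
have int s : `]0, t + 1[%classic s -> mu.-integrable setT (EFin \o f s).
  by move=> _; exact: (integrable_window_step (X s xi) s M_ge0 bphi cphi).
have der s y : `]0, t + 1[%classic s -> setT y -> derivable (f^~ y) s 1.
  by rewrite /= in_itv/= => /andP[s0 _] _; have [] := df s y s0.
have dom s y : `]0, t + 1[%classic s -> setT y ->
    `|partial1of2 f s y| <= M' * \1_(`[- (N + r), N + r]%classic) y.
  rewrite /= in_itv/= => /andP[s0 st] _; rewrite /partial1of2 derive1E.
  have [_ ->] := df s y s0.
  apply: (@boxed_window _ N M' (fun z => dx phi z * v s + dt phi z)) => //.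
    move=> z; rewrite mulrDl (le_trans (ler_normD _ _))// lerD//.
    rewrite normrM [M * _ * _]mulrAC; apply: ler_pM => //; exact: bdx.
  by apply: X_size; [exact: ltW|rewrite addr_ge0// ltW].
have G0 y : 0 <= M' * \1_(`[- (N + r), N + r]%classic) y by rewrite mulr_ge0// indicE.
have iG := integrable_cst_itv M' (N + r).
have D1 := @derivable_under_integral R _ (measurableTypeR R) mu f setT measurableT
  t 0 (t + 1) t1 int der _ G0 iG dom.
have D2 := @differentiation_under_integral R _ (measurableTypeR R) mu f setT measurableT
  t 0 (t + 1) t1 int der _ G0 iG dom.
split; first exact: D1.
rewrite -derive1E D2.
transitivity (\int[mu]_y (v t * (dx phi (X t xi + y, t) * step y) +
    dt phi (X t xi + y, t) * step y)).
  apply: eq_Rintegral => y _; rewrite /partial1of2 derive1E.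
  by have [_ ->] := df t y t0; ring.
rewrite RintegralD//.
- rewrite RintegralZl//; last exact: (integrable_window_step (X t xi) t M_ge0 bdx cdx).
  by rewrite (shift_steps (X t xi) t cdx) (shift_steps (X t xi) t cdt) dx_steps -/(v t) [LHS]addrC mulrN.
- exact: (integrable_scale (v t) (integrable_window_step (X t xi) t M_ge0 bdx cdx)).
- exact: (integrable_window_step (X t xi) t M_ge0 bdt cdt).
Qed.

Definition balance xi t :=
  \int[mu]_y (dt phi (y, t) * step (y - X t xi)) - vel P Vx A (X t) xi * phi (X t xi, t).

Lemma steps_dt_continuous xi :
  continuous (fun t => \int[mu]_y (dt phi (y, t) * step (y - X t xi))).
Proof.
have -> : (fun t => \int[mu]_y (dt phi (y, t) * step (y - X t xi))) =
  (fun t => \int[mu]_y (dt phi (X t xi + y, t) * step y)).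
  by apply/funext => t; rewrite shift_steps.
apply: (@moving_steps_continuous _ N M _ (fun t => X t xi) id) => //.
by move=> t; exact: cvg_id.
Qed.

Lemma phi_along_continuous xi : continuous (fun t => phi (X t xi, t)).
Proof.
move=> t; apply: (@continuous_comp _ _ _ (fun s : R => (X s xi, s)) phi); last exact: cphi.
by apply: (@cvg_pair _ _ _ (nbhs t) (nbhs (X t xi)) (nbhs t)); [exact: X_cont|exact: cvg_id].
Qed.

Lemma balance_continuous xi : continuous (balance xi).
Proof.
move=> t; apply: cvgB; first exact: steps_dt_continuous.
by apply: cvgM; [exact: vel_continuous|exact: phi_along_continuous].
Qed.

Lemma late_balance xi t : N < `|t| -> balance xi t = 0.
Proof.
move=> Nt; rewrite /balance (boxed_out bphi) ?mulr0 ?subr0; last first.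
  by rewrite /in_box/= (leNgt `|t|) Nt andbF.
rewrite /Rintegral integral0_eq// => y _; rewrite (boxed_out bdt) ?mul0r//.
by rewrite /in_box/= (leNgt `|t|) Nt andbF.
Qed.

(** Along each particle path, the fundamental theorem of calculus. *)
Lemma particle_balance xi :
  \int[mu]_t (pos_time t * balance xi t) = - \int[mu]_x (phi (x, 0) * step (x - xi)).
Proof.
have N1 : 0 < N + 1 by rewrite addr_gt0.
have cb := @balance_continuous xi.
have ct : continuous (test_mass xi).
  apply: (@moving_steps_continuous _ N M _ (fun t => X t xi) id) => //.
  by move=> t; exact: cvg_id.
have FTC : \int[mu]_(t in `[0, N + 1]) balance xi t = test_mass xi (N + 1) - test_mass xi 0.
  rewrite /Rintegral (@continuous_FTC2 _ (balance xi) (test_mass xi) 0 (N + 1) N1 (continuous_subspaceT cb))//.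
    split.
    - by move=> t; rewrite in_itv/= => /andP[t0 _]; have [] := test_mass_derive xi t0.
    - exact: cvg_at_right_filter (ct 0).
    - exact: cvg_at_left_filter (ct (N + 1)).
  move=> t; rewrite in_itv/= => /andP[t0 _]; rewrite derive1E.
  by have [_ ->] := test_mass_derive xi t0.
have end0 : test_mass xi (N + 1) = 0.
  rewrite /test_mass /Rintegral integral0_eq// => y _.
  rewrite (boxed_out bphi) ?mul0r// /in_box/= [`|N + 1|]gtr0_norm//.
  by rewrite (leNgt (N + 1)) ltrDl ltr01 andbF.
have start0 : test_mass xi 0 = \int[mu]_x (phi (x, 0) * step (x - xi)).
  by rewrite /test_mass shift_steps// X_start.
rewrite -start0 -[RHS]add0r -[X in _ = X + _]end0 -FTC -Rintegral_itv_obnd_cbnd; last first.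
  apply: (integrableS _ _ _ (continuous_compact_integrable (@segment_compact _ 0 (N + 1))
    (continuous_subspaceT cb))) => //; exact: subset_itv_oc_cc.
rewrite [RHS]Rintegral_mkcond; apply: eq_Rintegral => t _.
rewrite patchE mem_setE in_itv/= /pos_time; case: (ltP 0 t) => t0 /=; last by rewrite mul0r.
rewrite mul1r; case: (leP t (N + 1)) => // tN; apply: late_balance.
by rewrite gtr0_norm//; lra.
Qed.


Local Notation U := (U P X).

Lemma integrable_slice (f : R * R -> R) (t : R) : boxed N M f -> continuous f ->
  mu.-integrable setT (EFin \o (fun x => f (x, t))).
Proof.
move=> fb cf; apply: (integrable_boxed_slice M_ge0 fb).
exact: (continuous_measurable_fun (slice_x_continuous cf)).
Qed.

Lemma spacetime_intE (f : R * R -> R) :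
  spacetime_int f = \int[mu]_t (pos_time t * \int[mu]_x f (x, t)).
Proof.
rewrite /spacetime_int Rintegral_mkcond; apply: eq_Rintegral => t _.
rewrite patchE mem_setE in_itv/= andbT /pos_time.
by case: (0 < t); rewrite ?mul1r ?mul0r.
Qed.

Lemma dx_mean t : \int[mu]_y dx phi (y, t) = 0.
Proof.
have h := dx_steps (- N - 1) t.
rewrite (boxed_out bphi) ?oppr0 in h; last first.
  rewrite /in_box/= -opprD normrN gtr0_norm ?addr_gt0//.
  by rewrite (leNgt (N + 1)) ltrDl ltr01.
transitivity (\int[mu]_y (2 * (dx phi (y, t) * step (y - (- N - 1))))).
  apply: eq_Rintegral => y _; have [yN|Ny] := leP `|y| N.
    rewrite /step (_ : 0 <= y - (- N - 1)); last by move: yN; rewrite ler_norml; lra.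
    by rewrite /=; field.
  by rewrite (boxed_out bdx) ?mul0r ?mulr0// /in_box/= (leNgt `|y|) Ny.
rewrite RintegralZl//; first by rewrite h mulr0.
apply: (@integrable_dominated _ _ _ mu _ (fun y : R => `|dx phi (y, t)|)).
- apply: measurable_funM; first exact: (continuous_measurable_fun (slice_x_continuous cdx)).
  by apply: (measurableT_comp (@measurable_step R)); exact: measurable_funB.
- exact: (integrable_norm (integrable_slice t bdx cdx)).
- by move=> y; rewrite normrM ler_piMr// step_le1.
Qed.

Lemma U_dx t : \int[mu]_x (U (x, t) * dx phi (x, t)) = \int[P]_xi - phi (X t xi, t).
Proof.
transitivity (\int[mu]_x (dx phi (x, t) * U (x, t))).
  by apply: eq_Rintegral => x _; rewrite mulrC.
rewrite (integral_U c_gt0 X_start X_expands t (integrable_slice t bdx cdx)).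
by apply: eq_Rintegral => xi _; exact: dx_steps.
Qed.

Lemma U_dt t : \int[mu]_x (U (x, t) * dt phi (x, t)) =
  \int[P]_xi \int[mu]_x (dt phi (x, t) * step (x - X t xi)).
Proof.
transitivity (\int[mu]_x (dt phi (x, t) * U (x, t))).
  by apply: eq_Rintegral => x _; rewrite mulrC.
exact: (integral_U c_gt0 X_start X_expands t (integrable_slice t bdt cdt)).
Qed.

Lemma U_square_dx t : \int[mu]_x (U (x, t) ^+ 2 * dx phi (x, t)) =
  \int[P]_xi (- (2 * G xi) * phi (X t xi, t)).
Proof.
have iD := integrable_slice t bdx cdx.
have G1 xi : `|G xi| <= 1.
  by rewrite (le_trans (centered_cdf_bound _ _))// invf_le1// ler1n.
have mG := measurable_ccdf0 P.
pose J x := \int[P]_xi (G xi * step (x - X t xi)).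
have mJ : measurable_fun setT J.
  apply: (@measurable_Rintegral_param _ _ (measurableTypeR R) (measurableTypeR R) R P 1
    (fun z : measurableTypeR R * measurableTypeR R => G z.2 * step (z.1 - X t z.2))).
    exact: (measurable_wstepX c_gt0 X_start X_expands t mG).
  by move=> z; rewrite normrM mulr_ile1// step_le1.
have J1 x : `|J x| <= 1.
  apply: Rintegral_prob_bound.
    exact: (measurableT_comp (measurable_wstepX c_gt0 X_start X_expands t mG) (pair1_measurable x)).
  by move=> xi; rewrite normrM mulr_ile1// step_le1.
have iJ : mu.-integrable setT (EFin \o (fun x => dx phi (x, t) * J x)).
  apply: (@integrable_dominated _ _ _ mu _ (fun y : R => `|dx phi (y, t)|)).
  - apply: measurable_funM => //; exact: (continuous_measurable_fun (slice_x_continuous cdx)).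
  - exact: (integrable_norm iD).
  - by move=> y; rewrite normrM ler_piMr.
pose k := 4^-1 + \int[P]_xi G xi.
transitivity (\int[mu]_x (k * dx phi (x, t) + 2 * (dx phi (x, t) * J x))).
  apply: eq_Rintegral => x _.
  by rewrite (U_square Gcont c_gt0 X_start X_expands) -/k -/(J x); ring.
rewrite RintegralD//; last 2 first.
- exact: (integrable_scale k iD).
- exact: (integrable_scale 2 iJ).
rewrite !RintegralZl// dx_mean mulr0 add0r.
rewrite /J (integral_steps c_gt0 X_start X_expands t mG G1 iD) -RintegralZl//.
  by apply: eq_Rintegral => xi _; rewrite dx_steps; ring.
have e xi : G xi * \int[mu]_x (dx phi (x, t) * step (x - X t xi)) = G xi * - phi (X t xi, t).
  by rewrite dx_steps.
rewrite (_ : (fun xi => _) = (fun xi => G xi * - phi (X t xi, t))); last exact/funext.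
apply: (@integrable_bounded _ _ _ P M).
  apply: measurable_funM => //; apply: measurableT_comp => //.
  apply: (measurableT_comp (f := fun x => phi (x, t)) (g := X t)) => //.
  exact: (continuous_measurable_fun (slice_x_continuous cphi)).
move=> xi; rewrite normrM normrN; apply: (le_trans _ (boxed_le (X t xi, t) M_ge0 bphi)).
by rewrite ler_piMl.
Qed.

End one_test_function.
Local Notation T := (measurableTypeR R).
Local Notation U := (U P X).

Section label_time.
Variables (N M' : R) (g : T * T -> R).
Hypothesis M'_ge0 : 0 <= M'.
Hypothesis mg : measurable_fun setT g.
Hypothesis g_bound : forall z, `|g z| <= M' * (`|z.2| <= N)%R%:R.

Lemma label_time_integrable :
  (P \x mu)%E.-integrable setT (EFin \o (fun z => g z * pos_time z.2)).
Proof.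
apply: (@integrable_time_bounded _ P M' N) => //.
  apply: measurable_funM => //; exact: (measurableT_comp (@measurable_pos_time R)).
move=> z; rewrite normrM; apply: le_trans (g_bound z); rewrite ler_piMr//.
by rewrite /pos_time; case: (0 < z.2); rewrite ?normr1 ?normr0.
Qed.

Lemma label_time21 : \int[mu]_t (pos_time t * \int[P]_xi g (xi, t)) =
  \int[(P \x mu)%E]_z (g z * pos_time z.2).
Proof.
rewrite -(Rintegral21 label_time_integrable); apply: eq_Rintegral => t _ /=.
rewrite RintegralZr//; first by rewrite mulrC.
apply: (@integrable_bounded _ _ _ P M').
  exact: (measurableT_comp mg (pair2_measurable t)).
by move=> xi; apply: (le_trans (g_bound _)) => /=; rewrite ler_piMr//; case: (`|t| <= N).
Qed.

Lemma label_time12 : \int[P]_xi \int[mu]_t (pos_time t * g (xi, t)) =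
  \int[(P \x mu)%E]_z (g z * pos_time z.2).
Proof.
rewrite -(Rintegral12 label_time_integrable); apply: eq_Rintegral => xi _ /=.
by apply: eq_Rintegral => t _; rewrite mulrC.
Qed.

End label_time.

Lemma ess_sup_bound (f : R -> R) (C : R) : 0 <= C -> (forall x, `|f x| <= C) ->
  ('N[mu]_+oo[EFin \o f] <= C%:E)%E.
Proof.
move=> C0 fC; rewrite unlock; case: ifP => _; last by rewrite lee_fin.
by apply/ess_sup_inf.ess_supP; apply: aeW => x; rewrite /= lee_fin.
Qed.

(** Every space-time integral of the weak formulation is turned into an integral
    over labels and times of a function along the paths; what remains is the
    average over the labels of [particle_balance]. *)
Lemma flow_weak_solution : exists Ux : R * R -> R,
  [/\ weak_dx U Ux, Linfty_loc_Linfty Ux & weak_solution A Vx G U Ux].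
Proof.
(* the inverse of (A - a) t, as a power to be measurable on the whole line *)
pose k (t : R) := ((A - a) * t) `^ (-1).
have kE t : 0 < t -> k t = ((A - a) * t)^-1.
  by move=> t0; rewrite /k powR_inv1// mulr_ge0// ltW.
have mk : measurable_fun setT k.
  apply: (measurableT_comp (@measurable_powR R (-1))); exact: measurable_funM.
have k0 t : 0 < t -> 0 <= k t by move=> t0; rewrite /k powR_ge0.
have Xm t (S : set R) : 0 < t -> measurable S -> (P (X t @^-1` S) <= (k t)%:E * mu S)%E.
  move=> t0 mS; rewrite kE//; apply: expands_measure => //; first exact: mulr_gt0.
  exact: X_expands.
have [u [mu_ u_bound u_dens]] := spread_density mX2 mk k0 Xm.
have density := @density_test _ P X mX2 _ u mu_ u_bound u_dens.
have mdrift := measurable_drift_plane.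
have mvel := measurable_vel_plane.
have mG1 : measurable_fun setT (fun z : T * T => G z.1).
  exact: (measurableT_comp (measurable_ccdf0 P)).
have drift_le t z : `|drift P Vx (X t) z| <= a by exact: (drift_bound P Vxi normVx).
have vel_le t xi : `|vel P Vx A (X t) xi| <= 2 * A by exact: (vel_bound P Vxi A_gt0 normVx aA).
have a0 : 0 <= a by exact: (norm_bound_ge0 normVx).
have in_time N (z : R * R) (M : R) : 0 <= M -> M * (in_box N z)%:R <= M * (`|z.2| <= N)%R%:R.
  move=> M0; rewrite ler_wpM2l// /in_box; case: (`|z.2| <= N); rewrite ?andbF//.
  by case: (_ && _).
exists u; split.
- move=> phi tphi'.
  have tphi : test_function setT phi by case: tphi' => h1 h2 h3; split.
  have [N [M [N0 M0 b1 b2 b3]]] := test_function_boxed tphi.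
  have [c1 c2 c3] := test_function_continuous tphi.
  have [_ ->] := density M N phi (ltW M0) (measurable_plane c1)
     (fun z => le_trans (b1 z) (in_time N z M (ltW M0))).
  rewrite spacetime_intE -Rintegral_opp; apply: eq_Rintegral => t _.
  by rewrite (U_dx tphi M0 b1 b2) Rintegral_opp mulrN.
- split; first exact: measurable_funS mu_.
  move=> t1 t2 t10 t12; exists (((A - a) * t1)^-1); apply: aeW => t /andP[h1 h2].
  have t0 : 0 < t by exact: lt_le_trans h1.
  apply: ess_sup_bound; first by rewrite invr_ge0 mulr_ge0// ltW.
  move=> x; have /andP[u0 u1] := u_bound (x, t); rewrite ger0_norm//.
  apply: (le_trans u1); rewrite /= /pos_time t0 mulr1 kE// lef_pV2 ?posrE ?mulr_gt0//.
  by rewrite ler_pM2l.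
- move=> phi tphi VxU.
  have [N [M [N0 M0 bphi bdx bdt]]] := test_function_boxed tphi.
  have [cphi cdx cdt] := test_function_continuous tphi.
  have M_ge0 := ltW M0.
  have mphi := measurable_plane cphi.
  have mU := measurable_U B_ge0 c_gt0 X_start X_lip X_expands.
  have U1 z : `|U z| <= 1.
    by rewrite (le_trans (U_bound c_gt0 X_start X_expands z))// invf_le1// ler1n.
  have half (f : R * R -> R) : (mu \x mu)%E.-integrable setT (EFin \o f) -> spacetime_integrable f.
    move=> fi; apply: (integrableS measurableT) fi => //.
    by apply: measurableX => //; exact: measurable_itv.
  have I1 : spacetime_integrable (fun z => U z * dt phi z).
    apply: half; apply: (integrable_boxed_plane M_ge0 (N := N)); last first.
      by apply: measurable_funM => //; exact: measurable_plane.
    by move=> z; apply: le_trans (bdt z); rewrite normrM ler_piMl.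
  have I2 : spacetime_integrable (fun z => U z ^+ 2 * dx phi z).
    apply: half; apply: (integrable_boxed_plane M_ge0 (N := N)); last first.
      by apply: measurable_funM; [exact: measurable_funX|exact: measurable_plane].
    by move=> z; apply: le_trans (bdx z); rewrite normrM ler_piMl// normrX exprn_ile1.
  have g3_bound z : `|drift P Vx (X z.2) z.1 * phi z| <= a * M * (`|z.2| <= N)%R%:R.
    rewrite normrM -mulrA ler_pM//; apply: le_trans (bphi z) _; exact: in_time.
  have aM0 : 0 <= a * M by rewrite mulr_ge0.
  have mg3 := measurable_funM mdrift mphi.
  have [I3 S3] := density (a * M) N (fun z => drift P Vx (X z.2) z.1 * phi z) aM0 mg3 g3_bound.
  have VE : (fun z => u z * VxU z * phi z) =
      (fun z => u z * (drift P Vx (X z.2) z.1 * phi z)).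
    by apply/funext => -[x t]; rewrite /VxU (conv_U c_gt0 X_start X_expands Vxi)/= mulrA.
  split => //; first by rewrite VE.
  rewrite VE S3 !spacetime_intE.
  pose g1 (z : T * T) := \int[mu]_x (dt phi (x, z.2) * step (x - X z.2 z.1)).
  pose g2 (z : T * T) := - (2 * G z.1) * phi (X z.2 z.1, z.2).
  pose g3 (z : T * T) := drift P Vx (X z.2) (X z.2 z.1) * phi (X z.2 z.1, z.2).
  pose gv (z : T * T) := vel P Vx A (X z.2) z.1 * phi (X z.2 z.1, z.2).
  pose L := \int[mu]_y (M * \1_(`[- N, N]%classic) y).
  have L0 : 0 <= L by apply: Rintegral_ge0 => y _; rewrite mulr_ge0// indicE.
  have mphiX : measurable_fun setT (fun z : T * T => phi (X z.2 z.1, z.2)).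
    exact: (measurableT_comp mphi mPhi).
  have phiX z : `|phi (X z.2 z.1, z.2)| <= M * (`|z.2| <= N)%R%:R.
    by apply: le_trans (bphi _) _; exact: in_time.
  have m1 : measurable_fun setT g1.
    apply: caratheodory_measurable => [t|xi].
      have h : measurable_fun setT (fun x : R => \int[mu]_y (dt phi (x + y, t) * step y)).
        apply: continuous_measurable_fun.
        by apply: (@moving_steps_continuous _ N M _ id (cst t)) => // x; [exact: cvg_id|exact: cvg_cst].
      rewrite (_ : (fun xi => _) = (fun x => \int[mu]_y (dt phi (x + y, t) * step y)) \o X t).
        exact: (measurableT_comp h (mX t)).
      by apply/funext => xi; rewrite /g1/= shift_steps.
    exact: (@steps_dt_continuous phi tphi N M M0 bdt xi).
  have b1 z : `|g1 z| <= L * (`|z.2| <= N)%R%:R.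
    have [zN|Nz] := leP `|z.2| N; last first.
      rewrite mulr0 /g1 /Rintegral integral0_eq ?normr0// => y _.
      by rewrite (boxed_out bdt) ?mul0r// /in_box/= (leNgt `|z.2|) Nz andbF.
    have dtb y : `|dt phi (y, z.2) * step (y - X z.2 z.1)| <= M * \1_(`[- N, N]%classic) y.
      rewrite normrM (@le_trans _ _ (`|dt phi (y, z.2)| * 1))//.
        by rewrite ler_wpM2l// step_le1.
      rewrite mulr1 (le_trans (bdt _))// ler_wpM2l// indicE mem_setE in_itv/= -ler_norml.
      by rewrite /in_box/= zN andbT.
    have ii : mu.-integrable setT (EFin \o (fun y => dt phi (y, z.2) * step (y - X z.2 z.1))).
      apply: (@integrable_dominated _ _ _ mu _ (fun y : R => M * \1_(`[- N, N]%classic) y)) => //.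
        apply: measurable_funM; first exact: (continuous_measurable_fun (slice_x_continuous cdt)).
        by apply: (measurableT_comp (@measurable_step R)); exact: measurable_funB.
      exact: integrable_cst_itv.
    rewrite mulr1 /g1; apply: (le_trans (le_normr_Rintegral measurableT ii)).
    apply: le_Rintegral => //; first exact: (integrable_norm ii).
    exact: integrable_cst_itv.
  have m2 : measurable_fun setT g2.
    apply: measurable_funM => //; apply: measurableT_comp => //.
    exact: measurable_funM.
  have b2 z : `|g2 z| <= M * (`|z.2| <= N)%R%:R.
    rewrite /g2 normrM normrN; apply: le_trans (phiX z); rewrite ler_piMl// normrM.
    have := centered_cdf_bound P z.1; rewrite (ger0_norm (x := 2))//; lra.
  have m3 : measurable_fun setT g3 by exact: (measurableT_comp mg3 mPhi).
  have b3 z : `|g3 z| <= a * M * (`|z.2| <= N)%R%:R.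
    exact: (g3_bound (X z.2 z.1, z.2)).
  have mv : measurable_fun setT gv by exact: measurable_funM.
  have bv z : `|gv z| <= 2 * A * M * (`|z.2| <= N)%R%:R.
    by rewrite normrM -mulrA ler_pM//; exact: phiX.
  have AM0 : 0 <= 2 * A * M by rewrite mulr_ge0.
  pose I (g : T * T -> R) := \int[(P \x mu)%E]_z (g z * pos_time z.2).
  have i1 := label_time_integrable L0 m1 b1.
  have i2 := label_time_integrable M_ge0 m2 b2.
  have i3 := label_time_integrable aM0 m3 b3.
  have iv := label_time_integrable AM0 mv bv.
  have e1 : \int[mu]_t (pos_time t * \int[mu]_x (U (x, t) * dt phi (x, t))) = I g1.
    rewrite /I -(label_time21 L0 m1 b1); apply: eq_Rintegral => t _.
    by rewrite (U_dt tphi M0 bdt).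
  have e2 : \int[mu]_t (pos_time t * \int[mu]_x (U (x, t) ^+ 2 * dx phi (x, t))) = I g2.
    rewrite /I -(label_time21 M_ge0 m2 b2); apply: eq_Rintegral => t _.
    by rewrite (U_square_dx tphi N0 M0 bphi bdx).
  have e3 : \int[mu]_t (pos_time t * \int[P]_xi
      (drift P Vx (X t) (X t xi) * phi (X t xi, t))) = I g3.
    by rewrite /I -(label_time21 aM0 m3 b3).
  have combine : A / 2 * I g2 + I g3 = - I gv.
    rewrite /I -Rintegral_opp -RintegralZl// -RintegralD//; last first.
      exact: (integrable_scale (A / 2) i2).
    by apply: eq_Rintegral => z _; rewrite /g2 /g3 /gv /vel; field.
  have balanced : I g1 - I gv = - \int[mu]_x (G x * phi (x, 0)).
    rewrite /I -RintegralB//.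
    have mb := measurable_funB m1 mv.
    have bb z : `|g1 z - gv z| <= (L + 2 * A * M) * (`|z.2| <= N)%R%:R.
      by rewrite mulrDl (le_trans (ler_normB _ _))// lerD.
    transitivity (\int[(P \x mu)%E]_z ((g1 z - gv z) * pos_time z.2)).
      by apply: eq_Rintegral => z _; rewrite mulrBl.
    rewrite -(label_time12 (addr_ge0 L0 AM0) mb bb).
    transitivity (\int[P]_xi - \int[mu]_x (phi (x, 0) * step (x - X 0 xi))).
      apply: eq_Rintegral => xi _.
      by rewrite (X_start _ (lexx 0)); exact: (particle_balance tphi N0 M0 bphi bdx bdt xi).
    rewrite Rintegral_opp -(integral_U c_gt0 X_start X_expands 0 (integrable_slice M0 0 bphi cphi)).
    by congr (- _); apply: eq_Rintegral => x _; rewrite (U_start P X_start) mulrC.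
  have alg (s1 s2 s3 s0 p1 p2 p3 pv : R) : s1 = p1 -> s2 = p2 -> s3 = p3 ->
      A / 2 * p2 + p3 = - pv -> p1 - pv = - s0 -> - s1 - s0 = A / 2 * s2 + s3.
    by move=> -> -> -> -> h; rewrite -[s0]opprK -h; ring.
  exact: (alg _ _ _ _ _ _ _ _ e1 e2 e3 combine balanced).
Qed.

End weak_form.

(** * Integrability of the kernel *)

Section smooth_functions.
Context (R : realType).

(** The classical function with a zero of infinite order at the origin, multiplied
    by powers of 1/x so that the family is stable under differentiation. *)
Definition flat (n : nat) (x : R) : R :=
  if 0 < x then x^-1 ^+ n * expR (- x^-1) else 0.

Lemma flat_bound n (x : R) : 0 < x -> x^-1 ^+ n.+1 * expR (- x^-1) <= (n.+2)`!%:R * x.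
Proof.
move=> x0; set y := x^-1; have y0 : 0 < y by rewrite invr_gt0.
have := expR_ge1Dxn n.+1 (ltW y0) => h.
have K0 : (0 : R) < (n.+2)`!%:R by rewrite ltr0n fact_gt0.
have {}h : y ^+ n.+2 <= (n.+2)`!%:R * expR y.
  rewrite mulrC -ler_pdivrMr//; apply: le_trans h; lra.
rewrite expRN ler_pdivrMr ?expR_gt0//.
rewrite -(ler_pM2r y0) -exprSr; apply: (le_trans h).
by rewrite mulrAC -[_ * x * y]mulrA mulfV ?mulr1// gt_eqF.
Qed.

Lemma flat_derive n (x : R) : is_derive x 1 (flat n) (flat n.+2 x - n%:R * flat n.+1 x).
Proof.
have [x0|x0|x0] := ltgtP x 0.
- have near0 : \near x, cst 0 x = flat n x.
    near=> y; rewrite /flat ltNge (_ : y <= 0)//; apply: ltW; near: y.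
    exact: lt_nbhsl.
  apply: (near_eq_is_derive near0).
  by rewrite /flat ltNge (ltW x0)/= mulr0 subr0; exact: is_derive_cst.
- have nearx : \near x, (fun y : R => y^-1 ^+ n * expR (- y^-1)) x = flat n x.
    near=> y; rewrite /flat (_ : 0 < y)//; near: y; exact: lt_nbhsr.
  apply: (near_eq_is_derive nearx).
  have dV : is_derive x 1 (fun y : R => y^-1) (- x ^- 2 *: 1).
    by apply: is_deriveV; rewrite ?gt_eqF//; exact: is_derive_id.
  have dE : is_derive x 1 (fun y : R => expR (- y^-1)) (expR (- x^-1) * - (- x ^- 2 *: 1)).
    by apply: (@is_derive1_comp _ expR (fun y => - y^-1)); exact: is_deriveN.
  have := is_deriveM (is_deriveX n dV) dE; rewrite exprfctE => h.
  apply: (is_derive_eq h); rewrite /flat x0 -exprVn /=.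
  rewrite -[_ *: 1]/(_ * 1) -[_ *: (expR _ * _)]/(_ * _) -[_ *: (_ *: _)]/(_ * (_ * _)) mulr1.
  case: n {nearx h} => [|n].
    by rewrite !expr0 !mul0r mulr0 addr0 subr0 mul1r expr2; ring.
  rewrite !exprS expr0 /=; move: (x^-1 ^+ n) (expR _) => p e; ring.
- rewrite x0 /flat ltxx mulr0 subr0.
  suff h : h^-1 *: (flat n (h *: 1 + 0) - flat n 0) @[h --> 0^'] --> (0 : R).
    by split; [apply/cvg_ex; eexists; exact: h|exact/cvg_lim].
  apply/cvgrPdist_lt => e e0; near=> h.
  rewrite sub0r normrN addr0 [h *: 1]mulr1 {2}/flat ltxx subr0.
  have h0 : h != 0 by near: h; exact: nbhs_dnbhs_neq.
  have K0 : (0 : R) < (n.+2)`!%:R by rewrite ltr0n fact_gt0.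
  have hK : `|h| < e / (n.+2)`!%:R.
    by near: h; apply: dnbhs0_lt; rewrite divr_gt0.
  rewrite /flat; case: (ltP 0 h) => hp; last by rewrite scaler0 normr0.
  rewrite [_ *: _]mulrA -exprS ger0_norm ?mulr_ge0 ?exprn_ge0 ?invr_ge0 ?(ltW hp) ?expR_ge0//.
  apply: (le_lt_trans (flat_bound n hp)).
  by rewrite mulrC -ltr_pdivlMr//; rewrite gtr0_norm in hK.
Unshelve. all: by end_near. Qed.

Lemma flat_ge0 n x : 0 <= flat n x.
Proof.
rewrite /flat; case: ltP => // x0.
by rewrite mulr_ge0 ?expR_ge0// exprn_ge0// invr_ge0 ltW.
Qed.

Lemma flat_le1 x : flat 0 x <= 1.
Proof.
rewrite /flat; case: ltP => // x0; rewrite expr0 mul1r -expR0 ler_expR oppr_le0.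
by rewrite invr_ge0 ltW.
Qed.

(** The functions generated by constants, the identity and the flat functions
    under sums, products and composition: this class is closed under
    differentiation by the rules of calculus. *)
Inductive smooth : (R -> R) -> Prop :=
| smooth_cst c : smooth (fun=> c)
| smooth_id : smooth (fun x => x)
| smooth_flat n : smooth (flat n)
| smooth_add f g : smooth f -> smooth g -> smooth (fun x => f x + g x)
| smooth_mul f g : smooth f -> smooth g -> smooth (fun x => f x * g x)
| smooth_comp f g : smooth f -> smooth g -> smooth (fun x => f (g x)).

Lemma smooth_derive f : smooth f ->
  exists2 f', smooth f' & forall x : R, is_derive x 1 f (f' x).
Proof.
elim=> [c||n|{}f g _ [f' sf df] _ [g' sg dg]|{}f g sf0 [f' sf df] sg0 [g' sg dg]|
        {}f g sf0 [f' sf df] sg0 [g' sg dg]].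
- by exists (fun=> 0); [exact: smooth_cst|move=> x; exact: is_derive_cst].
- by exists (fun=> 1); [exact: smooth_cst|move=> x; exact: is_derive_id].
- exists (fun x => flat n.+2 x + (- n%:R) * flat n.+1 x).
    apply: smooth_add; first exact: smooth_flat.
    by apply: smooth_mul; [exact: smooth_cst|exact: smooth_flat].
  by move=> x; have := flat_derive n x; rewrite mulNr.
- by exists (fun x => f' x + g' x); [exact: smooth_add|move=> x; exact: is_deriveD].
- exists (fun x => f x * g' x + g x * f' x).
    by apply: smooth_add; exact: smooth_mul.
  by move=> x; exact: is_deriveM.
- exists (fun x => f' (g x) * g' x).
    by apply: smooth_mul => //; exact: smooth_comp.
  by move=> x; exact: is_derive1_comp.
Qed.

Lemma smooth_is_Ck k f : smooth f -> is_Ck k f.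
Proof.
elim: k f => [|k IH] f /smooth_derive[f' sf df]; first by split => //; exact: is_derive_continuous df.
split; first exact: is_derive_continuous df.
move=> v; have dfx x : differentiable f x.
  by apply/derivable1_diffP; have [] := df x.
split; first by move=> x; apply: diff_derivable.
have -> : 'D_v f = (fun x => v * f' x).
  apply/funext => x; rewrite deriveE// diff1E// derive1E.
  by have [_ ->] := df x.
by apply: IH; apply: smooth_mul => //; exact: smooth_cst.
Qed.

(** The flat function composed with itself: flat 0 (1/2 - flat 0 x) is constant for
    x <= 0, where the inner function vanishes, and zero once the inner function
    exceeds 1/2, which holds for x >= 2 as exp (- 1/2) >= 1/2. *)
Lemma smooth_cutoff : exists S S' : R -> R, exists C : R,
  [/\ smooth S, (forall x, is_derive (x : R) 1 S (S' x)),
      continuous S', 0 < C &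
      forall x, [/\ `|S x| <= C, (x <= 0 -> S x = 1), (2 <= x -> S x = 0) &
        `|S' x| <= C * \1_(`[0, 2]%classic) x]].
Proof.
pose k : R := (flat 0 2^-1)^-1.
have f2 : 0 < flat 0 (2^-1 : R) by rewrite /flat invr_gt0 ltr0n expr0 mul1r expR_gt0.
have k0 : 0 < k by rewrite invr_gt0.
pose S (x : R) := k * flat 0 (2^-1 + (-1) * flat 0 x).
have sS : smooth S.
  apply: smooth_mul; first exact: smooth_cst.
  apply: (smooth_comp (f := flat 0) (g := fun x => 2^-1 + (-1) * flat 0 x)); first exact: smooth_flat.
  apply: smooth_add; first exact: smooth_cst.
  by apply: smooth_mul; [exact: smooth_cst|exact: smooth_flat].
have [S' sS' dS] := smooth_derive sS.
have cS' : continuous S'.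
  have [S'' _ d2] := smooth_derive sS'; exact: is_derive_continuous d2.
have SL x : x <= 0 -> S x = 1.
  by move=> x0; rewrite /S {2}/flat ltNge x0/= mulr0 addr0 mulVf// gt_eqF.
have SR x : 2 <= x -> S x = 0.
  move=> x2; have x0 : 0 < x by lra.
  rewrite /S {1}/flat ltNge (_ : _ <= 0) ?mulr0//= mulN1r subr_le0 /flat x0 expr0 mul1r.
  apply: le_trans (expR_ge1Dx _).
  have : x^-1 <= 2^-1 by rewrite lef_pV2 ?posrE//.
  lra.
have [M M0 HM] : exists2 M, 0 < M & forall x, x \in `[0, 2] -> `|S' x| <= M.
  have := compact_bounded (continuous_compact (continuous_subspaceT cS') (@segment_compact _ (0 : R) 2)).
  rewrite /bounded_near/= => hb.
  have b0 : \forall M \near +oo, (0 : R) < M by exact: nbhs_pinfty_gt.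
  have [M [M0 HM]] := filter_ex (filterI b0 hb); exists M => // x x02.
  by apply: (HM (S' x)); exists x.
have d0 x (c : R) : (\near x, S x = c) -> S' x = 0.
  move=> nx; have [_ <-] := dS x; rewrite -(@derive_cst _ R R c x 1).
  exact: near_eq_derive.
exists S, S', (k + M); split => //; first exact: addr_gt0.
move=> x; split.
- rewrite /S normrM (gtr0_norm k0) ger0_norm ?flat_ge0//.
  apply: (@le_trans _ _ k); last by rewrite lerDl ltW.
  by rewrite ler_piMr ?flat_le1// ltW.
- exact: SL.
- exact: SR.
- rewrite indicE mem_setE in_itv/=; case: (boolP (0 <= x <= 2)) => x02.
    by rewrite mulr1; apply: (le_trans (HM x _)); rewrite ?in_itv//= lerDr ltW.
  rewrite mulr0 normr_le0; apply/eqP.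
  move: x02; rewrite negb_and -!ltNge => /orP[x0|x2].
    apply: (@d0 x 1); near=> y; apply: SL; apply: ltW; near: y; exact: lt_nbhsl.
  apply: (@d0 x 0); near=> y; apply: SR; apply: ltW; near: y; exact: lt_nbhsr.
Unshelve. all: by end_near. Qed.

End smooth_functions.

Section kernel_integrable.
Context (R : realType).
Notation mu := (@lebesgue_measure R).
Variables V Vx : R -> R.
Hypothesis VW : W11_with_deriv V Vx.

Let Vi : mu.-integrable setT (EFin \o V). Proof. by case: VW. Qed.
Let Vxi : mu.-integrable setT (EFin \o Vx). Proof. by case: VW. Qed.
Let mV : measurable_fun setT V. Proof. exact: measurable_L1 Vi. Qed.
Let mVx' : measurable_fun setT Vx. Proof. exact: measurable_L1 Vxi. Qed.

Lemma integrable_times (f g : R -> R) (C : R) : mu.-integrable setT (EFin \o f) ->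
  measurable_fun setT g -> (forall x, `|g x| <= C) ->
  mu.-integrable setT (EFin \o (fun x => f x * g x)).
Proof.
move=> fi mg gC.
have mf : measurable_fun setT f by exact: measurable_L1 fi.
apply: (@integrable_dominated _ _ _ mu _ (fun x : R => C * `|f x|)).
- exact: measurable_funM.
- exact: (integrable_scale C (integrable_norm fi)).
- by move=> x; rewrite normrM mulrC ler_wpM2r.
Qed.

Lemma test_translates (S : R -> R) (x y : R) : smooth S ->
  (forall z, z <= 0 -> S z = 1) -> (forall z, 2 <= z -> S z = 0) ->
  test_function setT (fun z => S (z - x) - S (z - y)).
Proof.
move=> sS SL SR.
have sh (c : R) : smooth (fun z => S (z - c)).
  apply: (smooth_comp (f := S) (g := fun z => z - c)) => //.
  by apply: smooth_add; [exact: smooth_id|exact: smooth_cst].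
have sp : smooth (fun z => S (z - x) - S (z - y)).
  have := smooth_add (sh x) (smooth_mul (smooth_cst (-1)) (sh y)).
  by congr smooth; apply/funext => z; rewrite mulN1r.
split => //; first by move=> k; exact: smooth_is_Ck.
pose l := Num.min x y; pose r := Num.max x y + 2.
have lx : l <= x by rewrite ge_min lexx.
have ly : l <= y by rewrite ge_min lexx orbT.
have xr : x + 2 <= r by rewrite lerD2r le_max lexx.
have yr : y + 2 <= r by rewrite lerD2r le_max lexx orbT.
apply: (subclosed_compact _ (@segment_compact _ l r)); first exact: closed_closure.
have -> : `[l, r]%classic = closure `[l, r]%classic.
  by apply/closure_id; exact: interval_closed.
apply: closure_subset => z /=; rewrite in_itv/=; apply: contraR => zlr; apply/eqP.
move: zlr; rewrite negb_and -!ltNge => /orP[zl|rz].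
  by rewrite !SL ?subrr//; lra.
by rewrite !SR ?subrr//; lra.
Qed.

Lemma translates_limit (f h : R -> R) (C l : R) (s : nat -> R) :
  mu.-integrable setT (EFin \o f) -> measurable_fun setT h -> (forall x, `|h x| <= C) ->
  (forall z, \forall n \near \oo, h (z - s n) = l) ->
  \int[mu]_z (f z * h (z - s n)) @[n --> \oo] --> \int[mu]_z (f z * l).
Proof.
move=> fi mh hC hl.
have mf : measurable_fun setT f by exact: measurable_L1 fi.
have [| | | | |_ _] := @dominated_convergence _ _ _ mu setT measurableT
  (fun n => EFin \o (fun z : R => f z * h (z - s n))) (EFin \o (fun z : R => f z * l))
  (EFin \o (fun z : R => C * `|f z|)).
- move=> n; apply/measurable_EFinP; apply: measurable_funM => //.
  by apply: (measurableT_comp mh); exact: measurable_funB.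
- by apply/measurable_EFinP; exact: measurable_funM.
- apply: aeW => z _; apply: cvg_near_cst; apply: filterS (hl z) => n /= ->.
  by [].
- exact: (integrable_scale C (integrable_norm fi)).
- apply: aeW => z n _ /=; rewrite lee_fin normrM mulrC ler_wpM2r//.
have fl : mu.-integrable setT (EFin \o (fun z => f z * l)).
  by apply: (@integrable_times _ _ `|l|).
rewrite -(EFin_Rintegral measurableT fl); exact: fine_cvg.
Qed.

(** Testing the weak derivative against S (z - x) - S (z - y), with S a smooth
    cutoff, shows that W + T does not depend on the point, where W x and T x are
    the integrals of V S' (. - x) and of Vx S (. - x).  As the point tends to
    either infinity, W vanishes and T tends to the integral of Vx or to 0; thus
    Vx has mean zero and T = - W.  Replacing S (. - x) by the sharp cutoff at x
    turns T x into kerV Vx x, at the cost of the mass of Vx in [x, x + 2]. *)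
Lemma kerV_local_bound : exists2 C, 0 <= C & forall x,
  `|kerV Vx x| <= C * \int[mu]_z ((`|V z| + `|Vx z|) * \1_(`[0, 2]%classic) (z - x)).
Proof.
have [S [S' [C [sS dS cS' C0 H]]]] := smooth_cutoff R.
have SC x : `|S x| <= C by have [] := H x.
have SL x : x <= 0 -> S x = 1 by have [] := H x.
have SR x : 2 <= x -> S x = 0 by have [] := H x.
have S'C x : `|S' x| <= C * \1_(`[0, 2]%classic) x by have [] := H x.
have S'C2 x : `|S' x| <= C.
  by apply: (le_trans (S'C x)); rewrite ler_piMr ?(ltW C0)// indicE; case: (_ \in _).
have mS : measurable_fun setT S.
  by apply: continuous_measurable_fun; exact: is_derive_continuous dS.
have mS' : measurable_fun setT S' by exact: continuous_measurable_fun.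
have msh (f : R -> R) (c : R) : measurable_fun setT f -> measurable_fun setT (fun z : R => f (z - c)).
  by move=> mf; apply: (measurableT_comp mf); exact: measurable_funB.
pose W x := \int[mu]_z (V z * S' (z - x)).
pose T x := \int[mu]_z (Vx z * S (z - x)).
have iW x : mu.-integrable setT (EFin \o (fun z => V z * S' (z - x))).
  by apply: (integrable_times Vi (msh _ _ mS')) => z; exact: S'C2.
have iT x : mu.-integrable setT (EFin \o (fun z => Vx z * S (z - x))).
  by apply: (integrable_times Vxi (msh _ _ mS)) => z; exact: SC.
have WT x y : W x + T x = W y + T y.
  have tf := test_translates x y sS SL SR.
  have [_ _ /(_ _ tf)] := VW.
  have dsh c z : is_derive (z : R) 1 (fun z => S (z - c)) (S' (z - c)).
    have := @is_derive1_comp _ S (fun z => z - c) z (S' (z - c)) 1 (dS _).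
    rewrite mulr1; apply.
    have := is_deriveD (is_derive_id z (1 : R)) (is_derive_cst (- c) z (1 : R)).
    by rewrite addr0.
  have -> : (\int[mu]_z (V z * ((fun z => S (z - x) - S (z - y))^`()%classic z))) = W x - W y.
    rewrite /W -RintegralB//; apply: eq_Rintegral => z _.
    by rewrite derive1E; have [_ ->] := is_deriveB (dsh x z) (dsh y z); rewrite mulrBr.
  have -> : (\int[mu]_z (Vx z * (S (z - x) - S (z - y)))) = T x - T y.
    by rewrite /T -RintegralB//; apply: eq_Rintegral => z _; rewrite mulrBr.
  move: (W x) (W y) (T x) (T y) => a b c d h; rewrite -[a](subrK b) h; ring.
have W0 (s : nat -> R) : (forall z, \forall n \near \oo, z - s n < 0 \/ 2 < z - s n) ->
    W (s n) @[n --> \oo] --> (0 : R).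
  move=> hs; have -> : 0 = \int[mu]_z (V z * 0).
    by rewrite /Rintegral integral0_eq// => z _; rewrite mulr0.
  apply: (@translates_limit V S' C) => // z; apply: filterS (hs z) => n h.
  apply/eqP; rewrite -normr_le0; apply: (le_trans (S'C _)).
  rewrite indicE mem_setE in_itv/= (_ : (_ && _) = false) ?mulr0//.
  by apply/negbTE; rewrite negb_and -!ltNge; case: h => ->; rewrite ?orbT.
have grow (z : R) : \forall n \near \oo, z + 2 < n%:R by exact: nbhs_infty_gtr.
pose K := W 0 + T 0.
have KE x : W x + T x = K by exact: WT.
have limK (l : R) : (fun=> K) @ \oo --> l -> K = l.
  by move=> h; rewrite -(cvg_lim (@Rhausdorff R) h) (lim_cst (@Rhausdorff R)).
have right : K = \int[mu]_z (Vx z * 1).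
  apply: limK.
  rewrite -[X in _ --> X]add0r (_ : (fun n => K) = (fun n : nat => W n%:R + T n%:R)); last first.
    by apply/funext => n; rewrite KE.
  apply: cvgD; first by apply: W0 => z; apply: filterS (grow z) => n h; left; lra.
  by apply: (@translates_limit Vx S C) => // z; apply: filterS (grow z) => n h; apply: SL; lra.
have left : K = 0.
  apply: limK.
  rewrite (_ : (fun n => K) = (fun n : nat => W (- n%:R) + T (- n%:R))); last first.
    by apply/funext => n; rewrite KE.
  have T0 : 0 = \int[mu]_z (Vx z * 0).
    by rewrite /Rintegral integral0_eq// => z _; rewrite mulr0.
  rewrite -[X in _ --> X]add0r; apply: cvgD.
    by apply: W0 => z; apply: filterS (grow (- z)) => n h; right; lra.
  rewrite T0; apply: (@translates_limit Vx S C) => // z; apply: filterS (grow (- z)) => n h.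
  by apply: SR; lra.
have Vx0 : \int[mu]_z Vx z = 0.
  by rewrite -left right; apply: eq_Rintegral => z _; rewrite mulr1.
exists C; first exact: ltW.
move=> x.
pose g z := Vx z * step (x - z) - Vx z * S (z - x) - V z * S' (z - x) + 2^-1 * Vx z.
have iK := integrable_kerV Vxi x.
have iH : mu.-integrable setT (EFin \o (fun z => 2^-1 * Vx z)).
  exact: (integrable_scale 2^-1 Vxi).
have i1 : mu.-integrable setT (EFin \o (fun z => Vx z * step (x - z) - Vx z * S (z - x))).
  by have := integrableB measurableT iK (iT x); apply: eq_integrable.
have i2 : mu.-integrable setT (EFin \o (fun z => Vx z * step (x - z) - Vx z * S (z - x) - V z * S' (z - x))).
  by have := integrableB measurableT i1 (iW x); apply: eq_integrable.
have ig : mu.-integrable setT (EFin \o g).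
  by have := integrableD measurableT i2 iH; apply: eq_integrable.
have -> : kerV Vx x = \int[mu]_z g z.
  rewrite RintegralD// RintegralB// RintegralB// RintegralZl// Vx0 mulr0 addr0.
  rewrite -/(W x) -/(T x) -/(kerV Vx x) -addrA -opprD [T x + _]addrC KE left; ring.
apply: (le_trans (le_normr_Rintegral measurableT ig)).
have iB : mu.-integrable setT (EFin \o (fun z => (`|V z| + `|Vx z|) * \1_(`[0, 2]%classic) (z - x))).
  apply: (@integrable_times _ _ 1).
  - by have := integrableD measurableT (integrable_norm Vi) (integrable_norm Vxi); apply: eq_integrable.
  - by apply: (msh (\1_(`[0, 2]%classic))); exact: measurable_indic_itv.
  - by move=> z; rewrite indicE; case: (_ \in _); rewrite ?normr1 ?normr0.
rewrite -RintegralZl//; apply: le_Rintegral => //.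
- exact: (integrable_norm ig).
- exact: (integrable_scale C iB).
move=> z _; rewrite mulrDl mulrDr addrC.
have -> : g z = Vx z * (step (x - z) + 2^-1 - S (z - x)) - V z * S' (z - x) by rewrite /g; ring.
rewrite (le_trans (ler_normB _ _))// !normrM lerD//; last by rewrite mulrCA ler_wpM2l.
rewrite mulrCA ler_wpM2l// /step subrK indicE mem_setE in_itv/=.
have [zx|xz] := leP z x.
  rewrite (_ : 0 <= x - z) ?SL ?subrr ?normr0 ?mulr_ge0 ?(ltW C0)//; lra.
rewrite (_ : 0 <= x - z = false); last by apply/negbTE; rewrite -ltNge; lra.
rewrite sub0r normrN; have [z2|z2] := leP (z - x) 2.
  by rewrite (_ : 0 <= z - x) ?mulr1//; lra.
by rewrite SR ?normr0 ?mulr_ge0 ?(ltW C0)// ltW.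
Qed.

Lemma integrable_kernel : mu.-integrable setT (EFin \o kerV Vx).
Proof.
have [C C0 H] := kerV_local_bound.
have mI : measurable_fun setT (\1_(`[0, 2]%classic) : R -> R) by exact: measurable_indic_itv.
pose f z := `|V z| + `|Vx z|.
have f0 z : 0 <= f z by rewrite addr_ge0.
have fi : mu.-integrable setT (EFin \o f).
  by have := integrableD measurableT (integrable_norm Vi) (integrable_norm Vxi); apply: eq_integrable.
have mf : measurable_fun setT f by exact: measurable_L1 fi.
have I0 z : 0 <= (\1_(`[0, 2]%classic) z : R) by rewrite indicE.
pose w (p : measurableTypeR R * measurableTypeR R) := (C * (f p.2 * \1_(`[0, 2]%classic) ((p.2 : R) - p.1)))%:E.
have mw : measurable_fun setT w.
  apply/measurable_EFinP; apply: measurable_funM => //; apply: measurable_funM.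
    exact: (measurableT_comp mf).
  by apply: (measurableT_comp mI); exact: measurable_funB.
have w0 p : (0 <= w p)%E by rewrite lee_fin !mulr_ge0.
apply/integrableP; split; first by apply/measurable_EFinP; exact: measurable_kerV.
apply: (@le_lt_trans _ _ (\int[mu]_x \int[mu]_z w (x, z))%E).
  apply: ge0_le_integral => //.
  - by apply: measurableT_comp => //; apply/measurable_EFinP; exact: measurable_kerV.
  - exact: (@measurable_fun_fubini_tonelli_F _ _ (measurableTypeR R) (measurableTypeR R) R mu w mw w0).
  move=> x _; rewrite /= (_ : (fun z => w (x, z)) =
      EFin \o (fun z => C * (f z * \1_(`[0, 2]%classic) (z - x)))); last exact/funext.
  have iB : mu.-integrable setT (EFin \o (fun z => f z * \1_(`[0, 2]%classic) (z - x))).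
    apply: (@integrable_times _ _ 1) => //.
    - by apply: (measurableT_comp mI); exact: measurable_funB.
    - by move=> z; rewrite indicE; case: (_ \in _); rewrite ?normr1 ?normr0.
  have iC : mu.-integrable setT (EFin \o (fun z => C * (f z * \1_(`[0, 2]%classic) (z - x)))).
    exact: (integrable_scale C iB).
  by rewrite -EFin_Rintegral// lee_fin RintegralZl.
rewrite (@fubini_tonelli _ _ (measurableTypeR R) (measurableTypeR R) R mu mu w mw w0).
have -> : (\int[mu]_z \int[mu]_x w (x, z) = \int[mu]_z (2 * C * f z)%:E)%E.
  apply: eq_integral => z _.
  rewrite (@integral_reflect _ (fun y => (C * (f z * \1_(`[0, 2]%classic) y))%:E) z).
    transitivity (\int[mu]_x ((C * f z)%:E * (\1_(`[0, 2]%classic) x)%:E))%E.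
      by apply: eq_integral => y _; rewrite -EFinM mulrA.
    rewrite ge0_integralZl//; last 2 first.
    - exact/measurable_EFinP.
    - by rewrite lee_fin mulr_ge0.
    rewrite integral_indic// setIT.
    have m2 : mu (`[0%R, 2%R]%classic : set R) = 2%:E.
      by rewrite lebesgue_measure_itv/= lte_fin ltr0n/= -EFinB subr0.
    rewrite [X in (_ * X)%E](_ : _ = 2%:E); last exact: m2.
    by rewrite -EFinM; congr EFin; ring.
  by apply/measurable_EFinP; do 2 apply: measurable_funM => //.
have iC : mu.-integrable setT (EFin \o (fun z => 2 * C * f z)).
  exact: (integrable_scale (2 * C) fi).
by rewrite -EFin_Rintegral// ltry.
Qed.

End kernel_integrable.

(** * Comparison of superpositions of steps *)

Section superpositions.
Context (R : realType).
Notation mu := (@lebesgue_measure R).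
Variable P : probability (measurableTypeR R) R.
Local Notation T := (measurableTypeR R).

Lemma step_gap (p q : R) : (\int[mu]_x `|step (x - p) - step (x - q)|%:E = `|p - q|%:E)%E.
Proof.
have gap (u v : R) : u <= v ->
    (\int[mu]_x `|step (x - u) - step (x - v)|%:E = (v - u)%:E)%E.
  move=> uv; transitivity (\int[mu]_x (\1_(`[u, v[%classic) x)%:E)%E.
    apply: eq_integral => x _; congr EFin.
    rewrite /step indicE mem_setE in_itv/= !subr_ge0.
    case: (leP v x) => vx; case: (leP u x) => ux /=.
    - by rewrite subrr normr0.
    - by have := lt_le_trans ux (le_trans uv vx); rewrite ltxx.
    - by rewrite opprB addrA subrK subr0 normr1.
    - by rewrite subrr normr0.
  rewrite integral_indic// setIT [LHS]lebesgue_measure_itv/= lte_fin.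
  by case: ltP => // vu; rewrite (@le_anti _ _ u v) ?subrr// uv.
have [pq|qp] := leP p q; first by rewrite gap// ler0_norm ?subr_le0// opprB.
rewrite gtr0_norm ?subr_gt0// -(gap _ _ (ltW qp)).
by apply: eq_integral => x _; rewrite distrC.
Qed.

(** Two superpositions of steps are as close in L1 as the positions of the
    steps are on average, since moving one step costs the distance moved. *)
Lemma superposition_gap (X Y : R -> R) : measurable_fun setT X -> measurable_fun setT Y ->
  (\int[mu]_x `|\int[P]_xi step (x - X xi) - \int[P]_xi step (x - Y xi)|%:E <=
   \int[P]_xi `|X xi - Y xi|%:E)%E.
Proof.
move=> mX mY.
have ms (Z : R -> R) : measurable_fun setT Z ->
    measurable_fun [set: T * T] (fun z : T * T => step ((z.1 : R) - Z z.2)).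
  move=> mZ; apply: (measurableT_comp (@measurable_step R)); apply: measurable_funB => //.
  exact: (measurableT_comp mZ).
have is_ (Z : R -> R) (x : R) : measurable_fun setT Z ->
    P.-integrable setT (EFin \o (fun xi => step (x - Z xi))).
  move=> mZ; apply: (@integrable_bounded _ _ _ P 2^-1); last by move=> xi; exact: step_bound.
  exact: (measurableT_comp (ms Z mZ) (pair1_measurable x)).
pose w (z : T * T) := (`|step ((z.1 : R) - X z.2) - step ((z.1 : R) - Y z.2)|)%:E.
have mw : measurable_fun setT w.
  apply/measurable_EFinP; apply: measurableT_comp => //.
  by apply: measurable_funB; exact: ms.
have w0 z : (0 <= w z)%E by rewrite lee_fin.
apply: (@le_trans _ _ (\int[mu]_x \int[P]_xi w (x, xi))%E).
  apply: ge0_le_integral => //.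
  - apply/measurable_EFinP; apply: measurableT_comp => //.
    by apply: measurable_funB; apply: (@measurable_Rintegral_param _ _ T T R P 2^-1 _ (ms _ _)) => // z;
      exact: step_bound.
  - exact: (@measurable_fun_fubini_tonelli_F _ _ T T R P w mw w0).
  - move=> x _; rewrite -RintegralB//; [|exact: is_..].
    have iB : P.-integrable setT (EFin \o (fun xi => step (x - X xi) - step (x - Y xi))).
      by have := integrableB measurableT (is_ X x mX) (is_ Y x mY); apply: eq_integrable.
    rewrite (EFin_normr_Rintegral measurableT iB).
    by apply: le_abse_integral => //; exact: measurable_int iB.
rewrite (@fubini_tonelli _ _ T T R mu P w mw w0).
apply: ge0_le_integral => //.
- by move=> xi _; apply: integral_ge0.
- exact: (@measurable_fun_fubini_tonelli_G _ _ T T R mu w mw w0).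
- by apply/measurable_EFinP; apply: measurableT_comp => //; exact: measurable_funB.
- by move=> xi _; rewrite -step_gap.
Qed.

(** A Lipschitz function that is large somewhere is large on an interval. *)
Lemma lipschitz_sup (D : R -> R) (La N : R) : 0 < La -> measurable_fun setT D ->
  (forall x y, `|D x - D y| <= La * `|x - y|) ->
  (\int[mu]_x `|D x|%:E <= N%:E)%E -> forall x, `|D x| ^+ 2 <= 2 * La * N.
Proof.
move=> La0 mD lip DN x; set d := `|D x|.
have d0 : 0 <= d by exact: normr_ge0.
pose h := d / (2 * La).
have h0 : 0 <= h by rewrite divr_ge0// mulr_ge0// ltW.
have mI : measurable_fun setT (\1_(`[x - h, x + h]%classic) : R -> R) by exact: measurable_indic_itv.
have lo : ((d / 2 * (2 * h))%:E <= \int[mu]_x `|D x|%:E)%E.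
  have -> : (d / 2 * (2 * h))%:E = (\int[mu]_y ((d / 2) * \1_(`[x - h, x + h]%classic) y)%:E)%E.
    transitivity ((d / 2)%:E * \int[mu]_y (\1_(`[x - h, x + h]%classic) y)%:E)%E; last first.
      rewrite -ge0_integralZl//; first exact/measurable_EFinP.
      by rewrite lee_fin divr_ge0.
    rewrite integral_indic// setIT EFinM; congr (_ * _)%E.
    rewrite [RHS]lebesgue_measure_itv/= lte_fin.
    case: ltP => hh; first by rewrite -EFinB; congr EFin; ring.
    have -> : h = 0 by move: hh h0; clearbody h; lra.
    by rewrite mulr0.
  apply: ge0_le_integral => //.
  - by move=> y _; rewrite lee_fin mulr_ge0 ?divr_ge0// indicE.
  - by apply/measurable_EFinP; exact: measurable_funM.
  - by apply/measurable_EFinP; exact: measurableT_comp.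
  - move=> y _; rewrite lee_fin indicE mem_setE in_itv/=.
    case: (boolP (x - h <= y <= x + h)) => yh; last by rewrite mulr0.
    rewrite mulr1; have xy : `|x - y| <= h by rewrite ler_norml; lra.
    have := lip x y; have := lerB_dist (D x) (D y); rewrite -/d.
    have : La * `|x - y| <= d / 2.
      apply: (@le_trans _ _ (La * h)); first by rewrite ler_pM2l.
      by rewrite /h; apply: eq_ler; field; rewrite gt_eqF.
    lra.
have := le_trans lo DN; rewrite lee_fin => k.
have -> : d ^+ 2 = 2 * La * (d / 2 * (2 * h)) by rewrite /h; field; rewrite gt_eqF.
by rewrite ler_pM2l// mulr_gt0.
Qed.

(** Interpolation between L1 and the sup norm: |D| ^ r <= d ^ (r - 1) |D|. *)
Lemma Lnorm_interpolation (D : R -> R) (d N r : R) : 1 < r -> 0 <= d ->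
  measurable_fun setT D -> (forall x, `|D x| <= d) ->
  (\int[mu]_x `|D x|%:E <= N%:E)%E ->
  ('N[mu]_r%:E[EFin \o D] <= ((d `^ (r - 1) * N) `^ r^-1)%:E)%E.
Proof.
move=> r1 d0 mD Dd DN; have r0 : 0 < r by exact: lt_trans r1.
have ri : 0 <= r^-1 by rewrite invr_ge0 ltW.
rewrite unlock /= -poweR_EFin.
have I0 : (0 <= \int[mu]_x (`|D x| `^ r)%:E)%E.
  by apply: integral_ge0 => x _; rewrite lee_fin powR_ge0.
have le : (\int[mu]_x (`|D x| `^ r)%:E <= (d `^ (r - 1) * N)%:E)%E.
  apply: (@le_trans _ _ (\int[mu]_x (d `^ (r - 1) * `|D x|)%:E)%E).
    apply: ge0_le_integral => //.
    - apply/measurable_EFinP; apply: (measurableT_comp (@measurable_powR R r)).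
      exact: measurableT_comp.
    - by apply/measurable_EFinP; apply: measurable_funM => //; exact: measurableT_comp.
    - move=> x _; rewrite lee_fin.
      rewrite -[X in _ `^ X <= _](subrK 1) (@powRD _ `|D x| (r - 1) 1) ?powRr1//; last first.
        by rewrite subrK gt_eqF.
      by rewrite ler_wpM2r//; apply: ge0_ler_powR; rewrite ?nnegrE ?subr_ge0 ?(ltW r1).
  under eq_integral do rewrite EFinM.
  rewrite ge0_integralZl//; last 2 first.
  - by apply/measurable_EFinP; exact: measurableT_comp.
  - by rewrite lee_fin powR_ge0.
  by rewrite EFinM lee_wpmul2l// lee_fin powR_ge0.
apply: gt0_ler_poweR => //; rewrite in_itv/= ?leey ?andbT//.
exact: le_trans I0 le.
Qed.

Lemma powR_le1D (k s : R) : 0 <= k -> 0 <= s <= 1 -> k `^ s <= 1 + k.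
Proof.
move=> k0 /andP[s0 s1]; have k1 : 1 <= 1 + k by rewrite lerDl.
apply: (@le_trans _ _ ((1 + k) `^ s)).
  by apply: ge0_ler_powR => //; rewrite ?nnegrE ?addr_ge0// lerDr.
rewrite -[leRHS](powRr1 (ltW (lt_le_trans ltr01 k1))).
exact: ler_powR.
Qed.

End superpositions.

(** * Rate of convergence to the rarefaction wave *)

Section rate.
Context (R : realType).
Notation mu := (@lebesgue_measure R).
Local Notation T := (measurableTypeR R).
Variable P : probability T R.
Local Notation G := (centered_cdf P).
Hypothesis Gcont : continuous G.
Hypothesis moment : P.-integrable setT (EFin \o (fun xi : R => `|xi|)).
Variable Vx : R -> R.
Hypothesis Vxi : mu.-integrable setT (EFin \o Vx).
Hypothesis Ki : mu.-integrable setT (EFin \o kerV Vx).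
Variables (A a : R).
Hypothesis A_gt0 : 0 < A.
Hypothesis normVx : \int[mu]_w `|Vx w| <= a.
Hypothesis aA : a < A.
Variables (K : R -> R) (X : R -> R -> R).
Hypothesis X_start : forall t xi, t <= 0 -> X t xi = xi.
Hypothesis X_lip : forall s t xi, `|X t xi - X s xi| <= 2 * A * `|t - s|.
Hypothesis X_expands : forall t, 0 < t -> expands P ((A - a) * t) (X t).
Hypothesis X_taylor : forall t0 t xi, 0 < t0 -> 0 <= t ->
  `|X t xi - X t0 xi - (t - t0) * vel P Vx A (X t0) xi| <= K t0 * (t - t0) ^+ 2.
Local Notation c := (A - a).

Let B_ge0 : 0 <= 2 * A. Proof. by rewrite mulr_ge0// ltW. Qed.
Let c_gt0 : 0 < c. Proof. by rewrite subr_gt0. Qed.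
Let mX t : measurable_fun setT (X t) := measurable_X c_gt0 X_start X_expands t.
Let a0 : 0 <= a := norm_bound_ge0 normVx.

Let kappa := \int[mu]_z `|kerV Vx z|.
Let kappa0 : 0 <= kappa. Proof. exact: Rintegral_ge0. Qed.

(** Chosen so that drift_const / (2 + t) dominates a for t <= 1, and
    kappa / (c * t) for t >= 1. *)
Definition drift_const : R := 3 * a + 3 * kappa / c.
Local Notation C2 := drift_const.

Lemma drift_const_ge0 : 0 <= C2.
Proof. by apply: addr_ge0; [exact: mulr_ge0|apply: divr_ge0; [exact: mulr_ge0|exact: ltW]]. Qed.

Lemma drift_rate (t z : R) : 0 < t -> `|drift P Vx (X t) z| <= C2 / (2 + t).
Proof.
move=> t0; have t2 : 0 < 2 + t by rewrite addr_gt0.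
rewrite ler_pdivlMr//; set d := `|_|.
have d1 : d <= a by exact: (drift_bound P Vxi normVx).
have d2 : d * (c * t) <= kappa.
  have := drift_decay Gcont Vxi z (mulr_gt0 c_gt0 t0) (X_expands t0).
  have -> : (\int[mu]_w `|kerV Vx w|%:E = kappa%:E)%E.
    by rewrite /kappa EFin_Rintegral//; exact: (integrable_norm Ki).
  by rewrite -EFinM lee_fin mulrC ler_pdivlMr// mulr_gt0.
have d0 : 0 <= d by exact: normr_ge0.
rewrite /C2; have k3 : 0 <= 3 * kappa / c by rewrite divr_ge0 ?mulr_ge0// ltW.
have [t1|t1] := leP t 1.
  have : d * (2 + t) <= a * 3 by rewrite ler_pM ?(ltW t2)//; lra.
  lra.
have : d * (2 + t) <= d * (3 * t) by rewrite ler_wpM2l//; lra.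
have : d * (3 * t) <= 3 * kappa / c.
  by rewrite ler_pdivlMr// -[d * _ * c](_ : 3 * (d * (c * t)) = _) ?ler_pM2l//; ring.
lra.
Qed.

Lemma ln_derive (t : R) : 0 < 2 + t -> is_derive t 1 (fun s : R => ln (2 + s)) ((2 + t)^-1).
Proof.
move=> t2; have := @is_derive1_comp _ (@ln R) (fun s => 2 + s) t (2 + t)^-1 1 (is_derive1_ln t2).
rewrite mulr1; apply.
have := is_deriveD (is_derive_cst (2 : R) t (1 : R)) (is_derive_id t (1 : R)).
by rewrite add0r.
Qed.

(** By [drift_rate], both X t xi - A t G xi and its opposite become nonincreasing
    in t when drift_const * ln (2 + t) is subtracted. *)
Lemma X_rate (t xi : R) : 0 < t -> `|X t xi - A * t * G xi| <= `|xi| + C2 * ln (2 + t).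
Proof.
move=> t0.
pose f s := X s xi - A * s * G xi.
have X_cont : continuous (fun s => X s xi) by exact: (@X_continuous _ _ _ B_ge0 X_lip xi).
have fd (s : R) : 0 < s -> is_derive s 1 f (- drift P Vx (X s) (X s xi)).
  move=> s0.
  have dX : is_derive s 1 (fun s => X s xi) (vel P Vx A (X s) xi).
    by apply: (taylor_is_derive s0) => r; exact: X_taylor.
  have dl : is_derive s 1 (fun s => A * s * G xi) (A * G xi).
    have := is_deriveZ (A * G xi) (is_derive_id s (1 : R)).
    rewrite -[_ *: 1]/(_ * 1) mulr1; congr is_derive; apply/funext => r.
    by rewrite [LHS]/(_ * _)/= mulrAC.
  have := is_deriveB dX dl; rewrite /vel; congr is_derive; ring.
have cl (s : R) : 0 <= s -> {for s, continuous (fun s : R => ln (2 + s))}.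
  move=> s0; have [|d1 _] := @ln_derive s; first by rewrite ltr_wpDr.
  exact: differentiable_continuous (proj1 (derivable1_diffP _ _) d1).
(* used with e = 1 and e = - 1, for the two sides of the estimate *)
have key (e : R) : `|e| <= 1 -> e * (f t - f 0) - C2 * (ln (2 + t) - ln (2 + 0)) <= 0.
  move=> e1; pose g s := e * f s - C2 * ln (2 + s).
  pose g' s := e * - drift P Vx (X s) (X s xi) - C2 * (2 + s)^-1.
  have dg (s : R) : s \in `]0, t[ -> is_derive s 1 g (g' s).
    rewrite in_itv/= => /andP[s0 _]; apply: is_deriveB.
      exact: (is_deriveZ e (fd s s0)).
    by apply: (is_deriveZ C2); apply: ln_derive; rewrite addr_gt0.
  have cg : {within `[0, t], continuous g}.
    apply: continuous_in_subspaceT => s; rewrite inE/= in_itv/= => /andP[s0 _].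
    apply: cvgB; apply: cvgM; [exact: cvg_cst| |exact: cvg_cst|exact: cl].
    apply: cvgB; first exact: X_cont.
    apply: cvgM; last exact: cvg_cst.
    by apply: cvgM; [exact: cvg_cst|exact: cvg_id].
  have [s] := MVT t0 dg cg; rewrite in_itv/= subr0 => /andP[s0 _] E.
  have -> : e * (f t - f 0) - C2 * (ln (2 + t) - ln (2 + 0)) = g t - g 0 by rewrite /g; ring.
  rewrite E mulr_le0_ge0 ?(ltW t0)// subr_le0.
  apply: le_trans (drift_rate (X s xi) s0); apply: (le_trans (ler_norm _)).
  by rewrite normrM normrN ler_piMl.
have f0 : f 0 = xi by rewrite /f X_start// mulr0 mul0r subr0.
have ln2 : 0 <= ln (2 + 0) :> R by rewrite ln_ge0//; lra.
have C0 := drift_const_ge0.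
have Cl : 0 <= C2 * ln (2 + 0) by rewrite mulr_ge0.
have k1 := key 1 (eq_ler (normr1 _)).
have k2 := key (- 1) (eq_ler (etrans (normrN _) (normr1 _))).
have h : `|f t - xi| <= C2 * ln (2 + t).
  move: k1 k2; rewrite f0 mulN1r mul1r mulrBr ler_norml.
  move: (C2 * ln _) (C2 * ln _) Cl (f t) => u v v0 w h1 h2; lra.
have := lerB_dist (f t) xi; rewrite -/(f t); lra.
Qed.

(** The particles of the Riemann problem move with the constant velocity A * G xi.
    They all start at the origin; for t <= 0 they are put at xi instead, so that
    the results on flows apply. *)
Definition fan (t xi : R) : R := if t <= 0 then xi else A * t * G xi.

Let fan_start t xi : t <= 0 -> fan t xi = xi.
Proof. by rewrite /fan => ->. Qed.

Let fanE t : 0 < t -> fan t = fun xi => A * t * G xi.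
Proof. by move=> t0; apply/funext => xi; rewrite /fan leNgt t0. Qed.

Let fan_expands t : 0 < t -> expands P (A * t) (fan t).
Proof. by move=> t0 zeta xi _; rewrite fanE// mulrBr. Qed.

(** As G is uniform on [-1/2, 1/2], the law of A t G is uniform on the fan. *)
Lemma fan_rarefaction (x t : R) : 0 < t -> U P fan (x, t) = rarefaction A (x, t).
Proof.
move=> t0; have At0 : 0 < A * t by exact: mulr_gt0.
pose m := x / (A * t); pose S := [set xi | (G xi <= m)%R].
have mS : measurable S by exact: measurable_ccdf0_le.
have -> : U P fan (x, t) = fine (P S) - 2^-1.
  rewrite /U /= fanE//.
  have -> : (fun xi => step (x - A * t * G xi)) = (fun xi => \1_S xi - 2^-1).
    apply/funext => xi; rewrite /step indicE subr_ge0; congr (_%:R - _); congr nat_of_bool.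
    have e : (A * t * G xi <= x) = (G xi <= m) by rewrite /m ler_pdivlMr// mulrC.
    by rewrite e; apply/idP/idP => [|/set_mem//]; exact: mem_set.
  rewrite RintegralB//.
  - by rewrite Rintegral_cst_prob /Rintegral integral_indic// setIT.
  - apply: (@integrable_bounded _ _ _ P 1); first exact: measurable_indic.
    by move=> y; rewrite indicE; case: (_ \in _); rewrite ?normr1 ?normr0.
  - by apply: (@integrable_bounded _ _ _ P `|2^-1|).
have lowE : (x <= - (A * t / 2)) = (m <= - 2^-1).
  by rewrite /m ler_pdivrMr//; congr (_ <= _); ring.
have upE : (x < A * t / 2) = (m < 2^-1).
  by rewrite /m ltr_pdivrMr//; congr (_ < _); ring.
rewrite /rarefaction lowE upE; case: ifPn => [ml|]; last rewrite -ltNge => lm.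
  suff -> : P S = 0%E by rewrite sub0r.
  apply/eqP; rewrite eq_le measure_ge0 andbT.
  have -> : 0%E = P [set xi | (G xi <= - 2^-1)%R].
    by rewrite centered_cdf_uniform ?addNr// lexx; lra.
  apply: le_measure; rewrite ?inE//; first exact: measurable_ccdf0_le.
  by move=> xi /= h; exact: le_trans ml.
case: ifPn => [mu_|]; last rewrite -leNgt => um.
  by rewrite centered_cdf_uniform ?addrK// (ltW lm) (ltW mu_).
have -> : S = setT.
  apply/seteqP; split => // xi _ /=; apply: le_trans um.
  by have := centered_cdf_bound P xi; rewrite ler_norml => /andP[].
rewrite [P _]probability_setT; rewrite /=; lra.
Qed.

Definition first_moment : R := \int[P]_xi `|xi|.

Lemma gap_L1 (t : R) : 0 < t ->
  (\int[mu]_x `|U P X (x, t) - rarefaction A (x, t)|%:E <=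
   (first_moment + C2 * ln (2 + t))%:E)%E.
Proof.
move=> t0.
have mfan : measurable_fun setT (fan t) := measurable_X A_gt0 fan_start fan_expands t.
have il : P.-integrable setT (EFin \o (fun xi : R => `|xi| + C2 * ln (2 + t))).
  have := integrableD measurableT moment (@integrable_bounded _ _ _ P `|C2 * ln (2 + t)|
     (cst (C2 * ln (2 + t))) (measurable_cst _) (fun=> lexx _)).
  by apply: eq_integrable.
under eq_integral do rewrite -fan_rarefaction//.
apply: (le_trans (superposition_gap P (mX t) mfan)).
have -> : first_moment + C2 * ln (2 + t) = \int[P]_xi (`|xi| + C2 * ln (2 + t)).
  rewrite RintegralD//; first by rewrite Rintegral_cst_prob.
  exact: (@integrable_bounded _ _ _ P `|C2 * ln (2 + t)|).
rewrite EFin_Rintegral//; apply: ge0_le_integral => //.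
- by apply/measurable_EFinP; apply: measurableT_comp => //; exact: (measurable_funB (mX t) mfan).
- exact: measurable_int il.
- by move=> xi _; rewrite fanE// lee_fin; exact: X_rate.
Qed.

Lemma gap_lipschitz (t x y : R) : 0 < t ->
  `|(U P X (x, t) - rarefaction A (x, t)) - (U P X (y, t) - rarefaction A (y, t))| <=
  2 / (c * t) * `|x - y|.
Proof.
move=> t0; rewrite -!fan_rarefaction//.
have h1 := U_lip_norm Gcont c_gt0 X_start X_expands y x t0.
have h2 := U_lip_norm Gcont A_gt0 fan_start fan_expands y x t0.
have h3 : `|x - y| / (A * t) <= `|x - y| / (c * t).
  by rewrite ler_wpM2l// lef_pV2 ?posrE ?mulr_gt0// ler_pM2r// lerBlDr lerDl.
move: (U P X (x, t)) (U P X (y, t)) (U P fan (x, t)) (U P fan (y, t)) h1 h2 => u v p q h1 h2.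
have -> : u - p - (v - q) = (u - v) - (p - q) by ring.
apply: (le_trans (ler_normB _ _)).
have -> : 2 / (c * t) * `|x - y| = `|x - y| / (c * t) + `|x - y| / (c * t) by ring.
by rewrite lerD// (le_trans h2).
Qed.

Definition L1_const : R := first_moment / ln 2 + C2 + 1.

Let ln2_gt0 : 0 < ln 2 :> R. Proof. by rewrite ln_gt0// ltr1n. Qed.

Let ln_gt0' (t : R) : 0 < t -> 0 < ln (2 + t).
Proof. by move=> t0; rewrite ln_gt0//; lra. Qed.

Let moment_ge0 : 0 <= first_moment. Proof. exact: Rintegral_ge0. Qed.

Lemma L1_const_gt0 : 0 < L1_const.
Proof.
by rewrite ltr_wpDl// addr_ge0 ?drift_const_ge0// divr_ge0// ltW.
Qed.

Lemma gap_L1_log (t : R) : 0 < t ->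
  (\int[mu]_x `|U P X (x, t) - rarefaction A (x, t)|%:E <= (L1_const * ln (2 + t))%:E)%E.
Proof.
move=> t0; apply: (le_trans (gap_L1 t0)); rewrite lee_fin /L1_const.
have l0 := ln_gt0' t0.
have ll : ln 2 <= ln (2 + t) by rewrite ler_ln ?posrE//; lra.
have : first_moment <= first_moment / ln 2 * ln (2 + t).
  by rewrite mulrAC ler_pdivlMr// ler_wpM2l.
move: (first_moment / ln 2) (ln (2 + t)) l0 => u v v0; rewrite !mulrDl mul1r; lra.
Qed.

Lemma measurable_gap (t : R) : 0 < t ->
  measurable_fun setT (fun x : R => U P X (x, t) - rarefaction A (x, t)).
Proof.
move=> t0; apply: measurable_funB; first exact: (measurable_nd (U_nd c_gt0 X_start X_expands t)).
apply: (eq_measurable_fun (fun x : R => U P fan (x, t))).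
  by move=> y _; exact: fan_rarefaction.
exact: (measurable_nd (U_nd A_gt0 fan_start fan_expands t)).
Qed.

Definition sup_const : R := Num.sqrt (4 * L1_const / c).

Lemma gap_sup (t x : R) : 0 < t ->
  `|U P X (x, t) - rarefaction A (x, t)| <=
  sup_const * t `^ (- 2^-1) * ln (2 + t) `^ 2^-1.
Proof.
move=> t0; have l0 := ln_gt0' t0; have ct : 0 < c * t by exact: mulr_gt0.
set D := fun x => U P X (x, t) - rarefaction A (x, t).
have mD : measurable_fun setT D := measurable_gap t0.
have La0 : 0 < 2 / (c * t) by rewrite divr_gt0.
have := lipschitz_sup La0 mD (fun y z => gap_lipschitz y z t0) (gap_L1_log t0) x.
have E0 : 0 <= sup_const * t `^ (- 2^-1) * ln (2 + t) `^ 2^-1.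
  by rewrite !mulr_ge0 ?sqrtr_ge0 ?powR_ge0.
have sq (y e : R) : (y `^ e) ^+ 2 = y `^ (e * 2) by rewrite -powR_mulrn ?powR_ge0// -powRrM.
move=> h; rewrite -(@ler_pXn2r _ 2) ?nnegrE//; apply: (le_trans h).
rewrite !exprMn !sq sqr_sqrtr; last first.
  by rewrite divr_ge0 ?mulr_ge0 ?(ltW L1_const_gt0) ?(ltW c_gt0).
rewrite mulNr mulVf// powRr1 ?(ltW l0)// powR_inv1 ?(ltW t0)//.
have c0 : c != 0 by rewrite gt_eqF.
have t0' : t != 0 by rewrite gt_eqF.
move: c0; move: (c) (ln (2 + t)) L1_const => k l m k0; apply: eq_ler; field.
by rewrite k0 t0'.
Qed.

Lemma gap_Lp : exists2 C : R, 0 < C &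
  forall (t : R) (p : \bar R), 0 < t -> (1 < p)%E ->
    ('N[mu]_p [EFin \o (fun x => (U P X (x, t) - rarefaction A (x, t))%R)] <=
     (C * t `^ (- (2^-1 * (1 - inv_exponent p)))
        * ln (2 + t) `^ (2^-1 * (1 + inv_exponent p)))%:E)%E.
Proof.
have k10 := L1_const_gt0; have k20 : 0 <= sup_const by exact: sqrtr_ge0.
exists ((1 + sup_const) * (1 + L1_const)).
  by apply: mulr_gt0; [exact: ltr_wpDr|exact: addr_gt0].
move=> t p t0 p1; have l0 := ln_gt0' t0.
set D := fun x => U P X (x, t) - rarefaction A (x, t).
have Dsup x : `|D x| <= sup_const * t `^ (- 2^-1) * ln (2 + t) `^ 2^-1 by exact: gap_sup.
have E0 : 0 <= sup_const * t `^ (- 2^-1) * ln (2 + t) `^ 2^-1.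
  by rewrite !mulr_ge0 ?powR_ge0.
have mD : measurable_fun setT D := measurable_gap t0.
case: p p1 => [r| |] //; last first.
  move=> _; apply: (le_trans (ess_sup_bound E0 Dsup)).
  rewrite lee_fin /inv_exponent invey /= subr0 addr0 !mulr1.
  do 2 (apply: ler_wpM2r; first exact: powR_ge0).
  by rewrite -[leLHS]mulr1 ler_pM//; [rewrite lerDr|rewrite lerDl ltW].
rewrite lte_fin => r1; have r0 : 0 < r by exact: lt_trans r1.
have ieE : inv_exponent r%:E = r^-1 by rewrite /inv_exponent inver gt_eqF.
rewrite ieE; apply: (le_trans (Lnorm_interpolation r1 E0 mD Dsup (gap_L1_log t0))).
rewrite lee_fin; set s := r^-1.
have s0 : 0 < s by rewrite invr_gt0.
have s1 : s < 1 by rewrite invf_lt1.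
have rs : (r - 1) * s = 1 - s by rewrite mulrBl mul1r mulfV// gt_eqF.
rewrite powRM ?powR_ge0 ?mulr_ge0 ?(ltW k10) ?(ltW l0)// -powRrM rs.
rewrite !powRM ?mulr_ge0 ?powR_ge0 ?(ltW k10) ?(ltW l0)// -!powRrM.
have lE : ln (2 + t) `^ (2^-1 * (1 + s)) = ln (2 + t) `^ (2^-1 * (1 - s)) * ln (2 + t) `^ s.
  rewrite -powRD; first by congr (_ `^ _); field.
  by rewrite (gt_eqF l0) implybT.
rewrite lE mulNr.
have h2 : sup_const `^ (1 - s) <= 1 + sup_const.
  by apply: powR_le1D => //; rewrite subr_ge0 (ltW s1) gerBl ltW.
have h1 : L1_const `^ s <= 1 + L1_const by apply: powR_le1D; rewrite ?ltW.
have := ler_pM (powR_ge0 _ _) (powR_ge0 _ _) h2 h1.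
move: (sup_const `^ _) (L1_const `^ s) (_ * (1 + L1_const)) (t `^ _) (powR_ge0 t (- (2^-1 * (1 - s))))
  (ln (2 + t) `^ (2^-1 * (1 - s))) (powR_ge0 (ln (2 + t)) (2^-1 * (1 - s)))
  (ln (2 + t) `^ s) (powR_ge0 (ln (2 + t)) s) => u v w q q0 y y0 z z0 h.
have -> : u * q * y * (v * z) = u * v * (q * (y * z)) by ring.
by rewrite -[leRHS]mulrA; apply: ler_wpM2r => //; rewrite !mulr_ge0.
Qed.

End rate.

(** * The law of the initial mass *)

Section initial_law.
Context (R : realType).
Notation mu := (@lebesgue_measure R).
Variable u0 : R -> R.
Hypothesis u0_L1 : in_L1 u0.
Hypothesis u0_ge0 : {ae mu, forall x : R, 0 <= u0 x}.
Hypothesis u0_mass : (\int[mu]_x (u0 x)%:E = 1)%E.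
Hypothesis u0_moment : (\int[mu]_x (u0 x * `|x|)%:E < +oo)%E.

(** The density is u0, modified on the null set where it is negative. *)
Lemma initial_law : exists P : probability (measurableTypeR R) R,
  [/\ forall B, measurable B -> (P B = \int[mu]_(x in B) (u0 x)%:E)%E,
      P.-integrable setT (EFin \o (fun xi : R => `|xi|)),
      continuous (centered_cdf P) & primitive0 u0 = centered_cdf P].
Proof.
have mu0 : measurable_fun setT u0 by exact: measurable_L1 u0_L1.
pose v x := Num.max (u0 x) 0.
have v0 x : 0 <= v x by rewrite le_max lexx orbT.
have mv : measurable_fun setT v by exact: measurable_maxr.
have vE (B : set R) (f : R -> R) : measurable B -> measurable_fun setT f ->
    (\int[mu]_(x in B) (v x * f x)%:E = \int[mu]_(x in B) (u0 x * f x)%:E)%E.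
  move=> mB mf; apply: ae_eq_integral => //.
  - by apply/measurable_EFinP; apply: measurable_funTS; exact: measurable_funM.
  - by apply/measurable_EFinP; apply: measurable_funTS; exact: measurable_funM.
  - case: u0_ge0 => N [mN N0 HN]; exists N; split => // x /= /not_implyP[_ h].
    by apply: HN => /= h2; apply: h; rewrite /v max_l.
have vE1 (B : set R) : measurable B ->
    (\int[mu]_(x in B) (v x)%:E = \int[mu]_(x in B) (u0 x)%:E)%E.
  move=> mB; have := vE B (cst 1) mB (measurable_cst _).
  by under eq_integral do rewrite mulr1; under [RHS]eq_integral do rewrite mulr1.
have v1 : (\int[mu]_x (v x)%:E = 1)%E by rewrite vE1.
have [P [PE PI]] := @integrable_density _ (measurableTypeR R) R mu v mv v0 v1.
have PE' B : measurable B -> (P B = \int[mu]_(x in B) (u0 x)%:E)%E.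
  by move=> mB; rewrite PE// vE1.
have Gi (y : R) : centered_cdf P y = \int[mu]_(x in `]-oo, y]) u0 x - 2^-1.
  by rewrite /centered_cdf PE'.
exists P; split => //; last by apply/funext => y; rewrite Gi.
  apply/integrableP; split; first by apply/measurable_EFinP; exact: measurableT_comp.
  under eq_integral do rewrite /= normr_id.
  have mn : measurable_fun [set: measurableTypeR R] (fun x : measurableTypeR R => `|x : R|%:E).
    by apply/measurable_EFinP; exact: normr_measurable.
  rewrite (PI (fun x : R => `|x|%:E) mn) => [|x]; last by rewrite lee_fin.
  under eq_integral do rewrite -EFinM mulrC.
  by rewrite vE//; exact: measurableT_comp.
apply: small_increments_continuous => e e0.
have [d [d0 Hd]] := integral_normr_continuous u0_L1 e0; exists d => //.
move=> z1 z2 z12 zd.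
have lt : (mu `]z1, z2]%classic < d%:E)%E.
  rewrite lebesgue_measure_itv/=; case: ifP => _; last by rewrite lte_fin.
  by rewrite -EFinB lte_fin.
apply: le_lt_trans (Hd `]z1, z2]%classic (measurable_itv _) lt).
have iS (B : set R) : measurable B -> mu.-integrable B (EFin \o u0).
  by move=> mB; apply: (integrableS measurableT) u0_L1.
have -> : centered_cdf P z2 - centered_cdf P z1 = \int[mu]_(x in `]z1, z2]) u0 x.
  rewrite !Gi opprB addrA subrK.
  apply: (@Rintegral_itvB R u0 (BInfty _ true) (BRight z2) z1) => //.
  by apply: iS; exact: measurable_itv.
by apply: le_normr_Rintegral => //; exact: iS.
Qed.

End initial_law.

(** * Existence and convergence to the rarefaction wave *)

Theorem theorem2p5 (R : realType) (A : R) (V Vx u0 : R -> R)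
    (A_gt0 : 0 < A)
    (VW11 : W11_with_deriv V Vx)
    (Vx_lt : ('N[lebesgue_measure]_1[EFin \o Vx] < A%:E)%E)
    (u0_L1 : in_L1 u0)
    (u0_ge0 : {ae lebesgue_measure, forall x : R, 0 <= u0 x})
    (u0_mass : (\int[lebesgue_measure]_x (u0 x)%:E = 1)%E)
    (u0_moment : (\int[lebesgue_measure]_x (u0 x * `|x|)%:E < +oo)%E) :
  exists U Ux : R * R -> R,
    [/\ {within @upper_half R, continuous U},
        weak_dx U Ux,
        Linfty_loc_Linfty Ux,
        weak_solution A Vx (primitive0 u0) U Ux &
        exists2 C : R, 0 < C &
          forall (t : R) (p : \bar R), 0 < t -> (1 < p)%E ->
            ('N[lebesgue_measure]_p
               [EFin \o (fun x => (U (x, t) - rarefaction A (x, t))%R)] <=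
             (C * t `^ (- (2^-1 * (1 - inv_exponent p)))
                * ln (2 + t) `^ (2^-1 * (1 + inv_exponent p)))%:E)%E].
Proof.
have Vxi : lebesgue_measure.-integrable setT (EFin \o Vx) by case: VW11.
pose a : R := \int[lebesgue_measure]_w `|Vx w|.
have aA : a < A.
  move: Vx_lt; rewrite Lnorm1 -lte_fin /a EFin_Rintegral//.
  exact: (integrable_norm Vxi).
have c0 : 0 < A - a by rewrite subr_gt0.
have normVx : \int[lebesgue_measure]_w `|Vx w| <= a by [].
have [P [PE Pmoment Gcont GE]] := initial_law u0_L1 u0_ge0 u0_mass u0_moment.
have e0 : 0 < (A - a) / 3 / 4 by rewrite !divr_gt0.
have [L L0 HL] := Vx_truncation Vxi e0.
have tail : 4 * \int[lebesgue_measure]_w (`|Vx w| * (L < `|Vx w|)%R%:R) <= (A - a) / 3.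
  by rewrite mulrC -ler_pdivlMr// ltW.
have [X [X_start X_lip X_expands X_taylor]] :=
  flow_exists Gcont Vxi A_gt0 normVx aA (ltW L0) tail.
have [Ux [h1 h2 h3]] := flow_weak_solution Gcont Vxi A_gt0 normVx aA X_start X_lip X_expands X_taylor.
exists (U P X), Ux; split => //.
- by apply: (U_continuous Gcont (c := A - a) (B := 2 * A)) => //; rewrite mulr_ge0// ltW.
- by rewrite GE.
- exact: (gap_Lp Gcont Pmoment Vxi (integrable_kernel VW11) A_gt0 normVx aA X_start X_lip X_expands X_taylor).
Qed.
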